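(* For each $n$, let $(X_1,\ldots,X_n)$ be jointly normal with unit variances and $\operatorname{Corr}(X_i,X_j)=\rho$ for all $i\ne j$. Under the global null hypothesis, for all $\alpha\in(0,1)$ and all $\rho\in(0,1)$, $$\lim_{n\to\infty}FDR_{BH}(n,\alpha,\rho)=1-\Phi\left[\inf_{t\in(0,1)}\frac{\Phi^{-1}(1-t\alpha)-\sqrt{1-\rho}\,\Phi^{-1}(1-t)}{\sqrt{\rho}}\right]>0.$$ Also, $\lim_{n\to\infty}FDR_{BH}(n,\alpha,0)=\lim_{n\to\infty}FDR_{BH}(n,\alpha,1)=\alpha$.
   Context: $\Phi$ is the standard normal distribution function. Testing problem: $X_i\sim\mathcal N(\mu_i,1)$; test $H_{0i}:\mu_i=0$ against $H_{1i}:\mu_i>0$, $1\le i\le n$. The global null hypothesis states that $\mu_i=0$ for all $i$. The p-values are $P_i=1-\Phi(X_i)$, and $P_{(1)}\le\cdots\le P_{(n)}$ are the ordered p-values, with corresponding null hypotheses $H_{(1)},\ldots,H_{(n)}$. For a multiple testing procedure $T$, let $V_n(T)$ be the number of rejected true null hypotheses and $R_n(T)$ the total number of rejected hypotheses. The false discovery rate is $FDR_T(n,\alpha,\rho)=\mathbb E\left[V_n(T)/\max\{R_n(T),1\}\right]$, computed under the equicorrelated model with correlation $\rho$. The Benjamini–Hochberg (BH) procedure at level $\alpha$ is the step-up procedure with cutoffs $u_i=i\alpha/n$: it rejects $H_{(1)},\ldots,H_{(m)}$ where $m=\max\{i:P_{(i)}\le i\alpha/n\}$, and rejects nothing if no such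 $i$ exists. *)

(* Defs.v *)
From HB Require Import structures.
From mathcomp Require Import all_boot all_order all_algebra.
From mathcomp Require Import all_classical all_reals all_analysis.

Set Implicit Arguments.
Unset Strict Implicit.
Unset Printing Implicit Defensive.

Import Order.TTheory GRing.Theory Num.Theory.
Import numFieldNormedType.Exports.

Local Open Scope classical_set_scope.
Local Open Scope ring_scope.

Section normal.
Context {R : realType}.

Definition Phi (x : R) : R := fine (normal_prob 0 1 `]-oo, x]).

(* The value outside the range ]0, 1[ of Phi is irrelevant. *)
Definition PhiV : R -> R := 'pinv_(fun=> 0) [set: R] Phi.

Context d (T : measurableType d) (P : probability T R).

(* The normal law N(m, s^2). When s = 0 it is the point mass at m, whereas
   [normal_prob m 0] is by convention the uniform law on [0, 1]. *)
Definition normally_distributed (m s : R) (Y : T -> R) : Prop :=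
  forall A : set R, measurable A ->
    P (Y @^-1` A) = if s == 0 then \d_m A else normal_prob m s A.

(* Degenerate covariances are allowed, as needed for correlation 1. *)
Definition jointly_normal n (X : 'I_n -> {RV P >-> R}) : Prop :=
  forall a : 'I_n -> R, exists m s : R,
    0 <= s /\ normally_distributed m s (fun w => \sum_(i < n) a i * X i w).

Definition correlation (X Y : {RV P >-> R}) : R :=
  fine (covariance P X Y) /
  (Num.sqrt (fine ('V_P[X])) * Num.sqrt (fine ('V_P[Y]))).

Definition equicorrelated_normal n (X : 'I_n -> {RV P >-> R})
    (mu : 'I_n -> R) (rho : R) : Prop :=
  [/\ jointly_normal X,
      forall i, ('E_P[X i] = (mu i)%:E)%E,
      forall i, ('V_P[X i] = 1)%E &
      forall i j, i != j -> correlation (X i) (X j) = rho].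

End normal.

Section multiple_testing.
Context {R : realType}.

Definition pvalue (x : R) : R := 1 - Phi x.

(* A multiple testing procedure maps the p-values to the set of (indices of)
   rejected hypotheses. *)
Definition procedure n := ('I_n -> R) -> {set 'I_n}.

Definition ordered_hyps n (p : 'I_n -> R) : seq 'I_n :=
  sort (fun i j => p i <= p j) (enum 'I_n).

(* P_(k), for 1 <= k <= n. *)
Definition ordered_pvalue n (p : 'I_n -> R) (k : nat) : R :=
  nth 0 (map p (ordered_hyps p)) k.-1.

(* The step-up procedure with cutoffs u 1, ..., u n; the maximum is 0 when no
   index qualifies. *)
Definition stepup_index n (u : nat -> R) (p : 'I_n -> R) : nat :=
  (\max_(1 <= k < n.+1 | (ordered_pvalue p k <= u k)%R) k)%N.

Definition stepup n (u : nat -> R) : procedure n := fun p =>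
  [set i | i \in take (stepup_index u p) (ordered_hyps p)]%SET.

Definition BH n (alpha : R) : procedure n :=
  stepup (fun k => k%:R * alpha / n%:R).

Definition true_nulls n (mu : 'I_n -> R) : {set 'I_n} :=
  [set i | mu i == 0]%SET.

Definition num_rejected n (A : procedure n) (p : 'I_n -> R) : nat := #|A p|.

Definition num_false_rejected n (A : procedure n) (mu p : 'I_n -> R) : nat :=
  #|(A p :&: true_nulls mu)%SET|.

Definition FDR d (T : measurableType d) (P : probability T R) n
    (X : 'I_n -> {RV P >-> R}) (mu : 'I_n -> R) (A : procedure n) : \bar R :=
  'E_P[fun w => let p := fun i => pvalue (X i w) in
         (num_false_rejected A mu p)%:R / (maxn (num_rejected A p) 1)%:R].

(* Under the global null hypothesis FDR_BH(n, alpha, rho) depends only on the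
   joint law of X_1, ..., X_n; its limit is l when, for every choice for each n
   of a probability space carrying such X_1, ..., X_n, the FDRs tend to l. *)
Definition lim_FDR_BH (alpha rho l : R) : Prop :=
  forall (d : nat -> measure_display) (T : forall n, measurableType (d n))
    (P : forall n, probability (T n) R)
    (X : forall n, 'I_n -> {RV (P n) >-> R}),
  (forall n, equicorrelated_normal (X n) (fun=> 0) rho) ->
  (fun n => FDR (X n) (fun=> 0) (BH alpha)) @ \oo --> l%:E.

End multiple_testing.

(* Main.v *)
(* Under the global null hypothesis the false discovery rate is the probability
   that BH rejects anything. For [rho < 1], [X i = B + sqrt (1 - rho) Y i]
   exactly, with [Y] white noise and [B] a centered normal variable whose
   standard deviation tends to [sqrt rho]. Conditionally on [B = b], the fraction
   of the [X i] above [c] concentrates at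
   [1 - Phi ((c - b) / sqrt (1 - rho))], and BH compares it with
   [(1 - Phi c) / alpha]; putting [t] for the latter, the comparison succeeds for
   some [t] in ]0, 1[ when [b / sqrt rho] exceeds the infimum of the theorem and
   for none when it is below. Chebyshev's inequality suffices for the lower bound
   and, on a finite grid of levels [c], for the upper bound; rejections at very
   small levels are controlled by a first moment bound.

   For [rho = 0] the rejection probability is exactly [alpha] (Simes' equality),
   and for [rho = 1] all the [X i] coincide almost surely. *)

From HB Require Import structures.
Require Import Defs.
From mathcomp Require Import all_boot all_order all_algebra.
From mathcomp Require Import all_classical all_reals all_analysis.
From mathcomp Require Import measurable_realfun.
From mathcomp Require Import ring lra.
Import Order.TTheory GRing.Theory Num.Theory.
Import numFieldNormedType.Exports.
Local Open Scope classical_set_scope.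
Local Open Scope ring_scope.
Set Implicit Arguments.
Unset Strict Implicit.
Unset Printing Implicit Defensive.

(** * Gaussian integrals *)

(** Joint normality is given as normality of all linear combinations, whereas the concentration
    argument and Simes' equality need independence, for indicators of rays. The bridge is the
    characteristic function: it makes the expectation of the cosine of a linear combination
    explicit, products of trigonometric polynomials in distinct coordinates expand into such
    cosines, and indicators of rays are limits of trigonometric polynomials in L1 of the standard
    normal law.

    The conditioning on [B] is never carried out. Rejection by BH is monotone in the observations,
    so [B] can be replaced by a constant [z] on the event [z <= B] or on its complement, and a union
    bound does the rest; only the separate laws of [B] and of [Y] enter.

    Concentration alone cannot give the upper bound: as the cutoff decreases to 0, so does the
    expected fraction of exceedances, and the gap between them closes. Far in the tail the weight
    [1 / (1 - Phi x)] takes over; its mean is finite because [sqrt (1 - rho) < 1]. *)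

Section gauss.
Context {R : realType}.
Implicit Types (m s x : R) (f : R -> R).
Notation mu := (@lebesgue_measure R).

(** Change of variables is stated for the Radon-Nikodym derivative, which is determined only almost
    everywhere; this lemma lets the explicit density replace it under integrals. *)
Lemma ae_normal_pdf m s :
  ae_eq mu setT (Radon_Nikodym_SigmaFinite.f (normal_prob m s) mu)
    (EFin \o normal_pdf m s).
Proof.
apply: integral_ae_eq => //.
- exact: (Radon_Nikodym_SigmaFinite.f_integrable (normal_prob_dominates m s)).
- by apply/measurable_EFinP; exact: measurable_normal_pdf.
- move=> A _ mA; rewrite -Radon_Nikodym_SigmaFinite.f_integral//.
  exact: normal_prob_dominates.
Qed.

Lemma ge0_integral_normal_prob m s (f : R -> \bar R) :
  measurable_fun setT f -> (forall x, 0 <= f x)%E ->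
  (\int[normal_prob m s]_x f x = \int[mu]_x (f x * (normal_pdf m s x)%:E))%E.
Proof.
move=> mf f0.
rewrite -(Radon_Nikodym_SigmaFinite.change_of_variables
  (normal_prob_dominates m s))//.
apply: ae_eq_integral => //.
- apply: emeasurable_funM => //.
  apply: measurable_int.
  exact: (Radon_Nikodym_SigmaFinite.f_integrable (normal_prob_dominates m s)).
- apply: emeasurable_funM => //.
  by apply/measurable_EFinP; exact: measurable_normal_pdf.
- by apply: filterS (ae_normal_pdf m s) => x h _; rewrite h.
Qed.

Lemma is_derive_affine m s x : is_derive x 1 (fun z : R => m + s * z) s.
Proof.
have := is_deriveD (is_derive_cst m x 1) (is_deriveZ s (is_derive_id x 1)).
by rewrite add0r /GRing.scale/= mulr1.
Qed.

Lemma normal_pdf_affine m s x : 0 < s ->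
  s * normal_pdf m s (m + s * x) = normal_pdf 0 1 x.
Proof.
move=> s0; rewrite /normal_pdf gt_eqF// oner_eq0 /normal_fun /normal_peak.
have -> : - (m + s * x - m) ^+ 2 / (s ^+ 2 *+ 2) = - (x - 0) ^+ 2 / (1 ^+ 2 *+ 2).
  by field; rewrite gt_eqF.
rewrite mulrA; congr (_ * _).
rewrite expr1n mul1r -mulrnAr sqrtrM ?sqr_ge0// sqrtr_sqr gtr0_norm//.
by rewrite invfM mulrA mulfV ?mul1r// gt_eqF.
Qed.

Lemma normal_prob_ray m s x : 0 < s ->
  normal_prob m s `]-oo, m + s * x] = normal_prob 0 1 `]-oo, x].
Proof.
move=> s0; rewrite /normal_prob.
pose F z := m + s * z.
have dF z : derivable F z 1 by have [] := is_derive_affine m s z.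
have F'E : derive1 F = cst s.
  by apply/funext => z; rewrite derive1E; have [_ ->] := is_derive_affine m s z.
rewrite (@increasing_ge0_integration_by_substitutionNy _ F)//=.
- apply: eq_integral => z _; rewrite F'E/= /F !fctE.
  by rewrite mulrC normal_pdf_affine.
- by move=> y z _ _ yz; rewrite /F ltrD2l ltr_pM2l.
- by rewrite F'E => ? _; exact: cvg_cst.
- by rewrite F'E; exact: is_cvg_cst.
- by rewrite F'E; exact: cvg_cst.
- split; first by move=> z _.
  apply: cvg_at_left_filter.
  by apply: differentiable_continuous; exact/derivable1_diffP.
- rewrite /F; under eq_fun do rewrite addrC mulrC.
  apply: (@cvg_comp _ _ _ (fun z => z * s) (fun z => z + m)); last exact: cvg_addrr_Ny.
  by apply: gt0_cvgMlNy => //; exact: cvg_id.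
- apply: continuous_subspaceT; apply: continuous_normal_pdf.
  by rewrite gt_eqF.
- by move=> z _; exact: normal_pdf_ge0.
Qed.

Lemma measurable_affine m s : measurable_fun [set: R] (fun z : R => m + s * z).
Proof. by apply: measurable_funD => //; exact: measurable_funM. Qed.

(** Two probability measures that agree on the rays []x, +oo[], a generator of the Borel sets stable
    under intersection, are equal; on rays the identity is the substitution in [normal_prob_ray]. *)
Lemma normal_probE m s (A : set R) : 0 < s -> measurable A ->
  normal_prob m s A = normal_prob 0 1 ((fun z => m + s * z) @^-1` A).
Proof.
move=> s0 mA.
have ray x : normal_prob m s `]x, +oo[%classic =
    normal_prob 0 1 ((fun z => m + s * z) @^-1` `]x, +oo[%classic).
  have xE : x = m + s * ((x - m) / s) by field; rewrite gt_eqF.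
  have -> : (fun z => m + s * z) @^-1` `]x, +oo[ = ~` `]-oo, (x - m) / s]%classic.
    rewrite setCitvl; apply/seteqP; split => z /=; rewrite !in_itv/= !andbT.
      by rewrite ltr_pdivrMr// ltrBlDl mulrC.
    by rewrite ltr_pdivrMr// ltrBlDl mulrC.
  have -> : `]x, +oo[%classic = ~` `]-oo, x]%classic by rewrite setCitvl.
  have rayC u v y : normal_prob u v (~` `]-oo, y]%classic) =
      (1 - normal_prob u v `]-oo, y]%classic)%E.
    exact: probability_setC.
  by rewrite !rayC [in LHS]xE normal_prob_ray.
pose rT := measurableTypeR R.
have mF : measurable_fun [set: rT] (fun z : rT => (m + s * z) : rT).
  exact: measurable_affine.
pose F : {mfun rT >-> rT} :=
  HB.pack (fun z : rT => (m + s * z) : rT) (isMeasurableFun.Build _ _ _ _ _ mF).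
pose m1 : {measure set rT -> \bar R} := normal_prob m s.
pose m2 : {measure set rT -> \bar R} := distribution (normal_prob 0 1) F.
suff: m1 A = m2 A by [].
refine (@measure_unique _ R (measurableTypeR R) (@RGenOInfty.G R)
  (fun n => `](- n%:R), +oo[%classic) _ _ _ _ m1 m2 _ _ A mA).
- exact: RGenOInfty.measurableE.
- move=> _ _ [x ->] [y ->]; exists (Num.max x y).
  apply/seteqP; split => z /=; rewrite !in_itv/= !andbT gt_max; first by move=> [-> ->].
  by move/andP.
- by move=> i; exists (- i%:R).
- apply/seteqP; split => // x _; exists (Num.truncn `|x|).+1 => //=.
  rewrite in_itv/= andbT ltrNl (le_lt_trans _ (truncnS_gt _))//.
  by rewrite -normrN ler_norm.
- by move=> _ [x ->]; exact: ray.
- by move=> k; exact: (le_lt_trans (probability_le1 _ _) (ltry _)).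
Qed.

End gauss.

(** * Transfer of integrals between variables with the same law *)

Section same_law.
Context d d' (T : measurableType d) (T' : measurableType d') (R : realType).
Variables (P : {measure set T -> \bar R}) (P' : {measure set T' -> \bar R}).
Variables (X : T -> R) (X' : T' -> R).
Hypotheses (mX : measurable_fun setT X) (mX' : measurable_fun setT X').
Hypothesis law : forall A, measurable A -> P (X @^-1` A) = P' (X' @^-1` A).

Lemma same_law_ge0_integral (f : R -> \bar R) :
  measurable_fun setT f -> (forall x, 0 <= f x)%E ->
  (\int[P]_w f (X w) = \int[P']_w f (X' w))%E.
Proof.
move=> mf f0.
pose Y : {mfun T >-> R} :=
  HB.pack X (isMeasurableFun.Build _ _ _ _ _ mX).
pose Y' : {mfun T' >-> R} :=
  HB.pack X' (isMeasurableFun.Build _ _ _ _ _ mX').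
transitivity (\int[pushforward P Y]_x f x)%E.
  by rewrite (ge0_integral_pushforward mX).
transitivity (\int[pushforward P' Y']_x f x)%E.
  by apply: eq_measure_integral => A mA _; exact: law.
by rewrite (ge0_integral_pushforward mX').
Qed.

Lemma same_law_integrable (f : R -> R) : measurable_fun setT f ->
  P'.-integrable setT (fun w => (f (X' w))%:E) ->
  P.-integrable setT (fun w => (f (X w))%:E).
Proof.
move=> mf /integrableP[_ foo]; apply/integrableP; split.
  by apply/measurable_EFinP; exact: measurableT_comp.
rewrite (@same_law_ge0_integral (fun x => `|(f x)%:E|%E))//.
by apply: measurableT_comp => //; exact/measurable_EFinP.
Qed.

Lemma same_law_Rintegral (f : R -> R) : measurable_fun setT f ->
  P'.-integrable setT (fun w => (f (X' w))%:E) ->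
  \int[P]_w f (X w) = \int[P']_w f (X' w).
Proof.
move=> mf intf; have intf' := same_law_integrable mf intf.
pose Y : {mfun T >-> R} :=
  HB.pack X (isMeasurableFun.Build _ _ _ _ _ mX).
pose Y' : {mfun T' >-> R} :=
  HB.pack X' (isMeasurableFun.Build _ _ _ _ _ mX').
have mEf : measurable_fun [set: R] (EFin \o f).
  exact/measurable_EFinP.
congr fine; transitivity (\int[pushforward P Y]_x (f x)%:E)%E.
  by rewrite (integral_pushforward mX).
transitivity (\int[pushforward P' Y']_x (f x)%:E)%E.
  by apply: eq_measure_integral => A mA _; exact: law.
by rewrite (integral_pushforward mX').
Qed.

End same_law.

(** * Moments, Stein's identity and characteristic function of the standard normal law *)

Section gauss_integrals.
Context {R : realType}.
Implicit Types (f h : R -> R) (x : R).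
Notation mu := (@lebesgue_measure R).
Notation gamma := (@normal_prob R 0 1).
Notation phi := (@normal_pdf R 0 1).

Lemma measurable_phi : measurable_fun setT phi.
Proof. exact: measurable_normal_pdf. Qed.

Lemma stdnormal_pdfE x : phi x = normal_peak 1 * expR (- (x ^+ 2 / 2)).
Proof.
rewrite normal_pdfE ?oner_eq0//; congr (_ * expR _).
by rewrite expr1n subr0; field.
Qed.

Lemma ge0_integral_gamma f : measurable_fun setT f -> (forall x, 0 <= f x) ->
  (\int[gamma]_x (f x)%:E = \int[mu]_x (f x * phi x)%:E)%E.
Proof.
move=> mf f0; rewrite ge0_integral_normal_prob//.
exact/measurable_EFinP.
Qed.

Lemma integrable_gamma f : measurable_fun setT f ->
  mu.-integrable setT (fun x => (f x * phi x)%:E) ->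
  gamma.-integrable setT (EFin \o f).
Proof.
move=> mf /integrableP[_ foo]; apply/integrableP; split.
  exact/measurable_EFinP.
rewrite (_ : (\int[gamma]_x _ = \int[gamma]_x (`|f x|)%:E)%E)// ge0_integral_gamma//.
  apply: le_lt_trans foo; apply: ge0_le_integral => //.
  - by move=> x _; rewrite lee_fin mulr_ge0// normal_pdf_ge0.
  - apply/measurable_EFinP; apply: measurable_funM; last exact: measurable_phi.
    exact: measurableT_comp.
  - do 2 apply: measurableT_comp => //.
    by apply: measurable_funM => //; exact: measurable_phi.
  - by move=> x _ /=; rewrite lee_fin normrM (ger0_norm (normal_pdf_ge0 _ _ _)).
exact: measurableT_comp.
Qed.

Lemma integrable_gamma_lebesgue f : gamma.-integrable setT (EFin \o f) ->
  mu.-integrable setT (fun x => (f x * phi x)%:E).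
Proof.
move=> /integrableP[/measurable_EFinP mf foo]; apply/integrableP; split.
  by apply/measurable_EFinP; apply: measurable_funM => //; exact: measurable_phi.
apply: le_lt_trans foo.
rewrite (_ : (\int[gamma]_x _ = \int[gamma]_x (`|f x|)%:E)%E)// ge0_integral_gamma//.
  apply: ge0_le_integral => //.
  - do 2 apply: measurableT_comp => //.
    by apply: measurable_funM => //; exact: measurable_phi.
  - apply/measurable_EFinP; apply: measurable_funM; last exact: measurable_phi.
    exact: measurableT_comp.
  - by move=> x _ /=; rewrite lee_fin normrM (ger0_norm (normal_pdf_ge0 _ _ _)).
exact: measurableT_comp.
Qed.

Lemma integral_gamma f : gamma.-integrable setT (EFin \o f) ->
  (\int[gamma]_x (f x)%:E = \int[mu]_x (f x * phi x)%:E)%E.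
Proof.
move=> intf; have /integrableP[/measurable_EFinP mf _] := intf.
have posE (g : R -> R) x : ((EFin \o g)^\+ x = (Num.max (g x) 0)%:E)%E.
  by rewrite funeposE/= EFin_max.
have negE (g : R -> R) x : ((EFin \o g)^\- x = (Num.max (- g x) 0)%:E)%E.
  by rewrite funenegE/= EFin_max.
rewrite integralE [RHS]integralE; congr (_ - _)%E.
  under eq_integral do rewrite posE.
  rewrite ge0_integral_gamma//.
  - apply: eq_integral => x _; rewrite (posE (fun x => f x * phi x)).
    by rewrite maxr_pMl ?normal_pdf_ge0// mul0r.
  - exact: measurable_maxr.
  - by move=> x; rewrite le_max lexx orbT.
under eq_integral do rewrite negE.
rewrite ge0_integral_gamma//.
- apply: eq_integral => x _; rewrite (negE (fun x => f x * phi x)).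
  by rewrite maxr_pMl ?normal_pdf_ge0// mul0r mulNr.
- by apply: measurable_maxr => //; exact: measurableT_comp.
- by move=> x; rewrite le_max lexx orbT.
Qed.

(** Completing the square: times [phi], the integrand is a constant multiple of the normal density
    with mean [b / (1 - c)] and variance [1 / (1 - c)]. The case [c = 1/2] dominates the square;
    larger [c] will dominate the inverse tail [1 / (1 - Phi)]. *)
Lemma integrable_expR_quad (b c : R) : c < 1 ->
  gamma.-integrable setT (fun x => (expR (c * x ^+ 2 / 2 + b * x))%:E).
Proof.
move=> c1.
pose s : R := (Num.sqrt (1 - c))^-1; pose m : R := b / (1 - c).
have c0 : 0 < 1 - c by rewrite subr_gt0.
have s0 : 0 < s by rewrite invr_gt0 sqrtr_gt0.
have s2 : s ^+ 2 = (1 - c)^-1 by rewrite exprVn sqr_sqrtr// ltW.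
have mf : measurable_fun setT (fun x : R => expR (c * x ^+ 2 / 2 + b * x)).
  apply: measurableT_comp => //; apply: measurable_funD.
    by apply: measurable_funM => //; apply: measurable_funM.
  exact: measurable_funM.
apply: integrable_gamma => //.
pose K := expR (b ^+ 2 / (2 * (1 - c))) * (normal_peak 1 / normal_peak s).
rewrite (_ : (fun x => _) = (fun x => K%:E * (normal_pdf m s x)%:E)%E); last first.
  apply/funext => x; rewrite -EFinM; congr EFin.
  rewrite normal_pdfE ?oner_eq0// normal_pdfE ?gt_eqF//= /K.
  have -> : expR (b ^+ 2 / (2 * (1 - c))) * (normal_peak 1 / normal_peak s) *
     (normal_peak s * normal_fun m s x) = normal_peak 1 *
     (expR (b ^+ 2 / (2 * (1 - c))) * normal_fun m s x).
    by field; rewrite gt_eqF// normal_peak_gt0// gt_eqF.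
  rewrite mulrCA; congr (_ * _); rewrite /normal_fun -!expRD; congr expR.
  by rewrite s2 /m; field; rewrite gt_eqF.
by apply: integrableZl => //; exact: integrable_normal_pdf.
Qed.

Lemma gamma_integrable_le (f g : R -> R) : measurable_fun setT f ->
  gamma.-integrable setT (EFin \o g) -> (forall x, `|f x| <= g x) ->
  gamma.-integrable setT (EFin \o f).
Proof.
move=> mf ig fg; apply: le_integrable ig => //; first exact/measurable_EFinP.
by move=> x _ /=; rewrite lee_fin (le_trans (fg x))// ler_norm.
Qed.

Lemma integrable_gamma_sqr : gamma.-integrable setT (fun x : R => (x ^+ 2)%:E).
Proof.
have h : gamma.-integrable setT
    (fun x => (4 * expR (2^-1 * x ^+ 2 / 2 + 0 * x))%:E).
  under eq_fun do rewrite EFinM.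
  by apply: integrableZl => //; apply: integrable_expR_quad; lra.
apply: gamma_integrable_le h _ => // x.
rewrite ger0_norm ?sqr_ge0// mul0r addr0.
have := expR_ge1Dx (2^-1 * x ^+ 2 / 2); lra.
Qed.

Lemma integrable_gamma_abs : gamma.-integrable setT (fun x : R => (`|x|)%:E).
Proof.
have h : gamma.-integrable setT (fun x : R => (1 + x ^+ 2)%:E).
  under eq_fun do rewrite EFinD.
  apply: integrableD => //; last exact: integrable_gamma_sqr.
  exact: finite_measure_integrable_cst.
apply: gamma_integrable_le h _ => // x.
rewrite normr_id -(real_normK (num_real x)).
by have := sqr_ge0 (`|x| - 1); nra.
Qed.

Lemma is_derive_phi x : is_derive x 1 phi (- x * phi x).
Proof.
have -> : phi = normal_peak 1 *: (expR \o (fun z : R => - (z ^+ 2 / 2))).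
  by apply/funext => z; exact: stdnormal_pdfE.
have dq : is_derive x 1 (fun z : R => - (z ^+ 2 / 2)) (- x).
  have -> : (fun z : R => - (z ^+ 2 / 2)) = - 2^-1 *: ((@id R) ^+ 2).
    by apply/funext => z; rewrite -[RHS]/(- 2^-1 * z ^+ 2) mulNr mulrC.
  apply: (is_derive_eq (is_deriveZ (- 2^-1 : R) (is_deriveX 2 (is_derive_id x 1)))).
  by rewrite /GRing.scale/= expr1; field.
have h := @is_derive1_comp _ expR (fun z => - (z ^+ 2 / 2)) x _ _
  (is_derive_expR (- (x ^+ 2 / 2))) dq.
apply: (is_derive_eq (is_deriveZ (normal_peak 1 : R) h)).
rewrite -[LHS]/(normal_peak 1 * (expR (- (x ^+ 2 / 2)) * - x)).
rewrite -[RHS]/(- x * (normal_peak 1 * expR (- (x ^+ 2 / 2)))); ring.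
Qed.

Lemma continuous_phi : continuous phi.
Proof. by apply: continuous_normal_pdf; exact: oner_neq0. Qed.

Lemma phiN x : phi (- x) = phi x.
Proof. by rewrite !stdnormal_pdfE sqrrN. Qed.

(** These are the boundary terms of the integration by parts in [stein]: the bound
    [exp (- n^2 / 2) <= 1 / (1 + n^2 / 2)] already beats the linear growth of [h]. *)
Lemma cvg_mul_phi h : (forall x, `|h x| <= 1 + `|x|) ->
  h n%:R * phi n%:R @[n --> \oo] --> 0 /\
  h (- n%:R) * phi (- n%:R) @[n --> \oo] --> 0.
Proof.
move=> hb.
have H (y : nat -> R) : (forall n, `|y n| = n%:R) -> (forall n, phi (y n) = phi n%:R) ->
    h (y n) * phi (y n) @[n --> \oo] --> 0.
  move=> yn py; apply: norm_cvg0.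
  (* The constant 4 comes from [(1 + n)^2 <= 4 (1 + n^2 / 2)], that is,
     [(1 + n) / (1 + n^2 / 2) <= 4 / (n + 1)]. *)
  have hc : 4 * normal_peak 1 * harmonic n @[n --> \oo] --> 4 * normal_peak 1 * (0 : R).
    by apply: cvgMr; exact: cvg_harmonic.
  rewrite mulr0 in hc.
  apply: squeeze_cvgr (cvg_cst 0) hc.
  apply: nearW => n; rewrite normr_ge0/= normrM (ger0_norm (normal_pdf_ge0 _ _ _)) py.
  have n0 : 0 <= n%:R :> R by exact: ler0n.
  have e1 : expR (- (n%:R ^+ 2 / 2)) <= (1 + n%:R ^+ 2 / 2)^-1 :> R.
    rewrite expRN lef_pV2 ?posrE ?expR_gt0 ?expR_ge1Dx//.
  have e2 : `|h (y n)| <= 1 + n%:R by rewrite -(yn n).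
  rewrite stdnormal_pdfE mulrCA.
  have -> : 4 * normal_peak 1 * harmonic n = normal_peak 1 * (4 / n.+1%:R) :> R.
    by rewrite /harmonic/=; ring.
  rewrite ler_wpM2l ?normal_peak_ge0//.
  apply: (le_trans (ler_pM (normr_ge0 _) (expR_ge0 _) e2 e1)).
  rewrite -[in leRHS]natr1 ler_pdivrMr; last first.
    by rewrite ltr_pwDl// divr_ge0 ?sqr_ge0.
  rewrite mulrAC ler_pdivlMr ?ltr_pwDr//.
  by have := sqr_ge0 (n%:R - 1 : R); nra.
split; apply: H => n; rewrite ?normrN ?phiN// ger0_norm//.
Qed.

(* The integrand [h' - x h] times [phi] is the derivative of [h phi]. *)
Lemma stein h h' (K : R) : (forall x, is_derive x 1 h (h' x)) -> continuous h' ->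
  (forall x, `|h x| <= 1 + `|x|) -> (forall x, `|h' x| <= K) ->
  \int[gamma]_x (x * h x) = \int[gamma]_x h' x.
Proof.
move=> dh ch' hb h'b.
have dh1 x : derivable h x 1 by have [] := dh x.
have ch : continuous h.
  by move=> x; apply/differentiable_continuous; exact/derivable1_diffP.
have mh : measurable_fun setT h by exact: continuous_measurable_fun.
have mh' : measurable_fun setT h' by exact: continuous_measurable_fun.
have ih' : gamma.-integrable setT (EFin \o h').
  apply: (@gamma_integrable_le _ (cst K)) => //.
  exact: finite_measure_integrable_cst.
have ixh : gamma.-integrable setT (EFin \o (fun x => x * h x)).
  have ib : gamma.-integrable setT (fun x : R => (`|x| + x ^+ 2)%:E).
    under eq_fun do rewrite EFinD.
    apply: integrableD => //; first exact: integrable_gamma_abs.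
    exact: integrable_gamma_sqr.
  apply: gamma_integrable_le ib _; first exact: measurable_funM.
  move=> x; rewrite normrM -(real_normK (num_real x)).
  by rewrite expr2 -[X in X + _]mulr1 -mulrDr ler_wpM2l.
pose g x := (h' x - x * h x) * phi x.
have ig : mu.-integrable setT (EFin \o g).
  apply: (@integrable_gamma_lebesgue (fun x => h' x - x * h x)).
  rewrite (_ : _ \o _ = fun x => (h' x)%:E - (x * h x)%:E)%E//.
  exact: integrableB.
have dG x : is_derive x 1 (h * phi) (g x).
  have := is_deriveM (dh x) (is_derive_phi x).
  congr is_derive; rewrite /GRing.scale/= /g; ring.
have cg : continuous g.
  move=> x; apply: cvgM; last exact: continuous_phi.
  by apply: cvgB; [exact: ch'|apply: cvgM; [exact: cvg_id|exact: ch]].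
(* The bound [n.+1] keeps the interval nondegenerate, as the fundamental theorem of calculus
   requires. *)
have ftc n : \int[mu]_(x in `[- n.+1%:R, n.+1%:R]) g x =
    h n.+1%:R * phi n.+1%:R - h (- n.+1%:R) * phi (- n.+1%:R).
  rewrite /Rintegral (@continuous_FTC2 _ g (h * phi))//.
  - by rewrite gtrN// ltr0Sn.
  - exact: continuous_subspaceT.
  - have cG z : {for z, continuous (h * phi)}.
      apply/differentiable_continuous/derivable1_diffP.
      by have [] := dG z.
    split.
    + by move=> z _; have [] := dG z.
    + by apply: cvg_at_right_filter; exact: cG.
    + by apply: cvg_at_left_filter; exact: cG.
  - by move=> z _; rewrite derive1E; have [_ ->] := dG z.
have cv0 : \int[mu]_(x in `[- n.+1%:R, n.+1%:R]) g x @[n --> \oo] --> 0.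
  under eq_fun do rewrite ftc.
  have [c1 c2] := cvg_mul_phi hb.
  have h1 : h n.+1%:R * phi n.+1%:R @[n --> \oo] --> (0 : R).
    by move: c1; rewrite -(cvg_shiftS (fun n => h n%:R * phi n%:R)).
  have h2 : h (- n.+1%:R) * phi (- n.+1%:R) @[n --> \oo] --> (0 : R).
    by move: c2; rewrite -(cvg_shiftS (fun n => h (- n%:R) * phi (- n%:R))).
  by have := cvgB h1 h2; rewrite subr0; apply.
(* The same truncated integrals also tend to the full integral, by domination by [|g|]; uniqueness
   of the limit then makes the full integral 0. *)
have cvI : \int[mu]_(x in `[- n.+1%:R, n.+1%:R]) g x @[n --> \oo] --> \int[mu]_x g x.
  pose I (n : nat) : set R := `[- n.+1%:R, n.+1%:R]%classic.
  pose F n : R -> \bar R := EFin \o (g \_ (I n)).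
  have mg : measurable_fun setT g by exact: continuous_measurable_fun.
  have mF n : measurable_fun setT (F n).
    apply/measurable_EFinP/(measurable_restrictT _ _).1; first exact: measurable_itv.
    exact: measurable_funTS.
  have FE n : \int[mu]_(x in I n) g x = fine (\int[mu]_x F n x).
    by rewrite Rintegral_mkcond.
  under eq_fun do rewrite FE.
  have [] := @dominated_convergence _ _ _ mu setT measurableT F (EFin \o g) (fun x => `|g x|%:E).
  - exact: mF.
  - exact/measurable_EFinP.
  - apply: aeW => x _; apply: cvg_near_cst.
    exists (Num.truncn `|x|).+1 => // n /= xn.
    rewrite /F/= patchE mem_set// /I/= in_itv/= -ler_norml.
    rewrite (le_trans (ltW (truncnS_gt _)))// ler_nat.
    by apply: leq_trans xn (leqnSn _).
  - exact: integrable_norm.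
  - by apply: aeW => x n _; rewrite /F/= lee_fin patchE; case: ifP => //; rewrite normr0.
  - move=> _ _ c; apply: fine_cvg.
    by rewrite fineK//; exact: integrable_fin_num.
have : \int[mu]_x g x = 0.
  exact: (cvg_unique _ cvI cv0).
have -> : \int[mu]_x g x = \int[gamma]_x (h' x - x * h x).
  congr fine; apply/esym/(@integral_gamma (fun x => h' x - x * h x)).
  rewrite (_ : _ \o _ = fun x => (h' x)%:E - (x * h x)%:E)%E//.
  exact: integrableB.
rewrite RintegralB//.
by move/subr0_eq => ->.
Qed.

Lemma gamma_mean : \int[gamma]_x x = 0.
Proof.
have d (x : R) : is_derive x 1 (cst 1 : R -> R) (cst 0 x) by exact: is_derive_cst.
have := @stein (cst 1) (cst 0) 0 d.
under eq_Rintegral do rewrite mulr1.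
move=> ->; first by rewrite Rintegral_cst// mul0r.
- by move=> x; exact: cvg_cst.
- by move=> x; rewrite normr1 lerDl.
- by move=> x; rewrite normr0.
Qed.

Lemma gamma_var : \int[gamma]_x (x ^+ 2) = 1.
Proof.
have d (x : R) : is_derive x 1 id (cst 1 x) by exact: is_derive_id.
have := @stein id (cst 1) 1 d.
under eq_Rintegral do rewrite -expr2.
move=> ->.
- rewrite Rintegral_cst// mul1r.
  by rewrite -[LHS]/(fine (gamma setT)) (_ : gamma setT = 1%E)//; exact: probability_setT.
- by move=> x; exact: cvg_cst.
- by move=> x; rewrite lerDr.
- by move=> x; rewrite normr1.
Qed.

Lemma is_derive_scale (a x : R) : is_derive x 1 (fun z => a * z) a.
Proof.
have := is_deriveZ a (is_derive_id x 1).
by rewrite /GRing.scale/= mulr1.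
Qed.

Lemma integrable_gamma_bounded f (K : R) : measurable_fun setT f ->
  (forall x, `|f x| <= K) -> gamma.-integrable setT (EFin \o f).
Proof.
move=> mf fK; apply: (@gamma_integrable_le _ (cst K)) => //.
exact: finite_measure_integrable_cst.
Qed.

Lemma norm_cos_le1 x : `|cos x| <= 1.
Proof. by rewrite ler_norml cos_geN1 cos_le1. Qed.

Lemma norm_sin_le1 x : `|sin x| <= 1.
Proof. by rewrite ler_norml sin_geN1 sin_le1. Qed.

Lemma measurable_cos_scale (a : R) : measurable_fun setT (fun x : R => cos (a * x)).
Proof.
by apply: measurableT_comp; [exact: (continuous_measurable_fun (@continuous_cos R))|exact: measurable_funM].
Qed.

Lemma measurable_sin_scale (a : R) : measurable_fun setT (fun x : R => sin (a * x)).
Proof.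
by apply: measurableT_comp; [exact: (continuous_measurable_fun (@continuous_sin R))|exact: measurable_funM].
Qed.

Lemma stein_sin (a : R) :
  \int[gamma]_x (x * sin (a * x)) = a * \int[gamma]_x cos (a * x).
Proof.
have d (x : R) : is_derive x 1 (fun x => sin (a * x)) (a * cos (a * x)).
  rewrite mulrC.
  exact: (is_derive1_comp (is_derive_sin _) (is_derive_scale _ _)).
rewrite (@stein _ _ `|a| d).
- rewrite RintegralZl//.
  apply: (@integrable_gamma_bounded _ 1); first exact: measurable_cos_scale.
  by move=> x; exact: norm_cos_le1.
- move=> x; apply: cvgM; first exact: cvg_cst.
  apply: continuous_comp; last exact: continuous_cos.
  exact: mulrl_continuous.
- move=> x; rewrite (@le_trans _ _ 1)//; last by rewrite lerDl.
  by rewrite ler_norml sin_geN1 sin_le1.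
- move=> x; rewrite normrM ler_piMr//.
  by rewrite ler_norml cos_geN1 cos_le1.
Qed.

Lemma gammaN (A : set R) : measurable A -> gamma (-%R @^-1` A) = gamma A.
Proof.
move=> mA; rewrite /normal_prob integral_mkcond [RHS]integral_mkcond.
have mphi : measurable_fun setT ((fun x => (phi x)%:E) \_ A).
  apply/(measurable_restrictT _ _).1 => //; apply: measurable_funTS.
  by apply/measurable_EFinP; exact: measurable_phi.
have mN : measurable_fun [set: measurableTypeR R] (-%R : R -> R) by exact: measurable_funN.
have mI : measurable_fun [set: measurableTypeR R] (id : R -> R) by exact: measurable_id.
rewrite -(@same_law_ge0_integral _ _ _ _ R mu mu -%R id mN mI _ _ mphi).
- apply: eq_integral => x _; rewrite !patchE phiN.
  by congr (if _ then _ else _); apply/idP/idP; rewrite !inE.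
- by move=> B mB; exact: lebesgue_measureN.
- by move=> x; rewrite patchE; case: ifP => // _; rewrite lee_fin normal_pdf_ge0.
Qed.

Lemma gamma_sin (a : R) : \int[gamma]_x sin (a * x) = 0.
Proof.
have isin : gamma.-integrable setT (fun x : R => (sin (a * x))%:E).
  apply: (@integrable_gamma_bounded _ 1); first exact: measurable_sin_scale.
  by move=> x; exact: norm_sin_le1.
have : \int[gamma]_x sin (a * - x) = \int[gamma]_x sin (a * x).
  apply: (@same_law_Rintegral _ _ _ _ R gamma gamma -%R id _ _ _ (fun x => sin (a * x))) => //.
  - by move=> A mA; exact: gammaN.
  - exact: measurable_sin_scale.
under eq_Rintegral do rewrite mulrN sinN -mulN1r.
rewrite RintegralZl//; lra.
Qed.

(** Differentiation under the integral sign, dominated by [|x|], brings down a factor [x], which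
    [stein_sin] removes again. *)
Lemma is_derive_gamma_cos (a : R) : is_derive a 1
  (fun b => \int[gamma]_x cos (b * x)) (- (a * \int[gamma]_x cos (a * x))).
Proof.
pose f (b x : R) := cos (b * x).
have df (b x : R) : is_derive b 1 (f ^~ x) (- (x * sin (b * x))).
  have -> : f ^~ x = cos \o (fun z => x * z).
    by apply/funext => z; rewrite /f/= mulrC.
  apply: (is_derive_eq (is_derive1_comp (is_derive_cos (x * b)) (is_derive_scale x b))).
  by rewrite mulrC mulrN (mulrC b).
have Ia : `]a - 1, a + 1[%classic a by rewrite /= in_itv/=; apply/andP; split; lra.
have c1 (b : R) : `]a - 1, a + 1[%classic b -> gamma.-integrable setT (EFin \o f b).
  move=> _; apply: (@integrable_gamma_bounded _ 1); first exact: measurable_cos_scale.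
  by move=> x; exact: norm_cos_le1.
have c2 (b x : R) : `]a - 1, a + 1[%classic b -> setT x -> derivable (f ^~ x) b 1.
  by move=> _ _; have [] := df b x.
have c3 (b x : R) : `]a - 1, a + 1[%classic b -> setT x -> `|partial1of2 f b x| <= `|x|.
  move=> _ _; rewrite partial1of2E.
  have [_ ->] := df b x.
  by rewrite normrN normrM ler_piMr// norm_sin_le1.
have := @derivable_under_integral _ _ _ gamma f setT measurableT a (a - 1) (a + 1)
  Ia c1 c2 (fun x => `|x|) (fun x => normr_ge0 x) integrable_gamma_abs c3.
have := @differentiation_under_integral _ _ _ gamma f setT measurableT a (a - 1) (a + 1)
  Ia c1 c2 (fun x => `|x|) (fun x => normr_ge0 x) integrable_gamma_abs c3.
move=> h1 h2; apply: DeriveDef => //.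
rewrite -derive1E h1 -stein_sin.
transitivity (\int[gamma]_x (-1 * (x * sin (a * x)))).
  apply: eq_Rintegral => x _; rewrite mulN1r.
  by rewrite -[LHS]/(partial1of2 f a x) partial1of2E; have [_ ->] := df a x.
rewrite RintegralZl// ?mulN1r//.
apply: gamma_integrable_le integrable_gamma_abs _.
  by apply: measurable_funM => //; exact: measurable_sin_scale.
by move=> x; rewrite normrM ler_piMr// norm_sin_le1.
Qed.

(* By Stein's identity, the characteristic function [F] satisfies [F' a = - a F a]. *)
Lemma gamma_cos (a : R) : \int[gamma]_x cos (a * x) = expR (- (a ^+ 2 / 2)).
Proof.
pose F (a : R) := \int[gamma]_x cos (a * x).
have dq (z : R) : is_derive z 1 (fun z : R => z ^+ 2 / 2) z.
  have -> : (fun z : R => z ^+ 2 / 2) = 2^-1 *: ((@id R) ^+ 2).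
    by apply/funext => y; rewrite mulrC.
  apply: (is_derive_eq (is_deriveZ (2^-1 : R) (is_deriveX 2 (is_derive_id z 1)))).
  by rewrite /GRing.scale/= expr1; field.
have dE (z : R) : is_derive z 1 (F * (expR \o (fun z : R => z ^+ 2 / 2))) 0.
  have h := @is_derive1_comp _ expR (fun z => z ^+ 2 / 2) z _ _
    (is_derive_expR (z ^+ 2 / 2)) (dq z).
  apply: (is_derive_eq (is_deriveM (is_derive_gamma_cos z) h)).
  by rewrite /GRing.scale/= -/(F z); ring.
have := is_derive_0_is_cst a 0 dE.
rewrite -[LHS]/(F a * expR (a ^+ 2 / 2)) -[RHS]/(F 0 * expR (0 ^+ 2 / 2)).
rewrite expr0n/= mul0r expR0 mulr1.
have -> : F 0 = 1.
  rewrite /F; under eq_Rintegral do rewrite mul0r cos0.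
  rewrite Rintegral_cst// mul1r.
  by rewrite -[LHS]/(fine (gamma setT)) (_ : gamma setT = 1%E)//; exact: probability_setT.
rewrite expRN -/(F a) => h; apply: (mulIf (_ : expR (a ^+ 2 / 2) != 0)).
  by rewrite gt_eqF// expR_gt0.
by rewrite h mulVf// gt_eqF// expR_gt0.
Qed.

Lemma gamma_cosD (a b : R) :
  \int[gamma]_x cos (a * x + b) = cos b * expR (- (a ^+ 2 / 2)).
Proof.
have ic : gamma.-integrable setT (fun x : R => (cos (a * x))%:E).
  apply: (@integrable_gamma_bounded _ 1); first exact: measurable_cos_scale.
  by move=> x; exact: norm_cos_le1.
have is' : gamma.-integrable setT (fun x : R => (sin (a * x))%:E).
  apply: (@integrable_gamma_bounded _ 1); first exact: measurable_sin_scale.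
  by move=> x; exact: norm_sin_le1.
under eq_Rintegral do rewrite cosD.
rewrite RintegralB//.
- by rewrite !RintegralZr// gamma_cos gamma_sin mul0r subr0 mulrC.
- rewrite (_ : _ \o _ = fun x => (cos (a * x))%:E * (cos b)%:E)%E//.
  exact: integrableZr.
- rewrite (_ : _ \o _ = fun x => (sin (a * x))%:E * (sin b)%:E)%E//.
  exact: integrableZr.
Qed.

End gauss_integrals.

(** * White noise *)

Section bounded_functions.
Context d (T : measurableType d) (R : realType) (P : probability T R).
Implicit Types f g : T -> R.

(** This class is closed under sums and products and is integrable for every probability, so the
    integrability conditions below reduce to closure rules. *)
Definition bounded_mfun f :=
  measurable_fun setT f /\ exists K, forall w, `|f w| <= K.

Lemma bounded_mfun_integrable f : bounded_mfun f ->
  P.-integrable setT (EFin \o f).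
Proof.
move=> [mf [K fK]]; apply: (@le_integrable _ _ _ P setT measurableT _ (EFin \o cst K)).
- exact/measurable_EFinP.
- by move=> x _ /=; rewrite lee_fin (le_trans (fK x))// ler_norm.
- exact: finite_measure_integrable_cst.
Qed.

Lemma bounded_mfun_cst (k : R) : bounded_mfun (fun=> k).
Proof. by split; [exact: measurable_cst|exists `|k|]. Qed.

Lemma bounded_mfunD f g : bounded_mfun f -> bounded_mfun g ->
  bounded_mfun (fun w => f w + g w).
Proof.
move=> [mf [K fK]] [mg [L gL]]; split; first exact: measurable_funD.
by exists (K + L) => w; rewrite (le_trans (ler_normD _ _))// lerD.
Qed.

Lemma bounded_mfunM f g : bounded_mfun f -> bounded_mfun g ->
  bounded_mfun (fun w => f w * g w).
Proof.
move=> [mf [K fK]] [mg [L gL]]; split; first exact: measurable_funM.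
by exists (K * L) => w; rewrite normrM ler_pM.
Qed.

Lemma bounded_mfunB f g : bounded_mfun f -> bounded_mfun g ->
  bounded_mfun (fun w => f w - g w).
Proof.
move=> hf hg; have := bounded_mfunD hf (bounded_mfunM (bounded_mfun_cst (-1)) hg).
by congr bounded_mfun; apply/funext => w; rewrite mulN1r.
Qed.

Lemma bounded_mfun_norm f : bounded_mfun f -> bounded_mfun (fun w => `|f w|).
Proof.
move=> [mf [K fK]]; split; first exact: measurableT_comp.
by exists K => w; rewrite normr_id.
Qed.

Lemma bounded_mfun_prod (I : Type) (s : seq I) (F : I -> T -> R) :
  (forall i, bounded_mfun (F i)) -> bounded_mfun (fun w => \prod_(i <- s) F i w).
Proof.
move=> hF; elim: s => [|i s ih].
  by under eq_fun do rewrite big_nil; exact: bounded_mfun_cst.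
by under eq_fun do rewrite big_cons; exact: bounded_mfunM.
Qed.

Lemma bounded_mfun_sum (I : Type) (s : seq I) (F : I -> T -> R) :
  (forall i, bounded_mfun (F i)) -> bounded_mfun (fun w => \sum_(i <- s) F i w).
Proof.
move=> hF; elim: s => [|i s ih].
  by under eq_fun do rewrite big_nil; exact: bounded_mfun_cst.
by under eq_fun do rewrite big_cons; exact: bounded_mfunD.
Qed.

Lemma RintegralD_bounded f g : bounded_mfun f -> bounded_mfun g ->
  \int[P]_w (f w + g w) = \int[P]_w f w + \int[P]_w g w.
Proof. by move=> hf hg; rewrite RintegralD//; exact: bounded_mfun_integrable. Qed.

Lemma RintegralB_bounded f g : bounded_mfun f -> bounded_mfun g ->
  \int[P]_w (f w - g w) = \int[P]_w f w - \int[P]_w g w.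
Proof. by move=> hf hg; rewrite RintegralB//; exact: bounded_mfun_integrable. Qed.

Lemma RintegralZl_bounded (k : R) f : bounded_mfun f ->
  \int[P]_w (k * f w) = k * \int[P]_w f w.
Proof. by move=> hf; rewrite RintegralZl//; exact: bounded_mfun_integrable. Qed.

Lemma Rintegral_sum_bounded (I : Type) (s : seq I) (F : I -> T -> R) :
  (forall i, bounded_mfun (F i)) ->
  \int[P]_w (\sum_(i <- s) F i w) = \sum_(i <- s) \int[P]_w F i w.
Proof.
move=> hF; elim: s => [|i s ih].
  under eq_Rintegral do rewrite big_nil.
  by rewrite Rintegral_cst// mul0r big_nil.
under eq_Rintegral do rewrite big_cons.
by rewrite RintegralD_bounded// ?ih ?big_cons//; exact: bounded_mfun_sum.
Qed.

Lemma le_Rintegral_bounded f g : bounded_mfun f -> bounded_mfun g ->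
  (forall w, f w <= g w) -> \int[P]_w f w <= \int[P]_w g w.
Proof.
by move=> hf hg fg; apply: le_Rintegral => //; exact: bounded_mfun_integrable.
Qed.

Lemma le_norm_Rintegral_bounded f : bounded_mfun f ->
  `|\int[P]_w f w| <= \int[P]_w `|f w|.
Proof. by move=> hf; apply: le_normr_Rintegral => //; exact: bounded_mfun_integrable. Qed.

Lemma Rintegral_prob_cst (k : R) : \int[P]_w k = k.
Proof. by rewrite Rintegral_cst// (_ : _ setT = 1%E) ?mulr1//; exact: probability_setT. Qed.

Lemma bounded_mfun_indic (A : set T) : measurable A -> bounded_mfun (\1_A).
Proof.
move=> mA; split; first exact: measurable_indic.
by exists 1 => w; rewrite indicE; case: (w \in A); rewrite ?normr1 ?normr0.
Qed.

Lemma bounded_mfun_bool (b : T -> bool) : measurable [set w | b w] ->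
  bounded_mfun (fun w => (b w)%:R).
Proof.
move=> mb; have := bounded_mfun_indic mb; congr bounded_mfun.
apply/funext => w; rewrite indicE; congr (nat_of_bool _)%:R.
by apply/idP/idP; rewrite inE.
Qed.

Lemma Rintegral_bool (b : T -> bool) : measurable [set w | b w] ->
  \int[P]_w (b w)%:R = fine (P [set w | b w]).
Proof.
move=> mb; rewrite /Rintegral; congr fine.
rewrite -[in RHS](setIT [set w | b w]) -integral_indic//.
apply: eq_integral => w _; rewrite indicE; congr (nat_of_bool _)%:R%:E.
by apply/idP/idP; rewrite inE.
Qed.

Lemma cvg_Rintegral_bounded (F : nat -> T -> R) f (K : R) :
  (forall n, measurable_fun setT (F n)) -> (forall n w, `|F n w| <= K) ->
  (forall w, F n w @[n --> \oo] --> f w) ->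
  \int[P]_w F n w @[n --> \oo] --> \int[P]_w f w.
Proof.
move=> mF FK Ff.
have mf : measurable_fun setT f by apply: measurable_fun_cvg mF _ => w _; exact: Ff.
have [] := @dominated_convergence _ _ _ P setT measurableT (fun n => EFin \o F n)
  (EFin \o f) (EFin \o cst K).
- by move=> n; exact/measurable_EFinP.
- exact/measurable_EFinP.
- by apply: aeW => w _; apply: cvg_EFin; [exact: nearW|exact: Ff].
- exact: finite_measure_integrable_cst.
- by apply: aeW => w n _; rewrite lee_fin.
- move=> ifi _ c; apply: fine_cvg; rewrite fineK//.
  exact: integrable_fin_num.
Qed.

End bounded_functions.

(** * Trigonometric polynomials and approximation of indicators of rays *)

Section trigonometric_polynomials.
Context {R : realType}.
Implicit Types (f g : R -> R) (a b c x : R).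

(** The free phase [b] lets one kind of generator cover cosines, sines and constants, and closure
    under products is the product-to-sum formula. *)
Inductive trigpoly : (R -> R) -> Prop :=
| trigpoly_cos k a b : trigpoly (fun x => k * cos (a * x + b))
| trigpolyD f g : trigpoly f -> trigpoly g -> trigpoly (fun x => f x + g x).

Lemma trigpoly_cst k : trigpoly (fun=> k).
Proof.
have := trigpoly_cos k 0 0; congr trigpoly.
by apply/funext => x; rewrite mul0r addr0 cos0 mulr1.
Qed.

Lemma trigpolyM f g : trigpoly f -> trigpoly g -> trigpoly (fun x => f x * g x).
Proof.
move=> hf hg; elim: hf => [k a b|f1 f2 h1 ih1 h2 ih2]; last first.
  have := trigpolyD ih1 ih2; congr trigpoly.
  by apply/funext => x; rewrite mulrDl.
elim: hg => [k' a' b'|f1 f2 h1 ih1 h2 ih2]; last first.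
  have := trigpolyD ih1 ih2; congr trigpoly.
  by apply/funext => x; rewrite mulrDr.
have := trigpolyD (trigpoly_cos (k * k' / 2) (a + a') (b + b'))
  (trigpoly_cos (k * k' / 2) (a - a') (b - b')).
congr trigpoly; apply/funext => x.
have -> : (a + a') * x + (b + b') = (a * x + b) + (a' * x + b') by ring.
have -> : (a - a') * x + (b - b') = (a * x + b) - (a' * x + b') by ring.
by rewrite cosD cosB; field.
Qed.

Lemma trigpolyX f n : trigpoly f -> trigpoly (fun x => f x ^+ n).
Proof.
move=> hf; elim: n => [|n ih].
  by under eq_fun do rewrite expr0; exact: trigpoly_cst.
by under eq_fun do rewrite exprS; exact: trigpolyM.
Qed.

Lemma trigpolyB f g : trigpoly f -> trigpoly g -> trigpoly (fun x => f x - g x).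
Proof.
move=> hf hg; have := trigpolyD hf (trigpolyM (trigpoly_cst (-1)) hg).
by congr trigpoly; apply/funext => x; rewrite mulN1r.
Qed.

Lemma trigpoly_bounded_mfun f : trigpoly f ->
  measurable_fun setT f /\ exists K, forall x, `|f x| <= K.
Proof.
elim=> [k a b|g h _ [mg [K gK]] _ [mh [L hL]]]; last first.
  split; first exact: measurable_funD.
  by exists (K + L) => w; rewrite (le_trans (ler_normD _ _))// lerD.
split.
  apply: measurable_funM => //; apply: measurableT_comp.
    exact: (continuous_measurable_fun (@continuous_cos R)).
  by apply: measurable_funD => //; exact: measurable_funM.
by exists `|k| => x; rewrite normrM ler_piMr// norm_cos_le1.
Qed.

(** The closure of the trigonometric polynomials in L1 of the standard normal law. Keeping the
    approximants in [[0, 1]] makes the errors of the factors of a product add up without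
    amplification. *)
Definition trig_approx g := measurable_fun setT g /\ (forall x, 0 <= g x <= 1) /\
  forall e, 0 < e -> exists f, [/\ trigpoly f, forall x, 0 <= f x <= 1 &
    \int[normal_prob 0 1]_x `|g x - f x| <= e].

Notation gamma := (@normal_prob R 0 1 : probability _ R).

Lemma unit_bounded_mfun g : measurable_fun setT g -> (forall x, 0 <= g x <= 1) ->
  @bounded_mfun _ (measurableTypeR R) R g.
Proof.
move=> mg g01; split => //; exists 1 => x.
by have /andP[g0 g1] := g01 x; rewrite ger0_norm.
Qed.

Lemma trigpoly_approx f : trigpoly f -> (forall x, 0 <= f x <= 1) -> trig_approx f.
Proof.
move=> hf f01; have [mf _] := trigpoly_bounded_mfun hf.
split => //; split => // e e0; exists f; split => //.
under eq_Rintegral do rewrite subrr normr0.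
by rewrite Rintegral_cst// mul0r ltW.
Qed.

Lemma trig_approxC g : trig_approx g -> trig_approx (fun x => 1 - g x).
Proof.
move=> [mg [g01 ga]]; split; first exact: measurable_funB.
split=> [x|e /ga[f [hf f01 fe]]]; first by have := g01 x; lra.
exists (fun x => 1 - f x); split.
- exact: (trigpolyB (trigpoly_cst 1)).
- by move=> x; have := f01 x; lra.
- apply: le_trans fe; rewrite le_eqVlt; apply/orP; left; apply/eqP.
  by apply: eq_Rintegral => x _; rewrite -normrN; congr `|_|; ring.
Qed.

Lemma trig_approxM g h : trig_approx g -> trig_approx h ->
  trig_approx (fun x => g x * h x).
Proof.
move=> [mg [g01 ga]] [mh [h01 ha]]; split; first exact: measurable_funM.
have M01 (u v : R -> R) (x : R) : (forall x, 0 <= u x <= 1) -> (forall x, 0 <= v x <= 1) ->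
    0 <= u x * v x <= 1.
  move=> /(_ x)/andP[u0 u1] /(_ x)/andP[v0 v1].
  by rewrite mulr_ge0//= mulr_ile1.
split=> [x|e e0]; first exact: M01.
have [//|f [hf f01 fe]] := ga (e / 2); first by rewrite divr_gt0.
have [//|k [hk k01 ke]] := ha (e / 2); first by rewrite divr_gt0.
exists (fun x => f x * k x); split; first exact: trigpolyM.
  by move=> x; exact: M01.
have [mf _] := trigpoly_bounded_mfun hf; have [mk _] := trigpoly_bounded_mfun hk.
have bg := unit_bounded_mfun mg g01; have bh := unit_bounded_mfun mh h01.
have bf := unit_bounded_mfun mf f01; have bk := unit_bounded_mfun mk k01.
rewrite [e]splitr; apply: le_trans (lerD fe ke).
rewrite -(RintegralD_bounded gamma); try exact/bounded_mfun_norm/bounded_mfunB.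
apply: (le_Rintegral_bounded gamma).
- by apply/bounded_mfun_norm/bounded_mfunB; exact: bounded_mfunM.
- by apply: bounded_mfunD; exact/bounded_mfun_norm/bounded_mfunB.
move=> x; have -> : g x * h x - f x * k x = (g x - f x) * h x + f x * (h x - k x) by ring.
have /andP[h0 h1] := h01 x; have /andP[f0 f1] := f01 x.
rewrite (le_trans (ler_normD _ _))// !normrM (ger0_norm h0) (ger0_norm f0).
by rewrite lerD// ?ler_piMr// ler_piMl.
Qed.

(** Between the bounds 0 and 1, pointwise convergence implies L1 convergence, so an approximant at
    [e / 2] of a late enough term serves for the limit. *)
Lemma trig_approx_cvg (G : nat -> R -> R) g : (forall n, trig_approx (G n)) ->
  (forall x, G n x @[n --> \oo] --> g x) -> trig_approx g.
Proof.
move=> GA Gg.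
have mG n : measurable_fun [set: measurableTypeR R] (G n) by have [] := GA n.
have G01 n x : 0 <= G n x <= 1 by have [_ []] := GA n.
have mg : measurable_fun [set: measurableTypeR R] g.
  by apply: measurable_fun_cvg mG _ => x _; exact: Gg.
have g01 x : 0 <= g x <= 1.
  apply/andP; split.
    by apply: (cvgr_to_ge (Gg x)); apply: nearW => n; have /andP[] := G01 n x.
  by apply: (cvgr_to_le (Gg x)); apply: nearW => n; have /andP[] := G01 n x.
split => //; split => // e e0.
have bG n := unit_bounded_mfun (mG n) (G01 n); have bg := unit_bounded_mfun mg g01.
have cv : \int[gamma]_x `|g x - G n x| @[n --> \oo] --> \int[gamma]_x (0 : R).
  apply: (@cvg_Rintegral_bounded _ _ _ gamma (fun n x => `|g x - G n x|) (fun=> 0) 1).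
  - by move=> n; have [] := bounded_mfun_norm (bounded_mfunB bg (bG n)).
  - move=> n x; rewrite normr_id ler_norml.
    by have := G01 n x; have := g01 x; lra.
  - move=> x.
    have : g x - G n x @[n --> \oo] --> g x - g x.
      by apply: cvgB; [exact: cvg_cst|exact: Gg].
    by move=> /cvg_norm; rewrite subrr normr0; apply.
rewrite Rintegral_prob_cst in cv.
have [N _ /(_ N (leqnn N)) hN] : \forall n \near \oo, `|\int[gamma]_x `|g x - G n x| | <= e / 2.
  by move/cvgr0_norm_le : cv; apply; rewrite divr_gt0.
have [_ [_ /(_ (e / 2))[|f [hf f01 fe]]]] := GA N; first by rewrite divr_gt0.
exists f; split => //.
have [mf _] := trigpoly_bounded_mfun hf; have bf := unit_bounded_mfun mf f01.
rewrite ger0_norm ?Rintegral_ge0// in hN.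
rewrite [e]splitr; apply: le_trans (lerD hN fe).
rewrite -(RintegralD_bounded gamma); try exact/bounded_mfun_norm/bounded_mfunB.
apply: (le_Rintegral_bounded gamma).
- by apply/bounded_mfun_norm/bounded_mfunB.
- by apply: bounded_mfunD; exact/bounded_mfun_norm/bounded_mfunB.
- by move=> x; exact: ler_distD.
Qed.

Lemma bernoulli_ineq x n : -1 <= x -> 1 + n%:R * x <= (1 + x) ^+ n.
Proof.
move=> x1; elim: n => [|n ih]; first by rewrite mul0r addr0 expr0.
rewrite exprS; apply: le_trans (ler_wpM2l _ ih); last by lra.
rewrite -natr1; have := sqr_ge0 x; have := ler0n R n; nra.
Qed.

Lemma cvg_natM_expr c : 0 <= c < 1 -> n%:R * c ^+ n @[n --> \oo] --> 0.
Proof.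
move=> /andP[c0 c1].
have [->|cn0] := eqVneq c 0.
  apply: cvg_near_cst; exists 1%N => // -[//|n] _.
  by rewrite expr0n/= mulr0.
have cp : 0 < c by rewrite lt_def cn0.
(* Split [c ^ n] as [r ^ n * r ^ n]: Bernoulli's inequality for [1 / r = 1 + h] gives
   [n * r ^ n <= 1 / h], and the other factor tends to 0. *)
pose r := Num.sqrt c.
have r0 : 0 < r by rewrite sqrtr_gt0.
have rc : r ^+ 2 = c by rewrite sqr_sqrtr.
have r1 : r < 1 by have := sqr_ge0 (r - 1); nra.
pose h := r^-1 - 1.
have h0 : 0 < h by rewrite subr_gt0 invf_gt1.
have bound n : n%:R * c ^+ n <= h^-1 * r ^+ n.
  rewrite -rc exprAC expr2 mulrA ler_wpM2r ?exprn_ge0 ?(ltW r0)//.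
  rewrite -ler_pdivlMr ?exprn_gt0// -exprVn ler_pdivlMl//.
  have -> : r^-1 = 1 + h by rewrite addrC subrK.
  apply: le_trans (bernoulli_ineq n _); last by lra.
  by rewrite mulrC lerDr.
have cr : h^-1 * r ^+ n @[n --> \oo] --> h^-1 * 0.
  apply: cvgMr; apply: cvg_expr; rewrite ger0_norm ?ltW//.
rewrite mulr0 in cr; apply: squeeze_cvgr (cvg_cst 0) cr.
by apply: nearW => n; rewrite bound andbT mulr_ge0// exprn_ge0.
Qed.

(** With [N = 2 ^ n * n] and [v = u ^ n], one has [N v = n (2 u) ^ n]. Below 1/2 this tends to 0 and
    [(1 - v) ^ N >= 1 - N v]. From 1/2 on it is at least [n], and [(1 - v) ^ N (1 + N v) <= (1 - v ^
    2) ^ N <= 1]. The factor [n] in the exponent makes the limit 0 at [u = 1/2] too. *)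
Lemma cvg_step_poly u : 0 <= u <= 1 ->
  (1 - u ^+ n) ^+ (2 ^ n * n) @[n --> \oo] --> ((u < 2^-1)%R%:R : R).
Proof.
move=> /andP[u0 u1].
have un n : 0 <= u ^+ n <= 1 by rewrite exprn_ge0//= exprn_ile1.
have mx n : (2 ^ n * n)%:R * u ^+ n = n%:R * (2 * u) ^+ n.
  by rewrite natrM natrX exprMn; ring.
have [uh|uh] := ltP u 2^-1.
  have c01 : 0 <= 2 * u < 1 by lra.
  have lo : 1 - n%:R * (2 * u) ^+ n @[n --> \oo] --> (1 : R).
    have : 1 - n%:R * (2 * u) ^+ n @[n --> \oo] --> (1 - 0 : R).
      by apply: cvgB; [exact: cvg_cst|exact: cvg_natM_expr].
    by rewrite subr0; apply.
  suff : (1 - u ^+ n) ^+ (2 ^ n * n) @[n --> \oo] --> (1 : R) by [].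
  apply: (@squeeze_cvgr _ _ _ _ (fun n => 1 - n%:R * (2 * u) ^+ n) (fun=> 1) _ _ 1 lo);
    last exact: cvg_cst.
  apply: nearW => n; rewrite -mx -mulrN.
  rewrite bernoulli_ineq ?exprn_ile1//=; have := un n; lra.
suff : (1 - u ^+ n) ^+ (2 ^ n * n) @[n --> \oo] --> (0 : R) by [].
apply: squeeze_cvgr (cvg_cst 0) (@cvg_harmonic R).
apply: nearW => n; have /andP[n0 n1] := un n.
rewrite exprn_ge0 ?subr_ge0//= /harmonic/= -[leRHS]mul1r ler_pdivlMr ?ltr0Sn//.
apply: (@le_trans _ _ ((1 - u ^+ n) ^+ (2 ^ n * n) * (1 + u ^+ n) ^+ (2 ^ n * n))).
  rewrite ler_wpM2l ?exprn_ge0 ?subr_ge0//.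
  apply: le_trans (bernoulli_ineq _ _); last by lra.
  rewrite -natr1 addrC lerD2l mx -[leLHS]mulr1 ler_wpM2l//.
  by rewrite exprn_ege1//; lra.
rewrite -exprMn exprn_ile1//; nra.
Qed.

Lemma sin_sign x : `|x| < pi -> (sin x < 0) = (x < 0).
Proof.
move=> xpi; have [x0|x0|->] := ltgtP x 0; last by rewrite sin0 ltxx.
  have : 0 < sin (- x) by rewrite sin_gt0_pi// oppr_gt0 x0/=; have := xpi; rewrite ltr_norml; lra.
  by rewrite sinN oppr_gt0.
apply/negbTE; rewrite -leNgt sin_ge0_pi// ltW//=.
by rewrite ltW// (le_lt_trans (ler_norm _)).
Qed.

(** The sine of [(x - c) / (k + 1)] has the sign of [x - c] once [(k + 1) * pi] exceeds [|x - c|],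
    so the indicators of negative slow sines converge pointwise to that of [x < c]. Each of them is
    a limit of polynomials in [y k], the sine rescaled to [[0, 1]], for which a negative sine means
    [y k x < 1/2]. *)
Lemma trig_approx_ge c : trig_approx (fun x => (c <= x)%R%:R).
Proof.
pose y k x : R := (1 + sin ((x - c) / k.+1%:R)) / 2.
have y01 k x : 0 <= y k x <= 1.
  have := sin_le1 ((x - c) / k.+1%:R); have := sin_geN1 ((x - c) / k.+1%:R).
  by rewrite /y; lra.
have ty k : trigpoly (y k).
  have := trigpolyD (trigpoly_cst 2^-1) (trigpoly_cos 2^-1 k.+1%:R^-1
     (- c / k.+1%:R - pi / 2)).
  congr trigpoly; apply/funext => x.
  have -> : k.+1%:R^-1 * x + (- c / k.+1%:R - pi / 2) = (x - c) / k.+1%:R - pi / 2.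
    by rewrite mulrBl mulNr addrA (mulrC _ x).
  by rewrite cosBpihalf /y; field.
have A1 k : trig_approx (fun x => (sin ((x - c) / k.+1%:R) < 0)%R%:R).
  apply: (@trig_approx_cvg (fun n x => (1 - y k x ^+ n) ^+ (2 ^ n * n))) => [n|x].
    apply: trigpoly_approx.
      by apply: trigpolyX; apply: (trigpolyB (trigpoly_cst 1)); exact: trigpolyX.
    move=> x; have /andP[h0 h1] := y01 k x.
    have z : 0 <= 1 - y k x ^+ n <= 1.
      by rewrite subr_ge0 exprn_ile1//= lerBlDr lerDl exprn_ge0.
    by have /andP[z0 z1] := z; rewrite exprn_ge0//= exprn_ile1.
  have -> : (sin ((x - c) / k.+1%:R) < 0) = (y k x < 2^-1).
    by rewrite /y; apply/idP/idP; lra.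
  exact: cvg_step_poly.
have A2 : trig_approx (fun x => (x - c < 0)%R%:R).
  apply: trig_approx_cvg A1 _ => x; apply: cvg_near_cst.
  exists (Num.truncn (`|x - c| / pi)) => // k /= xk.
  congr (nat_of_bool _)%:R; rewrite sin_sign; last first.
    rewrite normrM (ger0_norm (_ : 0 <= k.+1%:R^-1)) ?invr_ge0//.
    rewrite ltr_pdivrMr ?ltr0Sn// mulrC -ltr_pdivrMr ?pi_gt0//.
    rewrite (lt_le_trans (truncnS_gt _))// ler_nat ltnS//.
  by rewrite pmulr_llt0// invr_gt0.
have := trig_approxC A2; congr trig_approx; apply/funext => x.
rewrite subr_lt0 leNgt; case: (x < c); rewrite ?subrr ?subr0//.
Qed.

End trigonometric_polynomials.

(** * Independence from the laws of linear combinations *)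

Section white_noise.
Context d (T : measurableType d) (R : realType) (P : probability T R) (n : nat).
Variable Y : 'I_n -> T -> R.
Notation gamma := (@normal_prob R 0 1).

(* By the Cramer-Wold device, this says that the [Y i] are independent standard
   normal variables. *)
Definition white := (forall i, measurable_fun setT (Y i)) /\
  forall (a : 'I_n -> R) (A : set R), measurable A ->
    P ((fun w => \sum_i a i * Y i w) @^-1` A) =
    gamma ((fun z => Num.sqrt (\sum_i a i ^+ 2) * z) @^-1` A).

Hypothesis whiteY : white.

Let mY i : measurable_fun setT (Y i). Proof. by have [] := whiteY. Qed.

Lemma white_marginal i (A : set R) : measurable A -> P (Y i @^-1` A) = gamma A.
Proof.
move=> mA; have [_ /(_ (fun j => (j == i)%:R) A mA)] := whiteY.
have -> : (fun w => \sum_j (j == i)%:R * Y j w) = Y i.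
  apply/funext => w; rewrite (bigD1 i)//= eqxx mul1r big1 ?addr0// => j ji.
  by rewrite (negbTE ji) mul0r.
move=> ->; rewrite (bigD1 i)//= eqxx expr1n big1 ?addr0 ?sqrtr1 => [|j ji].
  by congr (gamma _); apply/seteqP; split => z /=; rewrite mul1r.
by rewrite (negbTE ji) expr0n.
Qed.

Lemma white_expectation i (f : R -> R) (K : R) : measurable_fun setT f ->
  (forall x, `|f x| <= K) -> \int[P]_w f (Y i w) = \int[gamma]_x f x.
Proof.
move=> mf fK.
apply: (@same_law_Rintegral _ _ _ _ R P gamma (Y i) id) => //.
- by move=> A mA; exact: white_marginal.
- exact: (@integrable_gamma_bounded _ _ K).
Qed.

Lemma white_cos (a : 'I_n -> R) (b : R) :
  \int[P]_w cos (\sum_i a i * Y i w + b) =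
  cos b * expR (- ((\sum_i a i ^+ 2) / 2)).
Proof.
have mc : measurable_fun setT (fun x : R => cos (x + b)).
  apply: measurableT_comp; first exact: (continuous_measurable_fun (@continuous_cos R)).
  exact: measurable_funD.
have [_ h] := whiteY.
rewrite (@same_law_Rintegral _ _ _ _ R P gamma (fun w => \sum_i a i * Y i w)
  (fun z => Num.sqrt (\sum_i a i ^+ 2) * z) _ _ (h a) (fun x => cos (x + b)))//.
- by rewrite gamma_cosD sqr_sqrtr// sumr_ge0// => i _; exact: sqr_ge0.
- by apply: measurable_sum => i; exact: measurable_funM.
- exact: measurable_funM.
- apply: (@integrable_gamma_bounded _ (fun z => cos (Num.sqrt (\sum_i a i ^+ 2) * z + b)) 1).
    apply: (measurableT_comp mc); exact: measurable_funM.
  by move=> x; exact: norm_cos_le1.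
Qed.

Lemma bounded_trig i f : trigpoly f -> bounded_mfun (fun w => f (Y i w)).
Proof.
move=> /trigpoly_bounded_mfun[mf [K fK]]; split; first exact: measurableT_comp.
by exists K.
Qed.

Lemma bounded_cos_sum (a : 'I_n -> R) (b : R) :
  bounded_mfun (fun w => cos (\sum_i a i * Y i w + b)).
Proof.
split; last by exists 1 => w; exact: norm_cos_le1.
apply: measurableT_comp; first exact: (continuous_measurable_fun (@continuous_cos R)).
apply: measurable_funD => //.
by apply: measurable_sum => i; exact: measurable_funM.
Qed.

(** The extra cosine, whose coefficients vanish on [l], is what makes the induction close:
    multiplying it by a cosine in [Y j] yields two cosines of the same shape, with coefficient [s]
    or [- s] at [j]. *)
Lemma white_cos_prod (f : 'I_n -> R -> R) (l : seq 'I_n) : (forall i, trigpoly (f i)) ->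
  uniq l -> forall (a : 'I_n -> R) (b : R), (forall i, i \in l -> a i = 0) ->
  \int[P]_w (cos (\sum_i a i * Y i w + b) * \prod_(j <- l) f j (Y j w)) =
  cos b * expR (- ((\sum_i a i ^+ 2) / 2)) * \prod_(j <- l) \int[gamma]_x f j x.
Proof.
move=> hf; elim: l => [|j l ih] /=.
  move=> _ a b _; rewrite big_nil mulr1 -white_cos.
  by apply: eq_Rintegral => w _; rewrite big_nil mulr1.
move=> /andP[jl ul] a b al.
have bp : bounded_mfun (fun w => \prod_(j <- l) f j (Y j w)).
  by apply: bounded_mfun_prod => i; exact: bounded_trig.
have al' i : i \in l -> a i = 0 by move=> il; rewrite al// inE il orbT.
have aj : a j = 0 by rewrite al// inE eqxx.
suff main g : trigpoly g ->
    \int[P]_w (cos (\sum_i a i * Y i w + b) * (g (Y j w) * \prod_(j <- l) f j (Y j w))) =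
    cos b * expR (- ((\sum_i a i ^+ 2) / 2)) *
    (\int[gamma]_x g x * \prod_(j <- l) \int[gamma]_x f j x).
  by rewrite big_cons -main//; apply: eq_Rintegral => w _; rewrite big_cons.
elim=> [k s t|g1 g2 hg1 ih1 hg2 ih2]; last first.
  have bm h : trigpoly h -> bounded_mfun (fun w => cos (\sum_i a i * Y i w + b) *
       (h (Y j w) * \prod_(j <- l) f j (Y j w))).
    move=> hh; apply: bounded_mfunM; first exact: bounded_cos_sum.
    by apply: bounded_mfunM => //; exact: bounded_trig.
  have bt h : trigpoly h -> @bounded_mfun _ (measurableTypeR R) R h.
    by move=> /trigpoly_bounded_mfun.
  rewrite (RintegralD_bounded gamma (bt _ hg1) (bt _ hg2)).
  rewrite mulrDl mulrDr -ih1 -ih2 -(RintegralD_bounded P (bm _ hg1) (bm _ hg2)).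
  by apply: eq_Rintegral => w _; rewrite mulrDl mulrDr.
pose ap i := if i == j then s else a i.
pose am i := if i == j then - s else a i.
have sumE (c : R) w : \sum_i (if i == j then c else a i) * Y i w =
    \sum_i a i * Y i w + c * Y j w.
  rewrite (bigD1 j)//= eqxx [in RHS](bigD1 j)//= aj mul0r add0r addrC; congr (_ + _).
  by apply: eq_bigr => i /negbTE ->.
have sqE (c : R) : \sum_i (if i == j then c else a i) ^+ 2 = \sum_i a i ^+ 2 + c ^+ 2.
  rewrite (bigD1 j)//= eqxx [in RHS](bigD1 j)//= aj expr0n/= add0r addrC; congr (_ + _).
  by apply: eq_bigr => i /negbTE ->.
have apl i : i \in l -> ap i = 0.
  by move=> il; rewrite /ap; case: eqP => [e|_]; [rewrite e in il; rewrite il in jl|exact: al'].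
have aml i : i \in l -> am i = 0.
  by move=> il; rewrite /am; case: eqP => [e|_]; [rewrite e in il; rewrite il in jl|exact: al'].
pose F c e w := cos (\sum_i c i * Y i w + e) * \prod_(j <- l) f j (Y j w).
have bF c e : bounded_mfun (F c e) by apply: bounded_mfunM => //; exact: bounded_cos_sum.
transitivity (\int[P]_w (k / 2 * (F ap (b + t) w + F am (b - t) w))).
  apply: eq_Rintegral => w _; rewrite /F !sumE.
  have -> : \sum_i a i * Y i w + s * Y j w + (b + t) =
    (\sum_i a i * Y i w + b) + (s * Y j w + t) by ring.
  have -> : \sum_i a i * Y i w + - s * Y j w + (b - t) =
    (\sum_i a i * Y i w + b) - (s * Y j w + t) by ring.
  move: (\sum_i a i * Y i w + b) (s * Y j w + t) => A B.
  by rewrite cosD cosB; field.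
rewrite RintegralZl_bounded; last exact: bounded_mfunD.
rewrite RintegralD_bounded// !ih// !sqE sqrrN.
have -> : \int[gamma]_x (k * cos (s * x + t)) = k * (cos t * expR (- (s ^+ 2 / 2))).
  rewrite -gamma_cosD (@RintegralZl_bounded _ _ _ gamma)//; split.
    apply: measurableT_comp; first exact: (continuous_measurable_fun (@continuous_cos R)).
    by apply: measurable_funD => //; exact: measurable_funM.
  by exists 1 => x; exact: norm_cos_le1.
(* Both cosines have variance increased by [s ^ 2], so the exponential factors out and [cos (b + t)
   + cos (b - t) = 2 cos b cos t] separates the phases. *)
by rewrite mulrDl opprD expRD cosD cosB; field.
Qed.

Lemma norm_prod_diff (I : Type) (l : seq I) (u v : I -> R) :
  (forall i, 0 <= u i <= 1) -> (forall i, 0 <= v i <= 1) ->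
  `|\prod_(i <- l) u i - \prod_(i <- l) v i| <= \sum_(i <- l) `|u i - v i|.
Proof.
move=> hu hv; elim: l => [|i l ih]; first by rewrite !big_nil subrr normr0.
rewrite !big_cons.
set p := \prod_(j <- l) u j in ih *; set q := \prod_(j <- l) v j in ih *.
have p01 : 0 <= p <= 1.
  rewrite /p; elim: (l) => [|j m /andP[m0 m1]]; first by rewrite big_nil ler01 lexx.
  by have /andP[u0 u1] := hu j; rewrite big_cons mulr_ge0//= mulr_ile1.
have -> : u i * p - v i * q = (u i - v i) * p + v i * (p - q) by ring.
have /andP[p0 p1] := p01; have /andP[v0 v1] := hv i.
rewrite (le_trans (ler_normD _ _))// !normrM (ger0_norm p0) (ger0_norm v0).
by apply: lerD; [rewrite ler_piMr|apply: le_trans ih; rewrite ler_piMl].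
Qed.

(** For trigonometric polynomials this is [white_cos_prod] with the trivial cosine. The
    approximation error is an L1 error under the standard normal law, which is the law of each
    [Y i], so it carries over to the product. *)
Lemma white_independent (g : 'I_n -> R -> R) : (forall i, trig_approx (g i)) ->
  \int[P]_w (\prod_i g i (Y i w)) = \prod_i \int[gamma]_x g i x.
Proof.
move=> hg; apply/eqP; rewrite -subr_eq0 -normr_le0.
have mg i : measurable_fun setT (g i) by have [] := hg i.
have g01 i x : 0 <= g i x <= 1 by have [_ []] := hg i.
(* One [n * e] pays for replacing [g] by [f] in the integral of the product, the other for replacing
   it in the product of the integrals. *)
suff key e : 0 < e -> `|\int[P]_w (\prod_i g i (Y i w)) - \prod_i \int[gamma]_x g i x|
    <= n%:R * e + n%:R * e.
  apply/ler_addgt0Pr => e e0; rewrite add0r.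
  (* Dividing by [n.+1] instead of [n] includes the case [n = 0]. *)
  apply: le_trans (key (e / (2 * n.+1%:R)) _) _; first by rewrite divr_gt0// mulr_gt0.
  have -> : n%:R * (e / (2 * n.+1%:R)) + n%:R * (e / (2 * n.+1%:R)) = e * (n%:R / n.+1%:R).
    have : n.+1%:R != 0 :> R by rewrite pnatr_eq0.
    by move: (n.+1%:R : R) => m m0; field.
  by rewrite ler_piMr ?(ltW e0)// ler_pdivrMr// mul1r ler_nat.
move=> e0.
have [f hf] : exists f : 'I_n -> R -> R, forall i, [/\ trigpoly (f i),
    forall x, 0 <= f i x <= 1 & \int[gamma]_x `|g i x - f i x| <= e].
  have h i : exists f, [/\ trigpoly f, forall x, 0 <= f x <= 1 &
    \int[gamma]_x `|g i x - f x| <= e] by have [_ [_ /(_ e e0)]] := hg i.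
  by exists (fun i => projT1 (cid (h i))) => i; exact: (projT2 (cid (h i))).
have tf i : trigpoly (f i) by have [] := hf i.
have f01 i x : 0 <= f i x <= 1 by have [_ ] := hf i.
have mf i : measurable_fun setT (f i) by have [] := trigpoly_bounded_mfun (tf i).
have fe i : \int[gamma]_x `|g i x - f i x| <= e by have [] := hf i.
have bg i := unit_bounded_mfun (mg i) (g01 i).
have bf i := unit_bounded_mfun (mf i) (f01 i).
have bY (h : R -> R) i : measurable_fun setT h -> (forall x, 0 <= h x <= 1) ->
    bounded_mfun (fun w => h (Y i w)).
  move=> mh h01; split; first exact: measurableT_comp.
  by exists 1 => w; have /andP[h0 h1] := h01 (Y i w); rewrite ger0_norm.
have fE : \int[P]_w (\prod_i f i (Y i w)) = \prod_i \int[gamma]_x f i x.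
  have := @white_cos_prod f (index_enum 'I_n) tf (index_enum_uniq _) (fun=> 0) 0 (fun _ _ => erefl).
  rewrite cos0 big1; last by move=> i _; rewrite expr0n.
  rewrite mul0r oppr0 expR0 !mul1r => <-.
  apply: eq_Rintegral => w _; have -> : \sum_i 0 * Y i w = 0.
    by rewrite big1// => i _; rewrite mul0r.
  by rewrite addr0 cos0 mul1r.
rewrite -(subrK (\int[P]_w (\prod_i f i (Y i w))) (\int[P]_w (\prod_i g i (Y i w)))).
rewrite -addrA [X in _ + (X - _)]fE (le_trans (ler_normD _ _))//.
have sumle (F : 'I_n -> R) : (forall i, F i <= e) -> \sum_i F i <= n%:R * e.
  move=> h; apply: (le_trans (ler_sum _ (fun i _ => h i))).
  by rewrite big_const_ord iter_addr_0 mulr_natl.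
apply: lerD.
  have bpg : bounded_mfun (fun w => \prod_i g i (Y i w)).
    by apply: bounded_mfun_prod => i; exact: bY.
  have bpf : bounded_mfun (fun w => \prod_i f i (Y i w)).
    by apply: bounded_mfun_prod => i; exact: bY.
  have bd i : bounded_mfun (fun w => `|g i (Y i w) - f i (Y i w)|).
    by apply/bounded_mfun_norm/bounded_mfunB; exact: bY.
  rewrite -RintegralB_bounded// (le_trans (le_norm_Rintegral_bounded _ _))//.
    exact: bounded_mfunB.
  apply: (@le_trans _ _ (\int[P]_w (\sum_i `|g i (Y i w) - f i (Y i w)|))).
    apply: le_Rintegral_bounded; [exact/bounded_mfun_norm/bounded_mfunB|exact: bounded_mfun_sum|].
    by move=> w; apply: norm_prod_diff => i.
  rewrite Rintegral_sum_bounded//; apply: sumle => i.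
  rewrite (@white_expectation i (fun x => `|g i x - f i x|) 1)//.
    by apply: measurableT_comp => //; exact: measurable_funB.
  move=> x; rewrite normr_id ler_norml.
  by have := g01 i x; have := f01 i x; lra.
have E01 (h : R -> R) : measurable_fun setT h -> (forall x, 0 <= h x <= 1) ->
    0 <= \int[gamma]_x h x <= 1.
  move=> mh h01; rewrite Rintegral_ge0/=; last by move=> x _; have /andP[] := h01 x.
  rewrite -[leRHS](Rintegral_prob_cst gamma).
  apply: (le_Rintegral_bounded gamma); [exact: unit_bounded_mfun|exact: bounded_mfun_cst|].
  by move=> x; have /andP[] := h01 x.
apply: (le_trans (norm_prod_diff _ _ _)) => [i|i|]; [exact: E01|exact: E01|].
apply: sumle => i; apply: le_trans (fe i).
rewrite distrC -(RintegralB_bounded gamma)//.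
exact/(le_norm_Rintegral_bounded gamma)/bounded_mfunB.
Qed.

End white_noise.

(** * Equicorrelated normal vectors *)

Section Rintegral_sum.
Context d (T : measurableType d) (R : realType) (mu : {measure set T -> \bar R}).
Context (I : Type) (F : I -> T -> R).
Hypothesis intF : forall i, mu.-integrable setT (EFin \o F i).

Let int_sum (s : seq I) :
  mu.-integrable setT (EFin \o (fun w => \sum_(i <- s) F i w)).
Proof.
elim: s => [|i s ih].
  have -> : EFin \o (fun w => \sum_(i <- [::]) F i w) = cst 0%E :> (T -> \bar R).
    by apply/funext => w /=; rewrite big_nil.
  exact: integrable0.
have -> : EFin \o (fun w => \sum_(i <- i :: s) F i w) =
    (fun w => (F i w)%:E + (\sum_(i <- s) F i w)%R%:E)%E.
  by apply/funext => w /=; rewrite big_cons EFinD.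
exact: (integrableD measurableT (intF i) ih).
Qed.

Lemma Rintegral_sum (s : seq I) :
  \int[mu]_w (\sum_(i <- s) F i w) = \sum_(i <- s) \int[mu]_w F i w.
Proof.
elim: s => [|i s ih].
  under eq_Rintegral do rewrite big_nil.
  by rewrite Rintegral_cst// mul0r big_nil.
under eq_Rintegral do rewrite big_cons.
by rewrite (RintegralD measurableT (intF i) (int_sum s)) ih big_cons.
Qed.

End Rintegral_sum.

Section affine_gaussian.
Context {R : realType}.
Notation gamma := (@normal_prob R 0 1 : probability _ R).

Lemma integrable_gamma_id : gamma.-integrable setT (fun x : R => x%:E).
Proof.
apply: gamma_integrable_le integrable_gamma_abs _ => //.
Qed.

Lemma integrable_gamma_affine (m s : R) :
  gamma.-integrable setT (fun x : R => (m + s * x)%:E).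
Proof.
under eq_fun do rewrite EFinD EFinM.
apply: integrableD => //; first exact: finite_measure_integrable_cst.
by apply: integrableZl => //; exact: integrable_gamma_id.
Qed.

Lemma integrable_gamma_affine_sqr (m s : R) :
  gamma.-integrable setT (fun x : R => ((m + s * x) ^+ 2)%:E).
Proof.
have -> : (fun x : R => ((m + s * x) ^+ 2)%:E) =
    (fun x => ((m ^+ 2 + (2 * m * s) * x)%:E + (s ^+ 2)%:E * (x ^+ 2)%:E)%E).
  by apply/funext => x; rewrite -EFinM -EFinD; congr EFin; ring.
apply: integrableD => //; first exact: integrable_gamma_affine.
by apply: integrableZl => //; exact: integrable_gamma_sqr.
Qed.

Lemma gamma_affine_mean (m s : R) : \int[gamma]_x (m + s * x) = m.
Proof.
rewrite RintegralD//; first last.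
- rewrite (_ : _ \o _ = fun x => s%:E * x%:E)%E//.
  by apply: integrableZl => //; exact: integrable_gamma_id.
- exact: (finite_measure_integrable_cst gamma).
- rewrite Rintegral_prob_cst RintegralZl//; last exact: integrable_gamma_id.
  by rewrite gamma_mean mulr0 addr0.
Qed.

Lemma gamma_affine_sqr (m s : R) :
  \int[gamma]_x ((m + s * x) ^+ 2) = m ^+ 2 + s ^+ 2.
Proof.
have -> : \int[gamma]_x ((m + s * x) ^+ 2) =
    \int[gamma]_x ((m ^+ 2 + (2 * m * s) * x) + s ^+ 2 * x ^+ 2).
  by apply: eq_Rintegral => x _; ring.
rewrite RintegralD//.
- rewrite gamma_affine_mean RintegralZl//; last exact: integrable_gamma_sqr.
  by rewrite gamma_var mulr1.
- exact: integrable_gamma_affine.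
- rewrite (_ : _ \o _ = fun x => (s ^+ 2)%:E * (x ^+ 2)%:E)%E//.
  by apply: integrableZl => //; exact: integrable_gamma_sqr.
Qed.

End affine_gaussian.

Section normally_distributed.
Context d (T : measurableType d) (R : realType) (P : probability T R).
Notation gamma := (@normal_prob R 0 1 : probability _ R).

(** Writing the law as an image of the standard normal law absorbs the case [s = 0], where the
    affine map is constant; moments then need no case distinction. *)
Lemma normally_distributedE (m s : R) (Y : T -> R) : 0 <= s ->
  normally_distributed P m s Y -> forall A, measurable A ->
  P (Y @^-1` A) = gamma ((fun z => m + s * z) @^-1` A).
Proof.
move=> s0 hY A mA; rewrite hY//; have [->|sn0] := eqVneq s 0; last first.
  by rewrite normal_probE// lt_def sn0.
rewrite diracE; have [mem|nmem] := boolP (m \in A).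
  rewrite (_ : _ @^-1` A = setT); first by rewrite probability_setT.
  by apply/seteqP; split => // z _ /=; rewrite mul0r addr0; exact: set_mem.
rewrite (_ : _ @^-1` A = set0) ?measure0//.
apply/seteqP; split => // z /=; rewrite mul0r addr0 => mem.
by rewrite mem_set in nmem.
Qed.

Context (m s : R) (Y : T -> R).
Hypotheses (mY : measurable_fun setT Y) (s0 : 0 <= s).
Hypothesis nY : normally_distributed P m s Y.

Lemma normally_distributed_integrable : P.-integrable setT (EFin \o Y).
Proof.
apply: (@same_law_integrable _ _ _ _ R P gamma Y (fun z => m + s * z) mY
  (measurable_affine m s) (normally_distributedE s0 nY) id) => //.
exact: integrable_gamma_affine.
Qed.

Lemma normally_distributed_integrable_sqr :
  P.-integrable setT (fun w => (Y w ^+ 2)%:E).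
Proof.
apply: (@same_law_integrable _ _ _ _ R P gamma Y (fun z => m + s * z) mY
  (measurable_affine m s) (normally_distributedE s0 nY) (fun x => x ^+ 2)) => //.
exact: integrable_gamma_affine_sqr.
Qed.

Lemma normally_distributed_mean : \int[P]_w Y w = m.
Proof.
rewrite (@same_law_Rintegral _ _ _ _ R P gamma Y (fun z => m + s * z) mY
  (measurable_affine m s) (normally_distributedE s0 nY) id) => //.
  exact: gamma_affine_mean.
exact: integrable_gamma_affine.
Qed.

Lemma normally_distributed_sqr : \int[P]_w (Y w ^+ 2) = m ^+ 2 + s ^+ 2.
Proof.
rewrite (@same_law_Rintegral _ _ _ _ R P gamma Y (fun z => m + s * z) mY
  (measurable_affine m s) (normally_distributedE s0 nY) (fun x => x ^+ 2)) => //.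
  exact: gamma_affine_sqr.
exact: integrable_gamma_affine_sqr.
Qed.

End normally_distributed.

Section equicorrelated.
Context d (T : measurableType d) (R : realType) (P : probability T R) (n : nat).
Context (X : 'I_n -> {RV P >-> R}) (rho : R).
Hypothesis hX : equicorrelated_normal X (fun=> 0) rho.
Notation gamma := (@normal_prob R 0 1 : probability _ R).

Let comb (a : 'I_n -> R) (w : T) := \sum_i a i * X i w.

Lemma measurable_comb a : measurable_fun setT (comb a).
Proof. by apply: measurable_sum => i; exact: measurable_funM. Qed.

Let combX i : comb (fun j => (j == i)%:R) = X i.
Proof.
apply/funext => w; rewrite /comb (bigD1 i)//= eqxx mul1r big1 ?addr0// => j ji.
by rewrite (negbTE ji) mul0r.
Qed.

Let normalX i : exists m s, 0 <= s /\ normally_distributed P m s (X i).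
Proof.
have [jn _ _ _] := hX; have [m [s [s0 h]]] := jn (fun j => (j == i)%:R).
by exists m, s; split => //; rewrite -(combX i).
Qed.

Let intX i : P.-integrable setT (EFin \o X i).
Proof.
have [m [s [s0 h]]] := normalX i.
exact: (normally_distributed_integrable _ s0 h).
Qed.

Let meanX i : \int[P]_w X i w = 0.
Proof. by have [_ /(_ i) + _ _] := hX; rewrite unlock /Rintegral => ->. Qed.

Let intXX i j : P.-integrable setT (fun w => (X i w * X j w)%:E).
Proof.
have [m [s [s0 h]]] := normalX i; have [m' [s' [s0' h']]] := normalX j.
have i1 := normally_distributed_integrable_sqr (measurable_funPT (X i)) s0 h.
have i2 := normally_distributed_integrable_sqr (measurable_funPT (X j)) s0' h'.
apply: (le_integrable measurableT _ _ (integrableD measurableT i1 i2)).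
  by apply/measurable_EFinP; exact: measurable_funM.
move=> w _ /=; rewrite lee_fin [leRHS]ger0_norm ?addr_ge0 ?sqr_ge0//.
by rewrite ler_norml; have := sqr_ge0 (X i w + X j w); have := sqr_ge0 (X i w - X j w); nra.
Qed.

Let covX i j : \int[P]_w (X i w * X j w) = if i == j then 1 else rho.
Proof.
have [_ mX vX cX] := hX.
have mE k : fine (\int[P]_w (X k w)%:E) = 0 := meanX k.
have covE : covariance P (X i) (X j) = (\int[P]_w (X i w * X j w)%:E)%E.
  rewrite unlock unlock; apply: eq_integral => w _.
  by rewrite !mE -[LHS]/(((X _ w - 0) * (X _ w - 0))%:E) !subr0.
case: eqP => [->|/eqP ij].
  have -> : \int[P]_w (X j w * X j w) = fine 'V_P[X j].
    rewrite /variance unlock unlock; congr fine; apply: eq_integral => w _.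
    by rewrite !mE -[RHS]/(((X _ w - 0) * (X _ w - 0))%:E) !subr0.
  by rewrite vX.
have := cX i j ij; rewrite /correlation !vX/= sqrtr1 mulr1 divr1 => <-.
by rewrite covE.
Qed.

(** The variance of [\sum_i a i * X i]: the covariance matrix is [1 - rho] times the identity plus
    [rho] times the all-ones matrix. *)
Definition comb_var (a : 'I_n -> R) :=
  (1 - rho) * \sum_i a i ^+ 2 + rho * (\sum_i a i) ^+ 2.

Let mean_comb a : \int[P]_w comb a w = 0.
Proof.
rewrite (@Rintegral_sum _ _ _ P _ (fun i w => a i * X i w)); last first.
  move=> i; rewrite (_ : _ \o _ = fun w => (a i)%:E * (X i w)%:E)%E//.
  by apply: integrableZl => //; exact: intX.
by rewrite big1// => i _; rewrite RintegralZl ?meanX ?mulr0//; exact: intX.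
Qed.

Let sqr_comb a : \int[P]_w (comb a w ^+ 2) = comb_var a.
Proof.
pose f (p : 'I_n * 'I_n) w := (a p.1 * a p.2) * (X p.1 w * X p.2 w).
have intf p : P.-integrable setT (EFin \o f p).
  rewrite (_ : _ \o _ = fun w => (a p.1 * a p.2)%:E * (X p.1 w * X p.2 w)%:E)%E//.
  by apply: integrableZl => //; exact: intXX.
have -> : \int[P]_w (comb a w ^+ 2) = \sum_p \int[P]_w f p w.
  rewrite -Rintegral_sum//; apply: eq_Rintegral => w _.
  rewrite expr2 /comb big_distrlr pair_bigA/=.
  by apply: eq_bigr => p _; rewrite /f; ring.
transitivity (\sum_i \sum_j (a i * a j * (if i == j then 1 else rho))).
  rewrite pair_bigA; apply: eq_bigr => -[i j] _.
  by rewrite /f/= RintegralZl ?covX//; exact: intXX.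
transitivity (\sum_i ((1 - rho) * a i ^+ 2 + rho * (a i * \sum_j a j))).
  apply: eq_bigr => i _; rewrite (bigD1 i)//= eqxx [in RHS](bigD1 i)//=.
  rewrite (eq_bigr (fun j => (rho * a i) * a j)) => [|j ji].
    by rewrite -mulr_sumr; ring.
  by rewrite eq_sym (negbTE ji); ring.
by rewrite big_split/= -!mulr_sumr -mulr_suml /comb_var; ring.
Qed.

(** Joint normality supplies some mean and standard deviation for each combination; the first two
    moments identify them. *)
Lemma equicorrelated_law a (A : set R) : measurable A ->
  P ((fun w => \sum_i a i * X i w) @^-1` A) =
  gamma ((fun z => Num.sqrt (comb_var a) * z) @^-1` A).
Proof.
have [jn _ _ _] := hX; have [m [s [s0 h]]] := jn a.
have m0 : m = 0.
  by rewrite -(normally_distributed_mean (measurable_comb a) s0 h) mean_comb.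
have s2 : comb_var a = s ^+ 2.
  rewrite -sqr_comb (normally_distributed_sqr (measurable_comb a) s0 h) m0.
  by rewrite expr0n add0r.
move=> mA; rewrite (normally_distributedE s0 h)// s2 sqrtr_sqr ger0_norm//.
by congr (gamma _); apply/seteqP; split => z /=; rewrite m0 add0r.
Qed.

End equicorrelated.

(** * Rejection by BH *)

Section BH_event.
Context {R : realType} (n : nat) (alpha : R).
Implicit Types (p : 'I_n -> R).

Definition count_le p (u : R) : nat := #|[set i | p i <= u]%SET|.

(** Rejection stated by counts instead of order statistics. The index [k] starts at 0 and stands for
    the cutoff of rank [k.+1], so the strict inequality says that at least [k.+1] p-values pass
    it. *)
Definition BH_event p : bool :=
  [exists k : 'I_n, (k < count_le p (k.+1%:R * alpha / n%:R))%N].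

Lemma size_ordered_hyps p : size (ordered_hyps p) = n.
Proof. by rewrite size_sort size_enum_ord. Qed.

Lemma ordered_pvalue_le p (k : nat) (u : R) : (k < n)%N ->
  (ordered_pvalue p k.+1 <= u) = (k < count_le p u)%N.
Proof.
move=> kn; rewrite /ordered_pvalue/=; set s := map p _.
have ss : sorted <=%O s.
  by rewrite sorted_map sort_sorted// => i j; exact: le_total.
have sz : size s = n by rewrite size_map size_ordered_hyps.
have cE : count (<= u)%O s = count_le p u.
  rewrite count_map /ordered_hyps.
  rewrite (permP (permEl (perm_sort _ _))) -size_filter /count_le cardE.
  rewrite /enum_mem -filter_predI; congr (size _); rewrite -enumT.
  by apply: eq_filter => i /=; rewrite !inE ?andbT.
rewrite -cE; apply/idP/idP => [h|]; last exact: nth_count_le.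
rewrite ltnNge; apply/negP => ck.
have : u < nth 0 s k by apply: nth_count_gt => //; rewrite ck sz.
by rewrite ltNge h.
Qed.

Lemma stepup_index_le (u : nat -> R) p : (stepup_index u p <= n)%N.
Proof.
rewrite /stepup_index big_seq_cond; apply/bigmax_leqP_seq => k _ /andP[].
by rewrite mem_index_iota ltnS => /andP[].
Qed.

Lemma card_stepup (u : nat -> R) p : #|stepup u p| = stepup_index u p.
Proof.
rewrite /stepup cardsE; have /card_uniqP -> : uniq (take (stepup_index u p) (ordered_hyps p)).
  by rewrite take_uniq// sort_uniq enum_uniq.
by rewrite size_takel// size_ordered_hyps stepup_index_le.
Qed.

Lemma stepup_index_gt0 p :
  (0 < stepup_index (fun k => k%:R * alpha / n%:R) p)%N = BH_event p.
Proof.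
apply/idP/existsP => [|[k hk]].
  move=> h; apply: contrapT => /forallNP nk; move: h; apply/negP; rewrite -leqNgt.
  rewrite /stepup_index big_seq_cond; apply/bigmax_leqP_seq => k _ /andP[].
  rewrite mem_index_iota => /andP[k0 kn] hk.
  case: k k0 kn hk => // k _ kn.
  by rewrite ordered_pvalue_le// => hk; case: (nk (Ordinal (kn : (k < n)%N))).
apply: (@leq_trans k.+1) => //.
rewrite /stepup_index; apply: (@leq_bigmax_seq _ _ _ id k.+1); last by rewrite ordered_pvalue_le.
by rewrite mem_index_iota /= ltnS; exact: ltn_ord.
Qed.

Lemma BH_fdp p :
  (num_false_rejected (BH alpha) (fun=> 0) p)%:R / (maxn (num_rejected (BH alpha) p) 1)%:R =
  (BH_event p)%:R :> R.
Proof.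
rewrite /num_false_rejected /num_rejected.
have -> : true_nulls (fun=> 0 : R) = [set: 'I_n]%SET.
  by apply/setP => i; rewrite !inE eqxx.
rewrite finset.setIT /BH card_stepup -stepup_index_gt0.
case: (stepup_index _ p) => [|m]; first by rewrite mul0r.
by rewrite (maxn_idPl _)// divff// pnatr_eq0.
Qed.

End BH_event.

Section FDR_event.
Context d (T : measurableType d) (R : realType) (P : probability T R) (n : nat).
Context (X : 'I_n -> {RV P >-> R}) (alpha : R).

Lemma measurable_count (b : 'I_n -> T -> bool) (k : nat) :
  (forall i, measurable [set w | b i w]) ->
  measurable [set w | (k <= #|[set i | b i w]%SET|)%N].
Proof.
move=> mb.
have mS : measurable_fun setT (fun w => \sum_i (b i w)%:R : R).
  by apply: measurable_sum => i; have [] := @bounded_mfun_bool _ _ R _ (mb i).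
have cE w : \sum_i (b i w)%:R = #|[set i | b i w]%SET|%:R :> R.
  rewrite -natr_sum -sum1_card [in RHS]big_mkcond/=; congr (_%:R).
  by apply: eq_bigr => i _; rewrite inE; case: (b i w).
have -> : [set w | (k <= #|[set i | b i w]%SET|)%N] =
    (fun w => \sum_i (b i w)%:R : R) @^-1` `[k%:R, +oo[%classic.
  by apply/seteqP; split => w /=; rewrite in_itv/= andbT cE ler_nat.
by rewrite -[X in measurable X]setTI; apply: mS => //; exact: measurable_itv.
Qed.

Lemma measurable_exists_ord (b : 'I_n -> T -> bool) :
  (forall i, measurable [set w | b i w]) ->
  measurable [set w | [exists i, b i w]].
Proof.
move=> mb; have -> : [set w | [exists i, b i w]] = \bigcup_(i in [set: 'I_n]) [set w | b i w].
  by apply/seteqP; split => w /= => [/existsP[i hi]|[i _ hi]]; [exists i|apply/existsP; exists i].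
by apply: fin_bigcup_measurable => // i _.
Qed.

Lemma Phi_cdf (x : R) : (Phi x)%:E = normal_prob 0 1 `]-oo, x].
Proof. by rewrite /Phi fineK// fin_num_measure. Qed.

Lemma Phi_nondecreasing : {homo @Phi R : x y / x <= y}.
Proof.
move=> x y xy; rewrite -lee_fin !Phi_cdf; apply: le_measure; rewrite ?inE//.
exact: subitvPr.
Qed.

Lemma measurable_Phi : measurable_fun setT (@Phi R).
Proof. by apply: nondecreasing_measurable => // x y; exact: Phi_nondecreasing. Qed.

Lemma measurable_pvalue_le (i : 'I_n) (u : R) : measurable [set w | pvalue (X i w) <= u].
Proof.
rewrite -[X in measurable X]setTI.
have mf : measurable_fun setT (fun w => pvalue (X i w)).
  by apply: measurable_funB => //; exact: (measurableT_comp measurable_Phi).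
have -> : [set w | pvalue (X i w) <= u] = (fun w => pvalue (X i w)) @^-1` `]-oo, u]%classic.
  by apply/seteqP; split => w /=; rewrite in_itv.
by apply: mf => //; exact: measurable_itv.
Qed.

Lemma measurable_BH_event :
  measurable [set w | BH_event alpha (fun i => pvalue (X i w))].
Proof.
apply: measurable_exists_ord => k; apply: measurable_count => i.
exact: measurable_pvalue_le.
Qed.

Lemma FDR_BH_event :
  FDR X (fun=> 0) (BH alpha) = P [set w | BH_event alpha (fun i => pvalue (X i w))].
Proof.
rewrite /FDR unlock.
under eq_integral do rewrite BH_fdp.
rewrite -[RHS]fineK ?fin_num_measure//; last exact: measurable_BH_event.
rewrite -Rintegral_bool; last exact: measurable_BH_event.
rewrite /Rintegral fineK//; apply: integrable_fin_num => //.
apply: (bounded_mfun_integrable (R := R)).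
by apply: bounded_mfun_bool; exact: measurable_BH_event.
Qed.

End FDR_event.

(** * The normal distribution function, its tails and its inverse *)

Section Phi_theory.
Context {R : realType}.
Implicit Types x y u : R.
Notation mu := (@lebesgue_measure R).
Notation gamma := (@normal_prob R 0 1 : probability _ R).
Notation phi := (@normal_pdf R 0 1).

Lemma gamma_itv x y : x <= y -> fine (gamma `]x, y]%classic) = Phi y - Phi x.
Proof.
move=> xy; apply/eqP; rewrite eq_sym subr_eq addrC; apply/eqP.
rewrite /Phi -fineD ?fin_num_measure//; congr fine.
rewrite -measureU//.
  congr (gamma _); apply/seteqP; split => z /=; rewrite !in_itv/=.
    by move=> zy; case: (leP z x) => zx; [left|right; apply/andP; split].
  by case=> [zx|/andP[]//]; exact: le_trans zx xy.
apply/seteqP; split => // z /=; rewrite !in_itv/= => -[zx /andP[xz _]].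
by have := lt_le_trans xz zx; rewrite ltxx.
Qed.

Lemma Phi_diff_ge (k : R) x y : x <= y -> 0 <= k -> (forall z, x < z <= y -> k <= phi z) ->
  k * (y - x) <= Phi y - Phi x.
Proof.
move=> xy k0 hk; rewrite -(gamma_itv xy) -lee_fin fineK ?fin_num_measure//.
apply: (@le_trans _ _ (\int[mu]_(z in `]x, y]) k%:E)%E).
  rewrite integral_cst//= lebesgue_measure_itv/= lte_fin.
  move: xy; rewrite le_eqVlt => /orP[/eqP->|xy]; first by rewrite ltxx mule0 subrr mulr0.
  by rewrite xy.
apply: ge0_le_integral => //.
- by apply/measurable_EFinP; apply: measurable_funTS; exact: measurable_phi.
Qed.

Lemma normal_peak_le1 : normal_peak 1 <= 1 :> R.
Proof.
rewrite /normal_peak invf_le1.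
  rewrite -[leLHS](@sqrtr1 R) ler_wsqrtr// expr1n mul1r.
  by have := @pi_ge2 R; rewrite mulr2n; lra.
rewrite sqrtr_gt0 expr1n mul1r mulrn_wgt0// pi_gt0//.
Qed.

Lemma Phi_diff_le x y : x <= y -> Phi y - Phi x <= y - x.
Proof.
move=> xy; rewrite -(gamma_itv xy) -lee_fin fineK ?fin_num_measure//.
apply: (@le_trans _ _ (\int[mu]_(z in `]x, y]) 1%:E)%E); last first.
  rewrite integral_cst//= lebesgue_measure_itv/= lte_fin.
  move: xy; rewrite le_eqVlt => /orP[/eqP->|xy]; first by rewrite ltxx mule0 subrr.
  by rewrite xy mul1e.
apply: ge0_le_integral => //.
- by move=> z _; rewrite lee_fin normal_pdf_ge0.
- by apply/measurable_EFinP; apply: measurable_funTS; exact: measurable_phi.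
- move=> z _; rewrite lee_fin (le_trans _ normal_peak_le1)//.
  by apply: normal_pdf_ub; exact: oner_neq0.
Qed.

Lemma phi_gt0 x : 0 < phi x.
Proof. by rewrite stdnormal_pdfE mulr_gt0 ?expR_gt0// normal_peak_gt0 ?oner_neq0. Qed.

Lemma phi_anti x y : `|x| <= `|y| -> phi y <= phi x.
Proof.
move=> xy; rewrite !stdnormal_pdfE ler_wpM2l ?normal_peak_ge0// ler_expR lerN2.
by rewrite ler_wpM2r// -(real_normK (num_real x)) -(real_normK (num_real y)) lerXn2r ?nnegrE.
Qed.

(** Between [x] and [y] the density is at least its value at the larger of [|x|] and [|y|], which is
    positive. *)
Lemma Phi_lt : {homo @Phi R : x y / x < y}.
Proof.
move=> x y xy; rewrite -subr_gt0.
pose b := Num.max `|x| `|y|.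
have h z : x < z <= y -> phi b <= phi z.
  move=> /andP[xz zy]; apply: phi_anti; rewrite [leRHS]ger0_norm; last first.
    by rewrite le_max normr_ge0.
  rewrite le_max; have [z0|z0] := leP 0 z.
    by rewrite (ger0_norm z0) (le_trans zy (ler_norm _)) orbT.
  by rewrite (ltr0_norm z0) -normrN (le_trans _ (ler_norm _))// lerN2 ltW.
apply: lt_le_trans (Phi_diff_ge (ltW xy) (ltW (phi_gt0 b)) h).
by rewrite mulr_gt0 ?phi_gt0// subr_gt0.
Qed.

Lemma Phi_le x y : (Phi x <= Phi y) = (x <= y).
Proof.
apply/idP/idP; last exact: Phi_nondecreasing.
by apply: contraTT; rewrite -!ltNge; exact: Phi_lt.
Qed.

Lemma Phi_ltE x y : (Phi x < Phi y) = (x < y).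
Proof. by rewrite !ltNge Phi_le. Qed.

Lemma Phi_lip x y : `|Phi x - Phi y| <= `|x - y|.
Proof.
wlog xy : x y / x <= y.
  move=> H; have [xy|/ltW xy] := leP x y; first exact: H.
  by rewrite distrC (distrC x); exact: H.
rewrite distrC (distrC x) !ger0_norm ?subr_ge0//; first exact: Phi_diff_le.
exact: Phi_nondecreasing.
Qed.

Lemma Phi_ge0 x : 0 <= Phi x.
Proof. by rewrite -lee_fin Phi_cdf. Qed.

Lemma Phi_le1 x : Phi x <= 1.
Proof. by rewrite -lee_fin Phi_cdf; exact: (probability_le1 gamma). Qed.

Lemma Phi_gt0 x : 0 < Phi x.
Proof. by apply: (le_lt_trans (Phi_ge0 (x - 1))); apply: Phi_lt; rewrite gtrBl. Qed.

Lemma Phi_lt1 x : Phi x < 1.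
Proof. by apply: (lt_le_trans _ (Phi_le1 (x + 1))); apply: Phi_lt; rewrite ltrDl. Qed.

Lemma continuous_Phi : continuous (@Phi R).
Proof.
move=> x; apply/cvgrPdist_le => e e0.
have : \forall y \near x, `|x - y| <= e.
  by exists e => //= y /ltW.
by apply: filterS => y; exact: le_trans (Phi_lip _ _).
Qed.

Lemma Phi_inj : injective (@Phi R).
Proof.
move=> x y xy; have [lt|lt|//] := ltgtP x y.
  by have := Phi_lt lt; rewrite xy ltxx.
by have := Phi_lt lt; rewrite xy ltxx.
Qed.

Lemma measurable_ray x : measurable [set z : R | x <= z].
Proof.
have -> : [set z | x <= z] = `[x, +oo[%classic by apply/seteqP; split => z /=; rewrite in_itv/= andbT.
exact: measurable_itv.
Qed.

Lemma Rintegral_ray x : \int[gamma]_z (x <= z)%R%:R = 1 - Phi x.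
Proof.
have mx := measurable_ray x.
rewrite (@Rintegral_bool _ _ _ gamma (fun z => x <= z))//.
have -> : [set z : R | x <= z] = ~` `]-oo, x]%classic `|` [set x].
  apply/seteqP; split => z /=; rewrite in_itv/=.
    move=> xz; have [->|zx] := eqVneq z x; [by right|left; apply/negP].
    by rewrite -ltNge lt_neqAle xz andbT eq_sym.
  by case=> [/negP|->//]; rewrite -ltNge => /ltW.
rewrite measureU//=; last 2 first.
- by apply: measurableC.
- by apply/seteqP; split => // z /=; rewrite in_itv/= => -[h zx]; apply: h; rewrite zx.
have -> : gamma [set x] = 0%E.
  exact: integral_set1.
rewrite adde0 (probability_setC gamma)//.
by rewrite -[gamma _]Phi_cdf.
Qed.

(** Chebyshev's inequality for the variance 1; such decay is enough for the surjectivity of [Phi]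
    onto []0, 1[]. *)
Lemma Phi_tail x : 0 < x -> 1 - Phi x <= x ^- 2.
Proof.
move=> x0; rewrite -Rintegral_ray.
apply: (@le_trans _ _ (\int[gamma]_z (x ^- 2 * z ^+ 2))); last first.
  by rewrite RintegralZl ?gamma_var ?mulr1//; exact: integrable_gamma_sqr.
apply: le_Rintegral => //.
- apply: (@bounded_mfun_integrable _ _ _ gamma).
  exact: (@bounded_mfun_bool _ (measurableTypeR R) R (fun z => x <= z) (measurable_ray x)).
- rewrite (_ : _ \o _ = fun z => (x ^- 2)%:E * (z ^+ 2)%:E)%E//.
  by apply: integrableZl => //; exact: integrable_gamma_sqr.
move=> z _; case: (leP x z) => xz; last by rewrite mulr_ge0 ?sqr_ge0// invr_ge0 sqr_ge0.
rewrite ler_pdivlMl ?exprn_gt0// mulr1 lerXn2r// nnegrE ?(ltW x0)//.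
exact: le_trans (ltW x0) xz.
Qed.

Lemma PhiN x : Phi (- x) = 1 - Phi x.
Proof.
rewrite -Rintegral_ray (@Rintegral_bool _ _ _ gamma (fun z => x <= z)); last exact: measurable_ray.
rewrite /Phi; congr fine; rewrite -[LHS](@gammaN R)//.
by congr (gamma _); apply/seteqP; split => z /=; rewrite in_itv/= lerN2.
Qed.

Lemma Phi_surj u : 0 < u < 1 -> exists x, Phi x = u.
Proof.
move=> /andP[u0 u1].
have tail (v : R) : 0 < v -> exists2 x, 0 < x & 1 - Phi x <= v.
  (* The square of [1 + 1 / v] exceeds [1 / v], so the Chebyshev tail there is at most [v]. *)
  move=> v0; exists (1 + v^-1); first by rewrite ltr_pwDl// invr_ge0 ltW.
  have h0 : 0 < 1 + v^-1 by rewrite ltr_pwDl// invr_ge0 ltW.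
  apply: (le_trans (Phi_tail h0)).
  rewrite -[leRHS]invrK lef_pV2 ?posrE ?exprn_gt0 ?invr_gt0//.
  have : 0 < v^-1 by rewrite invr_gt0.
  by move: (v^-1) => w; nra.
have [x x0 hx] := tail u u0; have [|y y0 hy] := tail (1 - u); first by rewrite subr_gt0.
have xy : - x <= y by lra.
have [||c _ <-] := @IVT R Phi (- x) y u xy; last by exists c.
  exact/continuous_subspaceT/continuous_Phi.
rewrite min_l ?max_r ?Phi_le// PhiN hx; lra.
Qed.

Lemma PhiVK u : 0 < u < 1 -> Phi (PhiV u) = u.
Proof.
move=> /Phi_surj[x xu]; rewrite /PhiV.
by apply: pinvK; rewrite inE; exists x.
Qed.

Lemma PhiK x : PhiV (Phi x) = x.
Proof.
by apply: Phi_inj; rewrite PhiVK// Phi_gt0 Phi_lt1.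
Qed.

(** Only the mass of []x, x + 1]] is kept, where the density is least at the right end. *)
Lemma Phi_tail_ge x : 0 <= x -> phi (x + 1) <= 1 - Phi x.
Proof.
move=> x0; apply: (@le_trans _ _ (Phi (x + 1) - Phi x)); last by rewrite lerD2r Phi_le1.
have -> : phi (x + 1) = phi (x + 1) * (x + 1 - x) by ring.
apply: Phi_diff_ge; rewrite ?lerDl// ?(ltW (phi_gt0 _))// => z /andP[xz zx].
by apply: phi_anti; rewrite !ger0_norm//; lra.
Qed.

End Phi_theory.

(** * Concentration of the exceedance counts *)

Section law_of_large_numbers.
Context d (T : measurableType d) (R : realType) (P : probability T R) (n : nat).
Context (Y : 'I_n -> T -> R).
Hypothesis whiteY : white P Y.
Notation gamma := (@normal_prob R 0 1 : probability _ R).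

Definition count_ge (y : R) (w : T) : nat := #|[set i | y <= Y i w]%SET|.

Let ind (y : R) (i : 'I_n) (w : T) : R := (y <= Y i w)%R%:R.

Let mind y i : measurable [set w | y <= Y i w].
Proof.
have [mY _] := whiteY.
rewrite -[X in measurable X]setTI.
have -> : [set w | y <= Y i w] = Y i @^-1` [set z | y <= z] by [].
by apply: mY => //; exact: measurable_ray.
Qed.

Let bind y i : bounded_mfun (ind y i).
Proof. by apply: bounded_mfun_bool; exact: mind. Qed.

Lemma count_geE y w : (count_ge y w)%:R = \sum_i ind y i w.
Proof.
rewrite /ind -natr_sum /count_ge -sum1_card big_mkcond/=; congr (_%:R).
by apply: eq_bigr => i _; rewrite inE; case: (_ <= _).
Qed.

Lemma mean_ind y i : \int[P]_w ind y i w = 1 - Phi y.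
Proof.
rewrite -Rintegral_ray.
have [mb _] := @bounded_mfun_bool _ (measurableTypeR R) R (fun z => y <= z) (measurable_ray y).
rewrite -(@white_expectation _ _ _ _ _ _ whiteY i (fun z => (y <= z)%R%:R) 1)//.
by move=> z; case: (y <= z); rewrite ?normr1 ?normr0.
Qed.

Lemma mean_ind2 y i j : i != j -> \int[P]_w (ind y i w * ind y j w) = (1 - Phi y) ^+ 2.
Proof.
move=> ij.
(* Factors equal to 1 outside [i] and [j] extract pairwise independence from the product formula. *)
pose g k (x : R) : R := if (k == i) || (k == j) then (y <= x)%R%:R else 1.
have hg k : trig_approx (g k).
  rewrite /g; case: ((k == i) || (k == j)); first exact: trig_approx_ge.
  by apply: trigpoly_approx; [exact: trigpoly_cst|move=> x; rewrite ler01 lexx].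
have prodE (F : 'I_n -> R) : (forall k, k != i -> k != j -> F k = 1) -> \prod_k F k = F i * F j.
  move=> h; rewrite (bigD1 i)//= (bigD1 j)/=; last by rewrite eq_sym.
  by rewrite big1 ?mulr1// => k /andP[ki kj]; exact: h.
have := white_independent whiteY hg.
rewrite prodE; last by move=> k ki kj; rewrite /g (negbTE ki) (negbTE kj)/= Rintegral_prob_cst.
have -> : \int[gamma]_x g i x = 1 - Phi y by rewrite -Rintegral_ray /g eqxx.
have -> : \int[gamma]_x g j x = 1 - Phi y by rewrite -Rintegral_ray /g eqxx orbT.
rewrite -expr2 => <-; apply: eq_Rintegral => w _.
rewrite prodE; last by move=> k ki kj; rewrite /g (negbTE ki) (negbTE kj).
by rewrite /g !eqxx orbT.
Qed.

Lemma bounded_count_ge y : bounded_mfun (fun w => (count_ge y w)%:R : R).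
Proof.
under eq_fun do rewrite count_geE.
by apply: bounded_mfun_sum => i; exact: bind.
Qed.

(** The centered indicators are uncorrelated and have variance at most 1, so only the [n] diagonal
    terms remain. *)
Lemma count_ge_var y :
  \int[P]_w (((count_ge y w)%:R - n%:R * (1 - Phi y)) ^+ 2) <= n%:R.
Proof.
set q := 1 - Phi y.
have q01 : 0 <= q <= 1 by rewrite subr_ge0 Phi_le1 lerBlDr lerDl Phi_ge0.
pose f i w := ind y i w - q.
have bf i : bounded_mfun (f i) by apply: bounded_mfunB => //; exact: bounded_mfun_cst.
have -> : \int[P]_w (((count_ge y w)%:R - n%:R * q) ^+ 2) =
    \sum_i \sum_j \int[P]_w (f i w * f j w).
  rewrite (eq_bigr (fun i => \int[P]_w (\sum_j f i w * f j w))); last first.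
    by move=> i _; rewrite Rintegral_sum_bounded// => j; exact: bounded_mfunM.
  rewrite -Rintegral_sum_bounded; last first.
    by move=> i; apply: bounded_mfun_sum => j; exact: bounded_mfunM.
  apply: eq_Rintegral => w _.
  have -> : (count_ge y w)%:R - n%:R * q = \sum_i f i w.
    by rewrite count_geE /f sumrB big_const_ord iter_addr_0 mulr_natl.
  by rewrite expr2 big_distrlr.
have cov i j : i != j -> \int[P]_w (f i w * f j w) = 0.
  move=> ij.
  have -> : \int[P]_w (f i w * f j w) =
      \int[P]_w ((ind y i w * ind y j w - q * ind y i w) - (q * ind y j w - q * q)).
    by apply: eq_Rintegral => w _; rewrite /f; ring.
  have bq k : bounded_mfun (fun w => q * ind y k w).
    by apply: bounded_mfunM => //; exact: bounded_mfun_cst.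
  rewrite RintegralB_bounded; last 2 first.
  - by apply: bounded_mfunB => //; exact: bounded_mfunM.
  - by apply: bounded_mfunB => //; exact: bounded_mfun_cst.
  rewrite RintegralB_bounded//; last exact: bounded_mfunM.
  rewrite RintegralB_bounded//; last exact: bounded_mfun_cst.
  have E k : \int[P]_w (q * ind y k w) = q * q.
    by rewrite RintegralZl_bounded//; congr (_ * _); exact: mean_ind.
  rewrite mean_ind2// !E Rintegral_prob_cst -/q; ring.
have var i : \int[P]_w (f i w * f i w) <= 1.
  rewrite -[leRHS](Rintegral_prob_cst P); apply: le_Rintegral_bounded.
  - exact: bounded_mfunM.
  - exact: bounded_mfun_cst.
  - by move=> w; rewrite /f /ind; case: (y <= Y i w) => /=; nra.
apply: (@le_trans _ _ (\sum_(i < n) 1)); last by rewrite big_const_ord iter_addr_0.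
apply: ler_sum => i _; rewrite (bigD1 i)//= big1 ?addr0// => j ji.
by rewrite cov// eq_sym.
Qed.

(** The event [b] is any measurable event that forces the deviation, so that one statement serves
    for counts that are too small and for counts that are too large. *)
Lemma count_ge_chebyshev y (e : R) (b : T -> bool) : 0 < e -> (0 < n)%N ->
  measurable [set w | b w] ->
  (forall w, b w -> e * n%:R <= `|(count_ge y w)%:R - n%:R * (1 - Phi y)|) ->
  \int[P]_w (b w)%:R <= (n%:R * e ^+ 2)^-1.
Proof.
move=> e0 n0 mb hb; have n0' : 0 < n%:R :> R by rewrite ltr0n.
have bN : bounded_mfun (fun w => ((count_ge y w)%:R - n%:R * (1 - Phi y)) ^+ 2).
  under eq_fun do rewrite expr2.
  have h : bounded_mfun (fun w => (count_ge y w)%:R - n%:R * (1 - Phi y)).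
    by apply: bounded_mfunB; [exact: bounded_count_ge|exact: bounded_mfun_cst].
  exact: bounded_mfunM.
apply: (@le_trans _ _ (\int[P]_w ((e * n%:R) ^- 2 *
    ((count_ge y w)%:R - n%:R * (1 - Phi y)) ^+ 2))).
  apply: le_Rintegral_bounded.
  - exact: bounded_mfun_bool.
  - by apply: bounded_mfunM => //; exact: bounded_mfun_cst.
  move=> w; have en0 : 0 < e * n%:R by rewrite mulr_gt0.
  case: (boolP (b w)) => [/hb h|_]; last by rewrite mulr_ge0 ?sqr_ge0// invr_ge0 sqr_ge0.
  rewrite ler_pdivlMl ?exprn_gt0// mulr1 -(real_normK (num_real (_ - _))).
  by rewrite lerXn2r// nnegrE (ltW en0).
rewrite RintegralZl_bounded//.
apply: (le_trans (ler_wpM2l _ (count_ge_var y))); first by rewrite invr_ge0 sqr_ge0.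
rewrite le_eqVlt; apply/orP; left; apply/eqP; field.
by rewrite !gt_eqF.
Qed.

End law_of_large_numbers.

(** * The one-factor model *)

Section gaussian_tail.
Context {R : realType}.
Notation gamma := (@normal_prob R 0 1 : probability _ R).
Notation phi := (@normal_pdf R 0 1).

Lemma pvalue_le (x c : R) : (pvalue x <= 1 - Phi c) = (c <= x).
Proof. by rewrite /pvalue lerD2l lerN2 Phi_le. Qed.

(** The weight [1 / (1 - Phi x)] of the observation [x = s y + z], kept only for [x >= C]. A
    rejection at a small cutoff forces the total weight to be at least [n / alpha], whatever the
    rank, so one first moment handles all small cutoffs at once. *)
Definition inv_tail (s z C y : R) : R := (C <= s * y + z)%R%:R / (1 - Phi (s * y + z)).

Lemma inv_tail_ge0 s z C y : 0 <= inv_tail s z C y.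
Proof. by rewrite /inv_tail mulr_ge0 ?invr_ge0 ?subr_ge0 ?Phi_le1. Qed.

Lemma measurable_inv_tail s z C : measurable_fun setT (inv_tail s z C).
Proof.
have ma : measurable_fun setT (fun y : R => s * y + z).
  by apply: measurable_funD => //; exact: measurable_funM.
apply: measurable_funM.
  have [m1 _] := @bounded_mfun_bool _ R R (fun y => C <= y) (measurable_ray C).
  exact: (measurableT_comp m1).
have mi : measurable_fun setT (fun y : R => (1 - Phi y)^-1).
  apply: continuous_measurable_fun => y; apply: cvgV.
    by rewrite gt_eqF// subr_gt0 Phi_lt1.
  by apply: cvgB; [exact: cvg_cst|exact: continuous_Phi].
exact: (measurableT_comp mi).
Qed.

Lemma inv_tail_anti s z C C' y : C <= C' -> inv_tail s z C' y <= inv_tail s z C y.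
Proof.
move=> CC'; rewrite /inv_tail ler_wpM2r ?invr_ge0 ?subr_ge0 ?Phi_le1//.
rewrite ler_nat; case: (leP C' (s * y + z)) => h //.
by rewrite (le_trans CC' h).
Qed.

(* [1 - Phi x >= phi (x + 1)] for [x >= 0], so that [inv_tail] is at most of
   the order of [expR ((s y + z + 1)^2 / 2)]; it is integrable as [s < 1]. *)
Lemma integrable_inv_tail s z C : 0 <= s < 1 -> 0 <= C ->
  gamma.-integrable setT (fun y => (inv_tail s z C y)%:E).
Proof.
move=> /andP[s0 s1] C0.
pose K := (normal_peak 1)^-1 * expR ((z + 1) ^+ 2 / 2).
have hq : gamma.-integrable setT
    (fun x => (K * expR (s ^+ 2 * x ^+ 2 / 2 + (s * (z + 1)) * x))%:E).
  under eq_fun do rewrite EFinM.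
  apply: integrableZl => //; apply: integrable_expR_quad.
  by rewrite expr2; nra.
apply: gamma_integrable_le hq _; first exact: measurable_inv_tail.
move=> y; rewrite ger0_norm ?inv_tail_ge0// /inv_tail.
have p0 : 0 < normal_peak 1 :> R by rewrite normal_peak_gt0 ?oner_neq0.
case: (leP C (s * y + z)) => h; last first.
  by rewrite mul0r mulr_ge0 ?expR_ge0// mulr_ge0 ?expR_ge0// invr_ge0 ltW.
rewrite mul1r; have x0 : 0 <= s * y + z by exact: le_trans h.
apply: (@le_trans _ _ (phi (s * y + z + 1))^-1).
  by rewrite lef_pV2 ?posrE ?phi_gt0 ?subr_gt0 ?Phi_lt1// Phi_tail_ge.
rewrite stdnormal_pdfE invfM -expRN opprK /K -mulrA -expRD.
by rewrite le_eqVlt; apply/orP; left; apply/eqP; congr (_ * expR _); field.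
Qed.

Lemma cvg_inv_tail s z : 0 <= s < 1 ->
  \int[gamma]_y inv_tail s z k%:R y @[k --> \oo] --> (0 : R).
Proof.
move=> s01.
have [] := @dominated_convergence _ _ _ gamma setT measurableT
  (fun k y => (inv_tail s z k%:R y)%:E) (cst 0%E) (fun y => (inv_tail s z 0 y)%:E).
- by move=> k; apply/measurable_EFinP; exact: measurable_inv_tail.
- exact: measurable_cst.
- apply: aeW => y _; apply: cvg_near_cst.
  exists (Num.truncn (s * y + z)).+1 => // k /= hk.
  rewrite /inv_tail leNgt (lt_le_trans (truncnS_gt _)) ?ler_nat//= mul0r//.
- exact: integrable_inv_tail.
- apply: aeW => y k _; rewrite lee_fin ger0_norm ?inv_tail_ge0//.
  exact: inv_tail_anti.
- move=> _ _; rewrite integral0 => c.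
  by have := fine_cvg c; apply.
Qed.

End gaussian_tail.

(** * Bounds on the rejection probability in the one-factor model *)

Section one_factor.
Context d (T : measurableType d) (R : realType) (P : probability T R) (n : nat).
Context (X : 'I_n -> {RV P >-> R}) (B : T -> R) (Y : 'I_n -> T -> R).
Context (sigma tau alpha : R).
Notation gamma := (@normal_prob R 0 1 : probability _ R).
Hypotheses (n0 : (0 < n)%N) (alpha01 : 0 < alpha < 1).
Hypotheses (sigma01 : 0 < sigma < 1) (tau0 : 0 < tau).
Hypothesis whiteY : white P Y.
Hypothesis mB : measurable_fun setT B.
Hypothesis lawB : forall A : set R, measurable A ->
  P (B @^-1` A) = gamma ((fun z => tau * z) @^-1` A).
Hypothesis XE : forall i w, X i w = B w + sigma * Y i w.

Let ev w := BH_event alpha (fun i => pvalue (X i w)).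

Let mev : measurable [set w | ev w]. Proof. exact: measurable_BH_event. Qed.

Let sigma0 : 0 < sigma. Proof. by case/andP: sigma01. Qed.
Let alpha0 : 0 < alpha. Proof. by case/andP: alpha01. Qed.
Let n0' : 0 < n%:R :> R. Proof. by rewrite ltr0n. Qed.

Let mBray z : measurable [set w | z <= B w].
Proof.
rewrite -[X in measurable X]setTI.
have -> : [set w | z <= B w] = B @^-1` [set x | z <= x] by [].
by apply: mB => //; exact: measurable_ray.
Qed.

Lemma factor_tail z : \int[P]_w (z <= B w)%R%:R = 1 - Phi (z / tau).
Proof.
rewrite Rintegral_bool// -Rintegral_ray.
rewrite (@Rintegral_bool _ _ _ gamma (fun x => z / tau <= x)); last exact: measurable_ray.
have := lawB (measurable_ray z).
have -> : B @^-1` [set x | z <= x] = [set w | z <= B w] by [].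
move=> ->; congr (fine (gamma _)); apply/seteqP; split => x /=;
by rewrite ler_pdivrMr// mulrC.
Qed.

Let mcount (a : R) (y : R) : measurable [set w | a <= (count_ge Y y w)%:R].
Proof.
have [mN _] := bounded_count_ge whiteY y.
rewrite -[X in measurable X]setTI.
have -> : [set w | a <= (count_ge Y y w)%:R] =
  (fun w => (count_ge Y y w)%:R : R) @^-1` [set x | a <= x] by [].
by apply: mN => //; exact: measurable_ray.
Qed.

Let mcount_lt (a : R) (y : R) : measurable [set w | (count_ge Y y w)%:R < a].
Proof.
have -> : [set w | (count_ge Y y w)%:R < a] = ~` [set w | a <= (count_ge Y y w)%:R].
  by apply/seteqP; split => w /=; rewrite ltNge => /negP.
exact: measurableC.
Qed.

Let cut (k : 'I_n) : 0 < k.+1%:R * alpha / n%:R <= alpha.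
Proof.
rewrite divr_gt0 ?mulr_gt0//= ler_pdivrMr// mulrC ler_wpM2l ?(ltW alpha0)//.
by rewrite ler_nat.
Qed.

(** When [z <= B], every [Y i] above [(c - z) / sigma] gives an [X i] above [c], hence a p-value at
    most [s * alpha]. By Chebyshev there are at least [s n + 1] of them outside a small event,
    enough for the cutoff just above [s * alpha]. *)
Lemma one_factor_lower (s c z e : R) : 0 < s < 1 -> Phi c = 1 - s * alpha -> 0 < e ->
  s + 2 * e <= 1 - Phi ((c - z) / sigma) -> e^-1 <= n%:R ->
  1 - Phi (z / tau) - (n%:R * e ^+ 2)^-1 <= \int[P]_w (ev w)%:R.
Proof.
move=> /andP[s0 s1] cE e0 he en.
pose y := (c - z) / sigma.
have bb (b : T -> bool) : measurable [set w | b w] -> @bounded_mfun _ T R (fun w => (b w)%:R).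
  exact: bounded_mfun_bool.
(* Of the margin [2 e n] in the mean, one [e n] is the deviation and the other, at least 1 by
   [e^-1 <= n], covers the [+ 1] for rounding. *)
have cheb : \int[P]_w ((count_ge Y y w)%:R < s * n%:R + 1)%R%:R <= (n%:R * e ^+ 2)^-1.
  apply: (@count_ge_chebyshev _ _ _ _ _ _ whiteY y) => // w.
  move=> h; rewrite -normrN (le_trans _ (ler_norm _))//.
  have : e^-1 * e <= n%:R * e by rewrite ler_wpM2r// ltW.
  rewrite mulVf ?gt_eqF// => h1.
  have : (s + 2 * e) * n%:R <= (1 - Phi y) * n%:R by rewrite ler_wpM2r// ltW.
  by rewrite opprB; lra.
apply: (@le_trans _ _ (\int[P]_w (z <= B w)%R%:R -
    \int[P]_w ((count_ge Y y w)%:R < s * n%:R + 1)%R%:R)).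
  by rewrite factor_tail lerD2l lerN2.
rewrite -(RintegralB_bounded P (bb _ (mBray z)) (bb _ (mcount_lt _ y))).
apply: le_Rintegral_bounded; [apply: bounded_mfunB; exact: bb|exact: bb|].
move=> w; case: (leP z (B w)) => zB; last first.
  by rewrite sub0r (le_trans _ (ler0n _ _))// oppr_le0.
case: ltP => hN; first by rewrite subrr.
rewrite subr0 (_ : ev w)//.
(* With [k] the integer part of [s n], the cutoff of rank [k.+1] is at least [s * alpha], while
   [k.+1 <= s n + 1] is still below the count. *)
have kn : (Num.truncn (s * n%:R) < n)%N.
  rewrite truncn_lt_nat; last by rewrite mulr_ge0 ?(ltW s0)// ltW.
  by rewrite -[ltRHS]mul1r ltr_pM2r.
apply/existsP; exists (Ordinal kn) => /=.
set k := Num.truncn _ in kn *.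
have sk : s * n%:R < k.+1%:R by exact: truncnS_gt.
have ks : k%:R <= s * n%:R by rewrite truncn_le mulr_ge0 ?(ltW s0)// ltW.
rewrite -(@ler_nat R).
apply: (@le_trans _ _ (count_ge Y y w)%:R).
  by apply: le_trans hN; rewrite -natr1 lerD2r.
rewrite ler_nat; apply: subset_leq_card; apply/fintype.subsetP => i; rewrite !inE => hi.
apply: (@le_trans _ _ (1 - Phi c)).
  rewrite pvalue_le XE; move: hi; rewrite /y ler_pdivrMr// => hi.
  by rewrite mulrC; lra.
by rewrite cE opprB addrCA subrr addr0 mulrAC ler_wpM2r ?(ltW alpha0)// ler_pdivlMr// ltW.
Qed.

Lemma inv_tail_mean (C z : R) i : 0 <= C ->
  P.-integrable setT (fun w => (inv_tail sigma z C (Y i w))%:E) /\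
  \int[P]_w inv_tail sigma z C (Y i w) = \int[gamma]_y inv_tail sigma z C y.
Proof.
move=> C0; have [mY _] := whiteY.
have s01 : 0 <= sigma < 1 by case/andP: sigma01 => /ltW -> ->.
have it := integrable_inv_tail z s01 C0.
have mI : measurable_fun [set: measurableTypeR R] (id : R -> R) by exact: measurable_id.
have law (A : set R) (mA : measurable A) : P (Y i @^-1` A) = gamma (id @^-1` A).
  exact: (white_marginal whiteY).
split.
  exact: (same_law_integrable (mY i) mI law (measurable_inv_tail sigma z C) it).
exact: (same_law_Rintegral (mY i) mI law (measurable_inv_tail sigma z C) it).
Qed.

(* If BH rejects at the cutoff [1 - Phi c = k.+1 * alpha / n], then either [c]
   lies in a cell of the grid, where the count is too large, or
   [c >= x0 + m * delta], and then the [k.+1 = n (1 - Phi c) / alpha] rejected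
   observations each contribute at least [(1 - Phi c)^-1] to the last sum. *)
Lemma one_factor_upper_pointwise (z x0 delta : R) (m : nat) w :
  0 < delta -> Phi x0 = 1 - alpha ->
  (ev w)%:R <= (z <= B w)%R%:R
    + \sum_(j < m) (n%:R * ((1 - Phi (x0 + j.+1%:R * delta)) / alpha)
        <= (count_ge Y ((x0 + j%:R * delta - z) / sigma) w)%:R)%R%:R
    + alpha / n%:R * \sum_i inv_tail sigma z (x0 + m%:R * delta) (Y i w) :> R.
Proof.
move=> d0 x0E; set S := \sum_(j < m) _; set I := \sum_i _.
have S0 : 0 <= S by rewrite sumr_ge0.
have I0 : 0 <= alpha / n%:R * I.
  by rewrite mulr_ge0 ?divr_ge0 ?(ltW alpha0)// sumr_ge0// => i _; exact: inv_tail_ge0.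
case: (leP z (B w)) => zB.
  by rewrite -addrA (le_trans (_ : _ <= 1))// ?lerDl ?addr_ge0//; case: (ev w).
rewrite add0r; case: (boolP (ev w)) => [|_]; last by rewrite addr_ge0.
move=> /existsP[k]; set u := _ * alpha / _ => hk.
have /andP[u0 ua] := cut k; rewrite -/u in u0 ua.
have [|c cE] := @Phi_surj R (1 - u); first by case/andP: alpha01 => *; lra.
have uE : u = 1 - Phi c by rewrite cE opprB addrC subrK.
(* No BH cutoff exceeds [alpha], so the grid may start at [x0]. *)
have x0c : x0 <= c by rewrite -Phi_le x0E cE; lra.
have hc : (k < #|[set i | (c <= X i w)%R]%SET|)%N.
  apply: leq_trans hk _; apply: subset_leq_card; apply/fintype.subsetP => i.
  by rewrite !inE uE pvalue_le.
have kn : k.+1%:R = n%:R * u / alpha :> R.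
  by rewrite /u; field; rewrite !gt_eqF.
have BX i : X i w - z <= sigma * Y i w by rewrite XE; lra.
have [Cc|cC] := leP (x0 + m%:R * delta) c.
  apply: (@le_trans _ _ (alpha / n%:R * I)); last by rewrite lerDr.
  suff h : k.+1%:R / u <= I.
    have -> : 1%:R = alpha / n%:R * (k.+1%:R / u) :> R.
      by rewrite kn; field; rewrite !gt_eqF.
    by rewrite ler_wpM2l// divr_ge0// ltW.
  apply: (@le_trans _ _ (\sum_(i in [set i | c <= X i w]%SET) u^-1)).
    by rewrite sumr_const -[leRHS]mulr_natl ler_wpM2r ?invr_ge0 ?(ltW u0)// ler_nat.
  rewrite [leLHS]big_mkcond/=; apply: ler_sum => i _; rewrite inE.
  case: (leP c (X i w)) => [cX|_]; last exact: inv_tail_ge0.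
  have hX : c <= sigma * Y i w + z by have := BX i; lra.
  rewrite /inv_tail (le_trans Cc hX) mul1r lef_pV2 ?posrE ?subr_gt0 ?Phi_lt1//.
  by rewrite uE lerD2l lerN2 Phi_le.
apply: (@le_trans _ _ S); last by rewrite lerDl.
(* In the cell that contains [c], the count is taken at the left end, where it is larger, and the
   cutoff at the right end, where it is smaller; the inequality survives both changes. *)
pose j := Num.truncn ((c - x0) / delta).
have cx0 : 0 <= (c - x0) / delta by rewrite divr_ge0 ?subr_ge0// ltW.
have jm : (j < m)%N by rewrite truncn_lt_nat// ltr_pdivrMr//; lra.
have /andP[j1 j2] := truncn_itv cx0.
rewrite -/j ler_pdivlMr// in j1; rewrite -/j ltr_pdivrMr// in j2.
rewrite /S (bigD1 (Ordinal jm))//= -[leLHS]addr0 lerD ?sumr_ge0//.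
suff h : n%:R * ((1 - Phi (x0 + j.+1%:R * delta)) / alpha)
    <= (count_ge Y ((x0 + j%:R * delta - z) / sigma) w)%:R :> R by rewrite h.
apply: (@le_trans _ _ k.+1%:R).
  rewrite kn -mulrA ler_wpM2l ?(ltW n0')// ler_wpM2r ?invr_ge0 ?(ltW alpha0)//.
  by rewrite uE lerD2l lerN2 Phi_le; lra.
rewrite ler_nat; apply: leq_trans hc _; apply: subset_leq_card.
apply/fintype.subsetP => i; rewrite !inE => cX.
by rewrite ler_pdivrMr// mulrC; have := BX i; lra.
Qed.

(** The three terms of the pointwise bound integrate to the tail of [B], one Chebyshev error per
    cell, and [alpha] times a single integral: the [n] equal means cancel the factor [1 / n], so
    this last term is uniform in [n]. *)
Lemma one_factor_upper (z x0 delta e : R) (m : nat) :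
  0 < delta -> Phi x0 = 1 - alpha -> 0 <= x0 + m%:R * delta -> 0 < e ->
  (forall j, (j < m)%N -> 1 - Phi ((x0 + j%:R * delta - z) / sigma) + e <=
     (1 - Phi (x0 + j.+1%:R * delta)) / alpha) ->
  \int[P]_w (ev w)%:R <= 1 - Phi (z / tau) + m%:R * (n%:R * e ^+ 2)^-1
    + alpha * \int[gamma]_y inv_tail sigma z (x0 + m%:R * delta) y.
Proof.
move=> d0 x0E C0 e0 he.
pose y (j : nat) := (x0 + j%:R * delta - z) / sigma.
pose b (j : nat) w := n%:R * ((1 - Phi (x0 + j.+1%:R * delta)) / alpha)
  <= (count_ge Y (y j) w)%:R :> R.
pose I i w := inv_tail sigma z (x0 + m%:R * delta) (Y i w).
have bb (h : T -> bool) : measurable [set w | h w] -> @bounded_mfun _ T R (fun w => (h w)%:R).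
  exact: bounded_mfun_bool.
have bS : bounded_mfun (fun w => \sum_(j < m) (b j w)%:R : R).
  by apply: bounded_mfun_sum => j; apply: bb; exact: mcount.
have b1 : bounded_mfun (fun w => (z <= B w)%R%:R + \sum_(j < m) (b j w)%:R : R).
  by apply: bounded_mfunD => //; exact: bb.
have intI i : P.-integrable setT (EFin \o I i) by have [] := inv_tail_mean z i C0.
have intS : P.-integrable setT (EFin \o (fun w => \sum_i I i w)).
  rewrite (_ : _ \o _ = fun w => \sum_i (I i w)%:E)%E; last first.
    by apply/funext => w; rewrite /= sumEFin.
  by apply: integrable_sum => // i _; exact: intI.
have intaS : P.-integrable setT (EFin \o (fun w => alpha / n%:R * \sum_i I i w)).
  rewrite (_ : _ \o _ = fun w => ((alpha / n%:R)%:E * (\sum_i I i w)%:E)%E)//.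
  exact: integrableZl.
apply: (@le_trans _ _ (\int[P]_w ((z <= B w)%R%:R + \sum_(j < m) (b j w)%:R
    + alpha / n%:R * \sum_i I i w))).
  apply: le_Rintegral => //.
  - exact/bounded_mfun_integrable/bb.
  - rewrite (_ : _ \o _ = fun w => (((z <= B w)%R%:R + \sum_(j < m) (b j w)%:R)%:E
      + (alpha / n%:R * \sum_i I i w)%:E)%E)//.
    by apply: (integrableD measurableT _ intaS); exact: bounded_mfun_integrable.
  - by move=> w _; exact: one_factor_upper_pointwise.
rewrite (RintegralD measurableT (bounded_mfun_integrable P b1) intaS).
rewrite (RintegralD_bounded P (bb _ (mBray z)) bS) factor_tail.
rewrite Rintegral_sum_bounded; last by move=> j; apply: bb; exact: mcount.
apply: lerD; first rewrite lerD2l.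
  apply: (@le_trans _ _ (\sum_(j < m) (n%:R * e ^+ 2)^-1)).
    apply: ler_sum => j _.
    apply: (@count_ge_chebyshev _ _ _ _ _ _ whiteY (y j)) => //; first exact: mcount.
    move=> w hb; rewrite (le_trans _ (ler_norm _))//.
    have := he j (ltn_ord j); rewrite -/(y j) => h.
    have : (1 - Phi (y j) + e) * n%:R <=
      (1 - Phi (x0 + j.+1%:R * delta)) / alpha * n%:R by rewrite ler_wpM2r// ltW.
    by move: hb; rewrite /b; lra.
  by rewrite big_const_ord iter_addr_0 -[leLHS]mulr_natl.
rewrite (RintegralZl _ measurableT intS) (Rintegral_sum intI).
rewrite (eq_bigr (fun=> \int[gamma]_y inv_tail sigma z (x0 + m%:R * delta) y)); last first.
  by move=> i _; have [] := inv_tail_mean z i C0.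
set J := Rintegral _ _ _.
by rewrite big_const_ord iter_addr_0 -[J *+ n]mulr_natl mulrA divfK ?gt_eqF.
Qed.

End one_factor.

Section decomposition.
Context d (T : measurableType d) (R : realType) (P : probability T R) (n : nat).
Context (X : 'I_n -> {RV P >-> R}) (rho : R).
Hypothesis hX : equicorrelated_normal X (fun=> 0) rho.
Hypotheses (n0 : (0 < n)%N) (rho0 : 0 <= rho) (rho1 : rho < 1).
Notation gamma := (@normal_prob R 0 1 : probability _ R).

(* With [v] the variance of the mean, subtracting from each [X i] the multiple
   [1 - sqrt ((1 - rho) / (n v))] of the mean, instead of the mean itself, makes
   the residuals exactly uncorrelated, with variance [1 - rho]. *)
Lemma equicorrelated_decomposition : exists (B : T -> R) (Y : 'I_n -> T -> R),
  [/\ white P Y, measurable_fun setT B,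
    forall A : set R, measurable A -> P (B @^-1` A) =
      gamma ((fun z => (Num.sqrt (rho + (1 - rho) / n%:R) -
                        Num.sqrt ((1 - rho) / n%:R)) * z) @^-1` A) &
    forall i w, X i w = B w + Num.sqrt (1 - rho) * Y i w].
Proof.
have n0' : 0 < n%:R :> R by rewrite ltr0n.
have r0 : 0 < 1 - rho by rewrite subr_gt0.
pose v := rho + (1 - rho) / n%:R.
have vn0 : 0 < (1 - rho) / n%:R by rewrite divr_gt0.
have v0 : 0 < v by rewrite ltr_wpDl.
pose m := Num.sqrt ((1 - rho) / n%:R) / Num.sqrt v.
have m2 : m ^+ 2 = (1 - rho) / n%:R / v.
  by rewrite expr_div_n !sqr_sqrtr// ltW.
have mv : m * Num.sqrt v = Num.sqrt ((1 - rho) / n%:R).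
  by rewrite divfK// gt_eqF// sqrtr_gt0.
have m1 : m <= 1.
  by rewrite ler_pdivrMr ?sqrtr_gt0// mul1r ler_wsqrtr// lerDr.
pose s := Num.sqrt (1 - rho).
have s2 : s ^+ 2 = 1 - rho by rewrite sqr_sqrtr// ltW.
have s0 : 0 < s by rewrite sqrtr_gt0.
pose B w := \sum_i ((1 - m) / n%:R) * X i w.
pose Y i w := (X i w - B w) / s.
have mB : measurable_fun setT B by apply: measurable_sum => i; exact: measurable_funM.
exists B, Y; split => //.
- split; first by move=> i; apply: measurable_funM => //; exact: measurable_funB.
  move=> a A mA.
  pose S := \sum_i a i; pose b i := (a i - (1 - m) * S / n%:R) / s.
  have -> : (fun w => \sum_i a i * Y i w) = (fun w => \sum_i b i * X i w).
    apply/funext => w; rewrite /Y /b.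
    have E1 : \sum_i a i * ((X i w - B w) / s) = (\sum_i a i * X i w - S * B w) / s.
      rewrite mulrBl mulr_suml mulr_suml mulr_suml -sumrB.
      by apply: eq_bigr => i _; ring.
    have E2 : \sum_i ((a i - (1 - m) * S / n%:R) / s) * X i w =
        (\sum_i a i * X i w - S * B w) / s.
      rewrite /B [S * _]mulr_sumr -sumrB mulr_suml.
      by apply: eq_bigr => i _; ring.
    by rewrite E1 E2.
  rewrite (equicorrelated_law hX)//; congr (gamma _); congr (_ @^-1` A).
  apply/funext => z; congr (Num.sqrt _ * z); rewrite /comb_var.
  have -> : \sum_i b i = m * S / s.
    rewrite /b -mulr_suml sumrB big_const_ord iter_addr_0 -/S; congr (_ / _).
    rewrite -[X in _ - X]mulr_natl; field; exact: lt0r_neq0.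
  have -> : \sum_i b i ^+ 2 = (\sum_i a i ^+ 2 - (1 - m ^+ 2) * S ^+ 2 / n%:R) / s ^+ 2.
    pose k := (1 - m) * S / n%:R.
    transitivity (\sum_i ((a i ^+ 2 - 2 * k * a i) + k ^+ 2) / s ^+ 2).
      by apply: eq_bigr => i _; rewrite /b -/k expr_div_n; congr (_ / _); ring.
    rewrite -mulr_suml; congr (_ / _).
    rewrite big_split/= sumrB -mulr_sumr -/S big_const_ord iter_addr_0.
    rewrite -[k ^+ 2 *+ n]mulr_natl /k; field; exact: lt0r_neq0.
  (* The choice [m ^ 2 * v = (1 - rho) / n] makes the terms in [S ^ 2] cancel and leaves
     [\sum_i a i ^ 2]. *)
  rewrite [(m * S / s) ^+ 2]expr_div_n [(m * S) ^+ 2]exprMn m2 s2 /v; field.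
  by rewrite !lt0r_neq0//= ltr_wpDl// mulr_ge0// ltW.
- move=> A mA; rewrite /B (equicorrelated_law hX)//; congr (gamma _); congr (_ @^-1` A).
  apply/funext => z; congr (_ * z); rewrite /comb_var.
  have sc (x : R) : \sum_(i < n) x = n%:R * x.
    by rewrite big_const_ord iter_addr_0 mulr_natl.
  rewrite !sc.
  have -> : (1 - rho) * (n%:R * ((1 - m) / n%:R) ^+ 2) + rho * (n%:R * ((1 - m) / n%:R)) ^+ 2
      = (Num.sqrt v - Num.sqrt ((1 - rho) / n%:R)) ^+ 2.
    have -> : Num.sqrt v - Num.sqrt ((1 - rho) / n%:R) = (1 - m) * Num.sqrt v.
      by rewrite -mv; ring.
    rewrite [RHS]exprMn [Num.sqrt v ^+ 2]sqr_sqrtr ?(ltW v0)// /v; field; exact: lt0r_neq0.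
  by rewrite sqrtr_sqr ger0_norm// subr_ge0 ler_wsqrtr// lerDr.
- by move=> i w; rewrite /Y mulrC divfK ?gt_eqF// addrC subrK.
Qed.

End decomposition.

(** * Simes' equality *)

Section simes.
Context {R : realFieldType} (n : nat) (alpha : R) (q : 'I_n.+1 -> R).
Hypothesis n0 : (0 < n)%N.
Hypothesis q1 : \sum_m q m = 1.
Hypothesis qlt : forall k : nat, (k <= n)%N ->
  \sum_(m < n.+1 | (m < k)%N) q m = k%:R * alpha / n%:R.
Implicit Types f : {ffun 'I_n -> 'I_n.+1}.

Let count_lt f (k : nat) : nat := #|[set i | (f i < k)%N]%SET|.

(* [f i] is the least level [k] for which the i-th p-value is at most
   [k.+1 * alpha / n], and [n] if there is none. *)
Definition simes_event f : bool := [exists k : 'I_n, (k < #|[set i | (f i < k.+1)%N]%SET|)%N].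

(** The step-up index in terms of levels; by [count_rej] it is also the number of entries below it,
    that is, of rejections. *)
Let rej f : 'I_n.+1 := [arg max_(k > ord0 | (k <= count_lt f k)%N) k].

Let rejP f : (rej f <= count_lt f (rej f))%N /\
  forall k : 'I_n.+1, (k <= count_lt f k)%N -> (k <= rej f)%N.
Proof. by rewrite /rej; case: arg_maxnP. Qed.

Let count_lt_mono f k l : (k <= l)%N -> (count_lt f k <= count_lt f l)%N.
Proof.
move=> kl; apply: subset_leq_card; apply/fintype.subsetP => i; rewrite !inE => h.
exact: leq_trans h kl.
Qed.

Let count_lt_n f k : (count_lt f k <= n)%N.
Proof. by rewrite /count_lt (leq_trans (max_card _))// card_ord. Qed.

(** If more than [rej f] entries lay below [rej f], then [(rej f).+1] would qualify too, since
    counts increase with the level. *)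
Let count_rej f : count_lt f (rej f) = rej f.
Proof.
have [h1 h2] := rejP f; apply/eqP; rewrite eqn_leq h1 andbT leqNgt; apply/negP => h.
have rn : ((rej f).+1 < n.+1)%N by rewrite ltnS (leq_trans h)// count_lt_n.
have := h2 (Ordinal rn); rewrite /= ltnn => H; suff: false by [].
by apply: H; apply: leq_trans h _; exact: count_lt_mono.
Qed.

Let simes_event_rej f : simes_event f = (0 < rej f)%N.
Proof.
have [h1 h2] := rejP f; apply/existsP/idP => [[k hk]|].
  by apply: leq_trans (h2 (lift ord0 k) _).
case e : (nat_of_ord (rej f)) => [//|k] _.
have kn : (k < n)%N by rewrite -ltnS -e ltn_ord.
by exists (Ordinal kn) => /=; rewrite -e.
Qed.

Let upd f (i : 'I_n) (m : 'I_n.+1) : {ffun 'I_n -> 'I_n.+1} :=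
  [ffun j => if j == i then m else f j].

Let rej1 f i := rej (upd f i ord0).

Let rej1_gt0 f i : (0 < rej1 f i)%N.
Proof.
rewrite /rej1 -simes_event_rej; apply/existsP; exists (Ordinal n0) => /=.
by rewrite card_gt0; apply/set0Pn; exists i; rewrite inE ffunE eqxx.
Qed.

Let count_upd f i (k : nat) : (count_lt f k <= count_lt (upd f i ord0) k)%N.
Proof.
apply: subset_leq_card; apply/fintype.subsetP => j; rewrite !inE ffunE.
by case: eqP => // _; case: k.
Qed.

Let count_upd_eq f i (k : nat) : (f i < k)%N -> count_lt (upd f i ord0) k = count_lt f k.
Proof.
move=> h; congr #|pred_of_set _|; apply/setP => j; rewrite !inE ffunE.
by case: eqP => // ->; rewrite h; case: k h.
Qed.

Let rej_le_rej1 f i : (rej f <= rej1 f i)%N.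
Proof.
have [h1 _] := rejP f; have [_ h2] := rejP (upd f i ord0).
exact/h2/(leq_trans h1)/count_upd.
Qed.

(** An entry already below [rej1 f i] is counted at that level before and after its move to level 0,
    so [rej1 f i] qualifies for [f] itself. *)
Let rej_rej1 f i : (f i < rej1 f i)%N -> rej1 f i = rej f.
Proof.
move=> h; apply/val_inj/eqP; rewrite eqn_leq rej_le_rej1 andbT.
have [_ h2] := rejP f; have [h3 _] := rejP (upd f i ord0).
by apply: h2; rewrite -(count_upd_eq h).
Qed.

Let weight f := \prod_i q (f i).

Let sum_weight : \sum_f weight f = 1.
Proof.
transitivity (\prod_(i < n) \sum_m q m); first by rewrite bigA_distr_bigA.
by rewrite big1.
Qed.

(* [rej1 f i], the number of rejections when hypothesis [i] is moved to the
   lowest level, does not depend on [f i]; so exchanging [f i] with an independent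
   copy shows that [f i] may be averaged out first. *)
Let leave_one_out i : \sum_f weight f * ((f i < rej1 f i)%N%:R / (rej1 f i)%:R) =
  alpha / n%:R.
Proof.
pose swap (p : {ffun 'I_n -> 'I_n.+1} * 'I_n.+1) := (upd p.1 i p.2, p.1 i).
have swapK : involutive swap.
  move=> [f m]; rewrite /swap/=; congr pair; last by rewrite ffunE eqxx.
  by apply/ffunP => j; rewrite !ffunE; case: eqP => [->|].
have rej1_swap f m : rej1 (upd f i m) i = rej1 f i.
  by rewrite /rej1; congr rej; apply/ffunP => j; rewrite !ffunE; case: eqP.
have weight_swap f m : weight (upd f i m) * q (f i) = weight f * q m.
  rewrite /weight (bigD1 i)//= ffunE eqxx [in RHS](bigD1 i)//=.
  rewrite (eq_bigr (fun j => q (f j))) => [|j ji]; first by ring.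
  by rewrite ffunE (negbTE ji).
transitivity (\sum_p weight p.1 * q p.2 * ((p.1 i < rej1 p.1 i)%N%:R / (rej1 p.1 i)%:R)).
  rewrite -(pair_bigA _ (fun f m => weight f * q m * ((f i < rej1 f i)%N%:R / (rej1 f i)%:R)))/=.
  apply: eq_bigr => f _; rewrite -mulr_suml -mulr_sumr q1; ring.
rewrite (reindex_inj (inv_inj swapK))/=.
transitivity (\sum_p weight p.1 * q p.2 * ((p.2 < rej1 p.1 i)%N%:R / (rej1 p.1 i)%:R)).
  apply: eq_bigr => -[f m] _ /=; rewrite weight_swap rej1_swap.
  by rewrite ffunE eqxx.
rewrite -(pair_bigA _ (fun f m => weight f * q m * ((m < rej1 f i)%N%:R / (rej1 f i)%:R)))/=.
transitivity ((\sum_f weight f) * (alpha / n%:R)); last by rewrite sum_weight mul1r.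
rewrite mulr_suml; apply: eq_bigr => f _.
transitivity (weight f / (rej1 f i)%:R * \sum_(m < n.+1 | (m < rej1 f i)%N) q m).
  rewrite mulr_sumr [in RHS]big_mkcond/=; apply: eq_bigr => m _.
  by case: (m < rej1 f i)%N; rewrite /= ?mul0r ?mulr0//; ring.
have rn : (rej1 f i <= n)%N by rewrite -ltnS.
have r0 : (rej1 f i)%:R != 0 :> R by rewrite pnatr_eq0 -lt0n rej1_gt0.
by rewrite (qlt rn) -(mulrA (rej1 f i)%:R) mulrA divfK.
Qed.

(** The indicator of a rejection is the sum over [i] of the share [1 / rej f] of each rejected [i].
    In each share [rej1 f i] may replace [rej f], and the average is then [alpha / n] by
    [leave_one_out]. *)
Lemma simes_equality :
  \sum_(f : {ffun 'I_n -> 'I_n.+1}) (\prod_i q (f i)) * (simes_event f)%:R = alpha.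
Proof.
transitivity (\sum_f \sum_i weight f * ((f i < rej1 f i)%N%:R / (rej1 f i)%:R)).
  apply: eq_bigr => f _; rewrite -mulr_sumr; congr (_ * _).
  transitivity (\sum_i ((f i < rej f)%N%:R / (rej f)%:R : R)).
    rewrite -mulr_suml -natr_sum.
    have -> : (\sum_i (f i < rej f))%N = rej f.
      rewrite -[RHS](count_rej f) /count_lt -sum1_card [RHS]big_mkcond/=.
      by apply: eq_bigr => i _; rewrite inE; case: (_ < _)%N.
    rewrite simes_event_rej; case: (nat_of_ord (rej f)) => [|m]; first by rewrite mul0r.
    by rewrite divff// pnatr_eq0.
  apply: eq_bigr => i _; case: (ltnP (f i) (rej1 f i)) => h.
    by rewrite (rej_rej1 h) -{1}(rej_rej1 h) h.
  by rewrite ltnNge (leq_trans (rej_le_rej1 f i) h) !mul0r.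
rewrite exchange_big/= (eq_bigr (fun=> alpha / n%:R)); last by move=> i _; exact: leave_one_out.
rewrite big_const_ord iter_addr_0 -[LHS]mulr_natl mulrC divfK// pnatr_eq0 -lt0n//.
Qed.

End simes.

(** * Correlation 0: reduction to the finite Simes equality *)

Section independent.
Context d (T : measurableType d) (R : realType) (P : probability T R) (n : nat).
Context (X : 'I_n -> {RV P >-> R}) (alpha : R).
Notation gamma := (@normal_prob R 0 1 : probability _ R).
Hypotheses (n0 : (0 < n)%N) (alpha01 : 0 < alpha < 1).
Hypothesis whiteX : white P (fun i => X i).

Let cut (k : nat) : R := k%:R * alpha / n%:R.

Let cut01 k : (0 < k)%N -> (k <= n)%N -> 0 < cut k < 1.
Proof.
move=> k0 kn; have /andP[a0 a1] := alpha01; have n0' : 0 < n%:R :> R by rewrite ltr0n.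
rewrite divr_gt0 ?mulr_gt0 ?ltr0n//= ltr_pdivrMr// mul1r.
apply: (@lt_le_trans _ _ k%:R); last by rewrite ler_nat.
by rewrite gtr_pMr// ltr0n.
Qed.

(** As the cutoffs increase, the number of cutoffs that the p-value exceeds is the least index [k]
    whose cutoff [cut k.+1] it meets, or [n] if it meets none. *)
Let bucket (x : R) : 'I_n.+1 :=
  inord #|[set k : 'I_n | ~~ (pvalue x <= cut k.+1)%R]%SET|.

Let bucket_lt x (k : nat) : (k < n)%N -> (bucket x < k.+1)%N = (pvalue x <= cut k.+1).
Proof.
move=> kn; rewrite inordK; last by rewrite ltnS (leq_trans (max_card _))// card_ord.
have cutm j l : (j <= l)%N -> cut j <= cut l.
  move=> jl; have /andP[a0 _] := alpha01.
  by rewrite /cut ler_wpM2r ?invr_ge0// ler_wpM2r ?(ltW a0)// ler_nat.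
have cardlt m : (m <= n)%N -> #|[set j : 'I_n | (j < m)%N]%SET| = m.
  move=> mn; rewrite -sum1_card -[RHS]card_ord -[RHS]sum1_card.
  rewrite [RHS](big_ord_widen n (fun=> 1%N) mn).
  by apply: eq_bigl => j; rewrite inE.
apply/idP/idP => [|h].
  apply: contraTT => h; rewrite -leqNgt -{1}(cardlt _ kn); apply: subset_leq_card.
  apply/fintype.subsetP => j; rewrite !inE ltnS => jk.
  by apply: contra h => h; rewrite (le_trans h)// cutm// ltnS.
rewrite ltnS -[leqRHS](cardlt _ (ltnW kn)); apply: subset_leq_card.
apply/fintype.subsetP => j; rewrite !inE; apply: contraR; rewrite -leqNgt => kj.
by rewrite (le_trans h)// cutm// ltnS.
Qed.

Let below (k : nat) (x : R) : R := (bucket x < k)%N%:R.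

Let below_ray k : (0 < k)%N -> (k <= n)%N -> exists2 c,
  Phi c = 1 - cut k & below k = fun x => (c <= x)%R%:R.
Proof.
case: k => // k _ kn; have /andP[u0 u1] := cut01 (ltn0Sn k) kn.
have [|c cE] := @Phi_surj R (1 - cut k.+1); first by rewrite subr_gt0 u1/= ltrBlDr ltrDl.
exists c => //; apply/funext => x; rewrite /below bucket_lt//.
have -> : cut k.+1 = 1 - Phi c by rewrite cE opprB addrC subrK.
by rewrite pvalue_le.
Qed.

Let below_approx k : (k <= n.+1)%N -> trig_approx (below k).
Proof.
rewrite leq_eqVlt => /orP[/eqP->|]; last rewrite ltnS => kn.
  have -> : below n.+1 = fun=> 1 by apply/funext => x; rewrite /below ltn_ord.
  by apply: trigpoly_approx; [exact: trigpoly_cst|move=> x; rewrite ler01 lexx].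
case: (posnP k) => [->|k0].
  have -> : below 0 = fun=> 0 by apply/funext => x; rewrite /below ltn0.
  by apply: trigpoly_approx; [exact: trigpoly_cst|move=> x; rewrite ler01 lexx].
by have [c _ ->] := below_ray k0 kn; exact: trig_approx_ge.
Qed.

Let mean_below k : (k <= n)%N -> \int[gamma]_x below k x = cut k.
Proof.
case: (posnP k) => [->|k0] kn.
  under eq_Rintegral do rewrite /below ltn0.
  by rewrite (Rintegral_prob_cst gamma) /cut !mul0r.
have [c cE ->] := below_ray k0 kn; rewrite Rintegral_ray cE; ring.
Qed.

Let cell (m : 'I_n.+1) (x : R) : R := (bucket x == m)%:R.

(** A cell is a difference of nested rays, written as a product with a complement so that the
    closure rules of [trig_approx] apply. *)
Let cell_approx m : trig_approx (cell m).
Proof.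
have -> : cell m = fun x => below m.+1 x * (1 - below m x).
  apply/funext => x; rewrite /cell /below ltnS -val_eqE/=.
  by case: ltngtP; rewrite ?subrr ?subr0 ?mulr0 ?mulr1 ?mul0r.
apply: trig_approxM; first exact: below_approx.
by apply: trig_approxC; apply: below_approx; rewrite ltnW.
Qed.

Let bounded_cell m : @bounded_mfun _ (measurableTypeR R) R (cell m).
Proof. by have [mc [c01 _]] := cell_approx m; exact: unit_bounded_mfun. Qed.

Let sum_cell (k : nat) : (k <= n.+1)%N ->
  \sum_(m < n.+1 | (m < k)%N) \int[gamma]_x cell m x = \int[gamma]_x below k x.
Proof.
move=> kn; rewrite big_mkcond/=.
rewrite (eq_bigr (fun m : 'I_n.+1 => \int[gamma]_x ((m < k)%N%:R * cell m x))); last first.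
  move=> m _; rewrite (RintegralZl_bounded gamma)//.
  by case: (m < k)%N; rewrite ?mul1r ?mul0r.
rewrite -(Rintegral_sum_bounded gamma); last first.
  by move=> m; apply: bounded_mfunM => //; exact: bounded_mfun_cst.
apply: eq_Rintegral => x _; rewrite /cell /below (bigD1 (bucket x))//= eqxx mulr1.
by rewrite big1 ?addr0// => m mx; rewrite eq_sym (negbTE mx) mulr0.
Qed.

(** For each outcome exactly one assignment [f] has a nonzero product of cells, so the event expands
    as a sum over [f]; independence turns the mean of each product into the weight
    [\prod_i q (f i)]. *)
Lemma independent_BH :
  \int[P]_w (BH_event alpha (fun i => pvalue (X i w)))%:R = alpha.
Proof.
pose q m := \int[gamma]_x cell m x.
have q1 : \sum_m q m = 1.
  have := sum_cell (leqnn n.+1).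
  rewrite (eq_bigl xpredT) => [->|m]; last by rewrite ltn_ord.
  under eq_Rintegral do rewrite /below ltn_ord.
  exact: (Rintegral_prob_cst gamma).
have qlt k : (k <= n)%N -> \sum_(m < n.+1 | (m < k)%N) q m = k%:R * alpha / n%:R.
  by move=> kn; rewrite sum_cell ?mean_below// ltnW// ltnS.
rewrite -[RHS](simes_equality n0 q1 qlt).
have [mX _] := whiteX.
have bX m i : bounded_mfun (fun w => cell m (X i w)).
  have [mc [c01 _]] := cell_approx m; split; first exact: (measurableT_comp mc).
  by exists 1 => w; have /andP[c0 c1] := c01 (X i w); rewrite ger0_norm.
have prodcell (f : {ffun 'I_n -> 'I_n.+1}) : \prod_i q (f i) = \int[P]_w (\prod_i cell (f i) (X i w)).
  by rewrite (white_independent whiteX (fun i => cell_approx (f i))).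
transitivity (\sum_(f : {ffun 'I_n -> 'I_n.+1}) \int[P]_w
    ((simes_event f)%:R * \prod_i cell (f i) (X i w))); last first.
  apply: eq_bigr => f _; rewrite RintegralZl_bounded ?prodcell 1?mulrC//.
  by apply: bounded_mfun_prod => i; exact: bX.
rewrite -Rintegral_sum_bounded; last first.
  move=> f; apply: bounded_mfunM; first exact: bounded_mfun_cst.
  by apply: bounded_mfun_prod => i; exact: bX.
apply: eq_Rintegral => w _.
pose F : {ffun 'I_n -> 'I_n.+1} := [ffun i => bucket (X i w)].
rewrite (bigD1 F)//= [X in _ = X + _](_ : _ = (simes_event F)%:R); last first.
  by rewrite big1 ?mulr1// => i _; rewrite /cell ffunE eqxx.
rewrite big1 ?addr0 => [|f fF]; last first.
  have [i hi] : exists i, f i != F i.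
    apply/existsP; apply: contraNT fF; rewrite negb_exists => /forallP h.
    by apply/eqP/ffunP => i; apply/eqP; have := h i; rewrite negbK.
  by rewrite (bigD1 i)//= /cell; move: hi; rewrite ffunE eq_sym => /negbTE ->; rewrite mul0r mulr0.
congr (nat_of_bool _)%:R; rewrite /BH_event /simes_event; apply: eq_existsb => k.
congr (_ < #|pred_of_set _|)%N; apply/setP => i; rewrite !inE ffunE bucket_lt//.
Qed.

End independent.

(** * The limits *)

Section limit_value.
Context {R : realType} (alpha rho : R).
Hypotheses (alpha01 : 0 < alpha < 1) (rho01 : 0 < rho < 1).
Notation gamma := (@normal_prob R 0 1 : probability _ R).

Let sigma := Num.sqrt (1 - rho).

Let sigma01 : 0 < sigma < 1.
Proof.
have /andP[r0 r1] := rho01; rewrite sqrtr_gt0 subr_gt0 r1/=.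
by rewrite -[ltRHS]sqrtr1 ltr_sqrt// gtrBl.
Qed.

Let srho0 : 0 < Num.sqrt rho.
Proof. by have /andP[r0 _] := rho01; rewrite sqrtr_gt0. Qed.

Lemma PhiV_le (u v : R) : 0 < u < 1 -> 0 < v < 1 -> (PhiV u <= PhiV v) = (u <= v).
Proof. by move=> u01 v01; rewrite -Phi_le !PhiVK. Qed.

(** The value of the standardized factor at which the expected fraction of p-values at most
    [t * alpha] is exactly [t]. *)
Definition threshold (t : R) : R :=
  (PhiV (1 - t * alpha) - Num.sqrt (1 - rho) * PhiV (1 - t)) / Num.sqrt rho.

Let thresholds := [set threshold t | t in `]0, 1[ ].

Let level01 (t : R) : 0 < t < 1 -> 0 < 1 - t * alpha < 1.
Proof.
have /andP[a0 a1] := alpha01; move=> /andP[t0 t1].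
by rewrite subr_gt0 mulr_ilt1 ?(ltW t0) ?(ltW a0)//= gtrBl mulr_gt0.
Qed.

Let one_minus01 (t : R) : 0 < t < 1 -> 0 < 1 - t < 1.
Proof. by lra. Qed.

Let has_inf_thresholds : has_inf thresholds.
Proof.
have /andP[a0 a1] := alpha01; have /andP[s0 s1] := sigma01.
split; first by exists (threshold 2^-1), 2^-1 => //=; rewrite in_itv/=; lra.
(* Since [PhiV (1 - t * alpha)] is at least both [PhiV (1 - t)] and [PhiV (1 - alpha)], the
   numerator is at least [1 - sigma] times the latter. *)
exists ((1 - sigma) * PhiV (1 - alpha) / Num.sqrt rho); apply/lbP => x [t /=].
rewrite in_itv/= => t01 <-; have /andP[t0 t1] := t01.
rewrite ler_pM2r ?invr_gt0//.
have h1 : PhiV (1 - alpha) <= PhiV (1 - t * alpha).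
  by rewrite PhiV_le ?level01 ?one_minus01// lerD2l lerN2 ger_pMl// ltW.
have h2 : PhiV (1 - t) <= PhiV (1 - t * alpha).
  by rewrite PhiV_le ?level01 ?one_minus01// lerD2l lerN2 ger_pMr// ltW.
rewrite -/sigma; nra.
Qed.

Let limit := inf thresholds.

Lemma lower_parameters (e : R) : 0 < e -> exists s c : R, [/\ 0 < s < 1,
  Phi c = 1 - s * alpha &
  s < 1 - Phi ((c - Num.sqrt rho * (limit + e)) / sigma)].
Proof.
move=> e0; have [_ [t t01 <-] ht] := inf_adherent e0 has_inf_thresholds.
move: t01; rewrite /= in_itv/= => t01; exists t, (PhiV (1 - t * alpha)); split => //.
  by rewrite PhiVK// level01.
have /andP[s0 _] := sigma01.
rewrite ltrBrDl -ltrBrDr -[ltRHS]PhiVK ?one_minus01// Phi_ltE ltr_pdivrMr//.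
by move: ht; rewrite /threshold ltr_pdivrMr// -/limit -/sigma; lra.
Qed.

(** For [c] beyond [PhiV (1 - alpha)], the ratio [t = (1 - Phi c) / alpha] lies in []0, 1[] and the
    infimum applies. The end [Phi c = 1 - alpha] corresponds to [t = 1], outside the range of the
    infimum, but there the right side is 1. Including it makes the range closed, as compactness
    requires. *)
Lemma upper_gap (e c : R) : 0 < e -> Phi c = 1 - alpha \/ PhiV (1 - alpha) < c ->
  1 - Phi ((c - Num.sqrt rho * (limit - e)) / sigma) < (1 - Phi c) / alpha.
Proof.
have /andP[a0 a1] := alpha01; have /andP[s0 _] := sigma01.
move=> e0 [->|xc].
  rewrite opprB addrCA subrr addr0 divff ?gt_eqF// gtrBl; exact: Phi_gt0.
have Pc : 1 - alpha < Phi c by rewrite -[ltLHS]PhiVK ?one_minus01// Phi_ltE.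
set t := (1 - Phi c) / alpha.
have t01 : 0 < t < 1.
  by rewrite divr_gt0 ?subr_gt0 ?Phi_lt1//= ltr_pdivrMr// mul1r; lra.
have tE : 1 - t * alpha = Phi c by rewrite divfK ?gt_eqF// opprB addrCA subrr addr0.
have : limit - e < threshold t.
  apply: (@lt_le_trans _ _ limit); first by rewrite gtrBl.
  by apply: ge_inf; [have [] := has_inf_thresholds|exists t].
rewrite /threshold tE PhiK ltr_pdivlMr// -/sigma => h.
rewrite ltrBlDr -ltrBlDl -[ltLHS]PhiVK ?one_minus01// Phi_ltE ltr_pdivlMr//.
by lra.
Qed.

Lemma upper_grid (e : R) : 0 < e -> let z := Num.sqrt rho * (limit - e) in
  exists (x0 delta eta : R) (m : nat),
  [/\ 0 < delta, Phi x0 = 1 - alpha, 0 <= x0 + m%:R * delta, 0 < eta &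
      (forall j, (j < m)%N -> 1 - Phi ((x0 + j%:R * delta - z) / sigma) + eta <=
        (1 - Phi (x0 + j.+1%:R * delta)) / alpha) /\
      alpha * \int[gamma]_y inv_tail sigma z (x0 + m%:R * delta) y <= e].
Proof.
move=> e0 z; have /andP[a0 a1] := alpha01; have /andP[s0 s1] := sigma01.
pose x0 := PhiV (1 - alpha).
have x0E : Phi x0 = 1 - alpha by rewrite PhiVK// one_minus01.
(* The right end [k] of the grid is so far out that the first moment term is at most [e];
   [|x0| + 1 <= k] also places it beyond [x0]. *)
have [k [kx kI]] : exists k : nat, `|x0| + 1 <= k%:R /\
    alpha * \int[gamma]_y inv_tail sigma z k%:R y <= e.
  have s01' : 0 <= sigma < 1 by rewrite (ltW s0).
  have /cvgr_le/(_ (e / alpha)) := cvg_inv_tail z s01'.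
  rewrite divr_gt0// => /(_ isT) h.
  have [k [h1 h2]] := filter_ex (filterI (nbhs_infty_ger (`|x0| + 1)) h).
  by exists k; split => //; rewrite mulrC -ler_pdivlMr.
have x0k : x0 < k%:R by have := ler_norm x0; lra.
pose D c := (1 - Phi c) / alpha - (1 - Phi ((c - z) / sigma)).
have cD : continuous D.
  move=> c; apply: cvgB; last apply: cvgB.
  - by apply: cvgMl; apply: cvgB; [exact: cvg_cst|exact: continuous_Phi].
  - exact: cvg_cst.
  - apply: (@continuous_cvg _ _ _ _ _ (fun c => (c - z) / sigma)); first exact: continuous_Phi.
    by apply: cvgMl; apply: cvgB; [exact: cvg_id|exact: cvg_cst].
have [c0 c0in hc0] := EVT_min (ltW x0k) (continuous_subspaceT cD).
have D0 : 0 < D c0.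
  rewrite subr_gt0; apply: upper_gap => //; move: c0in; rewrite in_itv/= => /andP[].
  by rewrite le_eqVlt => /orP[/eqP <- _|? _]; [left|right].
(* Half of the least gap is kept as [eta]. The other half absorbs the mesh: [Phi] is 1-Lipschitz, so
   a step [delta <= alpha * eta] lowers [(1 - Phi c) / alpha] by at most [eta]. *)
pose eta := D c0 / 2; have eta0 : 0 < eta by rewrite divr_gt0.
pose m := (Num.truncn ((k%:R - x0) / (alpha * eta))).+1.
have m0 : 0 < m%:R :> R by rewrite ltr0n.
pose delta := (k%:R - x0) / m%:R.
have delta0 : 0 < delta by rewrite divr_gt0// subr_gt0.
have mdelta : x0 + m%:R * delta = k%:R.
  by rewrite /delta mulrC divfK ?gt_eqF// addrC subrK.
have deltaeta : delta <= alpha * eta.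
  rewrite ler_pdivrMr// mulrC -ler_pdivrMr ?mulr_gt0//.
  by apply: ltW; rewrite /m truncnS_gt.
exists x0, delta, eta, m; split => //; first by rewrite mdelta.
split=> [j jm|]; last by rewrite mdelta.
set c := x0 + j%:R * delta.
have cin : c \in `[x0, k%:R]%R.
  rewrite in_itv/= lerDl mulr_ge0 ?ler0n ?(ltW delta0)//= -mdelta lerD2l.
  by rewrite ler_wpM2r ?(ltW delta0)// ler_nat ltnW.
have := hc0 c cin; rewrite {2}/D.
have -> : x0 + j.+1%:R * delta = c + delta by rewrite -natr1 /c; ring.
have h : Phi (c + delta) - Phi c <= delta.
  by apply: (le_trans (ler_norm _)); apply: (le_trans (Phi_lip _ _)); rewrite addrC addKr gtr0_norm.
have : (1 - Phi c) / alpha - eta <= (1 - Phi (c + delta)) / alpha.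
  by rewrite ler_pdivlMr// mulrBl divfK ?gt_eqF//; nra.
rewrite /eta; lra.
Qed.

End limit_value.

(** * Convergence of the false discovery rate for each correlation *)

Section limits.
Context {R : realType} (alpha : R).
Hypothesis alpha01 : 0 < alpha < 1.
Notation gamma := (@normal_prob R 0 1 : probability _ R).

Lemma cvg_invn : (n%:R^-1 : R) @[n --> \oo] --> (0 : R).
Proof.
apply/gtr0_cvgV0; last exact: cvgr_idn.
by near=> n; rewrite ltr0n; near: n; exact: nbhs_infty_gt.
Unshelve. all: by end_near. Qed.

Context (d : nat -> measure_display) (T : forall n, measurableType (d n)).
Context (P : forall n, probability (T n) R) (X : forall n, 'I_n -> {RV (P n) >-> R}).

Definition fdr (n : nat) : R :=
  \int[P n]_w (BH_event alpha (fun i => pvalue (X i w)))%:R.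

Lemma cvg_FDR (l : R) : fdr n @[n --> \oo] --> l ->
  (fun n => FDR (@X n) (fun=> 0) (BH alpha)) @ \oo --> l%:E.
Proof.
move=> h.
have fdrE n : FDR (@X n) (fun=> 0) (BH alpha) = (fdr n)%:E.
  rewrite FDR_BH_event /fdr Rintegral_bool; last exact: measurable_BH_event.
  by rewrite fineK// fin_num_measure//; exact: measurable_BH_event.
under eq_fun do rewrite fdrE.
by apply: cvg_EFin => //; exact: nearW.
Qed.

Lemma coordinate_law n (Y : 'I_n -> {RV (P n) >-> R}) rho i (A : set R) :
  equicorrelated_normal Y (fun=> 0) rho -> measurable A -> P n (Y i @^-1` A) = gamma A.
Proof.
move=> hY mA; have := equicorrelated_law hY (fun j => (j == i)%:R) mA.
have delta (F : 'I_n -> R) : \sum_j (j == i)%:R * F j = F i.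
  rewrite (bigD1 i)//= eqxx mul1r big1 ?addr0// => j /negbTE ->; exact: mul0r.
rewrite (_ : (fun w => \sum_j _) = Y i); last by apply/funext => w; rewrite delta.
move=> ->; congr (gamma _).
have -> : comb_var rho (fun j : 'I_n => (j == i)%:R) = 1.
  rewrite /comb_var (eq_bigr (fun j => (j == i)%:R * 1)); last first.
    by move=> j _; case: (j == i); rewrite ?mulr1 ?expr1n ?expr0n.
  rewrite delta (eq_bigr (fun j => (j == i)%:R * 1)); last by move=> j _; rewrite mulr1.
  by rewrite delta; ring.
by apply/seteqP; split => z /=; rewrite sqrtr1 mul1r.
Qed.

Section independent.
Hypothesis hX : forall n, equicorrelated_normal (@X n) (fun=> 0) 0.

Lemma cvg_fdr0 : fdr n @[n --> \oo] --> alpha.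
Proof.
apply: cvg_near_cst; near=> n; apply: independent_BH => //.
  by near: n; exact: nbhs_infty_gt.
split=> // a A mA; rewrite (equicorrelated_law (hX n) a mA).
by rewrite /comb_var subr0 mul1r mul0r addr0.
Unshelve. all: by end_near. Qed.

End independent.

Section equal.
Hypothesis hX : forall n, equicorrelated_normal (@X n) (fun=> 0) 1.

(** For [rho = 1] the combination [X i - X j] has variance 0, so its law is the point mass at 0. *)
Lemma equal_coordinates n (i j : 'I_n) : P n [set w | X i w != X j w] = 0.
Proof.
pose a k : R := (k == i)%:R - (k == j)%:R.
have delta (F : 'I_n -> R) k : \sum_l (l == k)%:R * F l = F k.
  rewrite (bigD1 k)//= eqxx mul1r big1 ?addr0// => l /negbTE ->; exact: mul0r.
have aE (F : 'I_n -> R) : \sum_k a k * F k = F i - F j.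
  rewrite -[in RHS](delta F i) -(delta F j) -sumrB.
  by apply: eq_bigr => k _; rewrite mulrBl.
have := equicorrelated_law (hX n) a (measurableC (measurable_set1 (0 : R))).
have a1 : comb_var 1 a = 0.
  rewrite /comb_var subrr mul0r add0r mul1r (eq_bigr (fun k => a k * 1)).
    by rewrite aE subrr expr0n.
  by move=> k _; rewrite mulr1.
rewrite a1 sqrtr0; set S := (S in P n S = _) => PS.
rewrite (_ : [set w | _] = S).
  rewrite PS (_ : _ @^-1` _ = set0) ?measure0//.
  by apply/seteqP; split => // z /=; rewrite mul0r.
apply/seteqP; split => w /=; rewrite /S/= aE; first by move=> /eqP h /subr0_eq.
by move=> h; apply/eqP => e; apply: h; rewrite e subrr.
Qed.

(** With a common p-value every count is 0 or [n], so the largest cutoff, [alpha], decides. *)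
Lemma BH_event_cst n (p : R) : (0 < n)%N -> BH_event alpha (fun _ : 'I_n => p) = (p <= alpha).
Proof.
move=> n0; have /andP[a0 a1] := alpha01; have n0' : 0 < n%:R :> R by rewrite ltr0n.
apply/existsP/idP => [[k hk]|pa].
  have pk : p <= k.+1%:R * alpha / n%:R.
    move: hk; rewrite /count_le; apply: contraTT => /negbTE pk.
    by rewrite (_ : [set _ | _]%SET = finset.set0) ?cards0//; apply/setP => i; rewrite !inE pk.
  apply: (le_trans pk); rewrite ler_pdivrMr// mulrC ler_pM2l// ler_nat.
  exact: ltn_ord.
have nn : (n.-1 < n)%N by rewrite prednK.
exists (Ordinal nn) => /=; rewrite prednK// [_ * alpha]mulrC mulfK ?gt_eqF//.
by rewrite /count_le (_ : [set _ | _]%SET = finset.setT) ?cardsT ?card_ord//; apply/setP => i; rewrite !inE.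
Qed.

Lemma fdr1 n : (0 < n)%N -> fdr n = alpha.
Proof.
move=> n0; have /andP[a0 a1] := alpha01; pose i0 := Ordinal n0.
have [c cE] : exists c : R, Phi c = 1 - alpha by apply: Phi_surj; lra.
have mE : measurable [set w | BH_event alpha (fun i : 'I_n => pvalue (X i w))].
  exact: measurable_BH_event.
have mray : measurable [set w | c <= X i0 w].
  have mX : measurable_fun setT (X i0) by [].
  by rewrite -[X in measurable X]setTI; apply: (mX measurableT [set x | c <= x]); exact: measurable_ray.
have mne i : measurable [set w | X i w != X i0 w].
  rewrite (_ : [set w | _] = (fun w => X i w - X i0 w) @^-1` (~` [set 0])).
    rewrite -[X in measurable X]setTI.
    have mf : measurable_fun setT (fun w => X i w - X i0 w) by exact: measurable_funB.
    by apply: mf => //; apply: measurableC; exact: measurable_set1.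
  apply/seteqP; split => w /=; first by move=> /eqP h /subr0_eq.
  by move=> h; apply/eqP => e; apply: h; rewrite e subrr.
have rayE : \int[P n]_w (c <= X i0 w)%R%:R = alpha.
  rewrite Rintegral_bool// (coordinate_law i0 (hX n) (measurable_ray c)).
  rewrite -(@Rintegral_bool _ _ _ gamma (fun x => c <= x)); last exact: measurable_ray.
  by rewrite Rintegral_ray cE opprB addrCA subrr addr0.
have bne i : bounded_mfun (fun w => (X i w != X i0 w)%:R : R) by exact: bounded_mfun_bool.
have bS : bounded_mfun (fun w => \sum_i (X i w != X i0 w)%:R : R) by exact: bounded_mfun_sum.
have neE : \int[P n]_w \sum_i (X i w != X i0 w)%:R = 0.
  rewrite Rintegral_sum_bounded// big1// => i _.
  by rewrite Rintegral_bool// equal_coordinates.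
(* The sum of the indicators of disagreement has mean 0 and is at least 1 wherever the coordinates
   differ, so adding it to either side corrects the comparison at no cost. *)
have same w : (BH_event alpha (fun i => pvalue (X i w)) = (c <= X i0 w)) \/
    1 <= \sum_i (X i w != X i0 w)%:R :> R.
  have [/forallP h|/forallPn[i hi]] := boolP [forall i, X i w == X i0 w].
    left; rewrite -(@pvalue_le _ (X i0 w)) cE opprB addrCA subrr addr0 -(BH_event_cst _ n0).
    by congr BH_event; apply/funext => i; rewrite (eqP (h i)).
  right; rewrite (bigD1 i)//= hi lerDl sumr_ge0//.
have bool_le1 (b : bool) : b%:R <= 1 :> R by case: b.
have bE := bounded_mfun_bool R mE; have bray := bounded_mfun_bool R mray.
apply/eqP; rewrite eq_le; apply/andP; split.
- rewrite -[leRHS]addr0 -[in leRHS]rayE -neE -RintegralD_bounded//.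
  apply: le_Rintegral_bounded => //; first exact: bounded_mfunD.
  move=> w; case: (same w) => [->|h]; first by rewrite lerDl sumr_ge0.
  by apply: le_trans (ler_wpDl (ler0n _ _) h); exact: bool_le1.
- rewrite -rayE -[leRHS]addr0 -neE -RintegralD_bounded//.
  apply: le_Rintegral_bounded => //; first exact: bounded_mfunD.
  move=> w; case: (same w) => [->|h]; first by rewrite lerDl sumr_ge0.
  by apply: le_trans (ler_wpDl (ler0n _ _) h); exact: bool_le1.
Qed.

Lemma cvg_fdr1 : fdr n @[n --> \oo] --> alpha.
Proof.
apply: cvg_near_cst; near=> n; apply: fdr1.
by near: n; exact: nbhs_infty_gt.
Unshelve. all: by end_near. Qed.

End equal.

Section one_factor_limit.
Context (rho : R).
Hypothesis rho01 : 0 < rho < 1.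
Hypothesis hX : forall n, equicorrelated_normal (@X n) (fun=> 0) rho.

Let tau n := Num.sqrt (rho + (1 - rho) / n%:R) - Num.sqrt ((1 - rho) / n%:R).

Let tau0 n : 0 < tau n.
Proof.
have /andP[r0 r1] := rho01.
have h : 0 <= (1 - rho) / n%:R by rewrite divr_ge0// subr_ge0 ltW.
by rewrite subr_gt0 ltr_sqrt ?ltr_pwDl// addr_gt0.
Qed.

Let cvg_tau : tau n @[n --> \oo] --> Num.sqrt rho.
Proof.
have h : (1 - rho) / n%:R @[n --> \oo] --> (0 : R).
  by rewrite -[X in _ --> X](mulr0 (1 - rho)); apply: cvgMr; exact: cvg_invn.
rewrite -[X in _ --> X]subr0 -[X in _ --> _ - X](@sqrtr0 R) -[in X in _ --> X](addr0 rho).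
apply: cvgB; apply: (continuous_cvg _ (@sqrt_continuous R _)) => //.
by apply: cvgD => //; exact: cvg_cst.
Qed.

Let srho0 : 0 < Num.sqrt rho.
Proof. by have /andP[r0 _] := rho01; rewrite sqrtr_gt0. Qed.

Let cvg_Phi_tau z : Phi (Num.sqrt rho * z / tau n) @[n --> \oo] --> Phi z.
Proof.
apply: (continuous_cvg _ (@continuous_Phi R z)).
have {2}-> : z = Num.sqrt rho * z / Num.sqrt rho by rewrite mulrAC divff ?gt_eqF// mul1r.
by apply: cvgMr; apply: cvgV => //; rewrite gt_eqF.
Qed.

Let cvg_error (k e : R) : k * (n%:R * e)^-1 @[n --> \oo] --> (0 : R).
Proof.
rewrite -[X in _ --> X](mulr0 k); apply: cvgMr.
under eq_fun do rewrite invfM mulrC.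
rewrite -(mulr0 e^-1); apply: cvgMr; exact: cvg_invn.
Qed.

Let sigma01 : 0 < Num.sqrt (1 - rho) < 1.
Proof.
have /andP[r0 r1] := rho01; rewrite sqrtr_gt0 subr_gt0 r1/=.
by rewrite -[ltRHS]sqrtr1 ltr_sqrt// gtrBl.
Qed.

Let limit := inf [set threshold alpha rho t | t in `]0, 1[ ].

Let fdr_lower e : 0 < e -> \forall n \near \oo, 1 - Phi limit - e <= fdr n.
Proof.
(* Three errors of size [e / 4] arise: the shift of the threshold, the replacement of [sqrt rho] by
   [tau n], and Chebyshev's bound. *)
move=> e0; have e40 : 0 < e / 4 by lra.
have [s [c [s01 cE hs]]] := lower_parameters alpha01 rho01 e40.
rewrite -/limit in hs.
set q := 1 - Phi _ in hs; pose eta := (q - s) / 2.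
have eta0 : 0 < eta by rewrite divr_gt0// subr_gt0.
have PhiI : `|Phi (limit + e / 4) - Phi limit| <= e / 4.
  by apply: (le_trans (Phi_lip _ _)); rewrite addrC addKr gtr0_norm.
near=> n.
have n0 : (0 < n)%N by near: n; exact: nbhs_infty_gt.
have [B [Y [whiteY mB lawB XE]]] : exists (B : T n -> R) (Y : 'I_n -> T n -> R),
  [/\ white (P n) Y, measurable_fun setT B,
    forall A : set R, measurable A -> P n (B @^-1` A) = gamma ((fun z => tau n * z) @^-1` A) &
    forall i w, X i w = B w + Num.sqrt (1 - rho) * Y i w].
  have /andP[r0 r1] := rho01.
  exact: (equicorrelated_decomposition (hX n) n0 (ltW r0) r1).
have := @one_factor_lower _ _ _ _ _ _ _ _ _ _ _ n0 alpha01 sigma01 (tau0 n) whiteY mB lawB XE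
  s c (Num.sqrt rho * (limit + e / 4)) eta s01 cE eta0.
rewrite -/q -/(fdr n) => H.
have : s + 2 * eta <= q by rewrite /eta; lra.
move=> /H{H}H.
have : eta^-1 <= n%:R by near: n; exact: nbhs_infty_ger.
move=> /H{H}.
have : `|Phi (limit + e / 4) - Phi (Num.sqrt rho * (limit + e / 4) / tau n)| <= e / 4.
  by near: n; apply: (cvgrPdist_le _ _).1 => //; exact: cvg_Phi_tau.
have : `|0 - 1 * (n%:R * eta ^+ 2)^-1| <= e / 4.
  by near: n; apply: (cvgrPdist_le _ _).1 => //; exact: cvg_error.
rewrite mul1r; move: PhiI; rewrite !ler_norml; lra.
Unshelve. all: by end_near. Qed.

Let fdr_upper e : 0 < e -> \forall n \near \oo, fdr n <= 1 - Phi limit + e.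
Proof.
(* All four quarters are spent here: the fourth bounds the first moment term of [upper_grid]. *)
move=> e0; have e40 : 0 < e / 4 by lra.
have [x0 [delta [eta [m [delta0 x0E C0 eta0 [hD hI]]]]]] := upper_grid alpha01 rho01 e40.
rewrite -/limit in hD hI.
have PhiI : `|Phi (limit - e / 4) - Phi limit| <= e / 4.
  by apply: (le_trans (Phi_lip _ _)); rewrite addrC addKr normrN gtr0_norm.
near=> n.
have n0 : (0 < n)%N by near: n; exact: nbhs_infty_gt.
have [B [Y [whiteY mB lawB XE]]] : exists (B : T n -> R) (Y : 'I_n -> T n -> R),
  [/\ white (P n) Y, measurable_fun setT B,
    forall A : set R, measurable A -> P n (B @^-1` A) = gamma ((fun z => tau n * z) @^-1` A) &
    forall i w, X i w = B w + Num.sqrt (1 - rho) * Y i w].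
  have /andP[r0 r1] := rho01.
  exact: (equicorrelated_decomposition (hX n) n0 (ltW r0) r1).
have := @one_factor_upper _ _ _ _ _ _ _ _ _ _ _ n0 alpha01 sigma01 (tau0 n) whiteY mB lawB XE
  _ x0 delta eta m delta0 x0E C0 eta0 hD.
rewrite -/(fdr n).
have : `|Phi (limit - e / 4) - Phi (Num.sqrt rho * (limit - e / 4) / tau n)| <= e / 4.
  by near: n; apply: (cvgrPdist_le _ _).1 => //; exact: cvg_Phi_tau.
have : `|0 - m%:R * (n%:R * eta ^+ 2)^-1| <= e / 4.
  by near: n; apply: (cvgrPdist_le _ _).1 => //; exact: cvg_error.
move: PhiI hI; rewrite !ler_norml; lra.
Unshelve. all: by end_near. Qed.

Lemma cvg_fdr : fdr n @[n --> \oo] --> 1 - Phi limit.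
Proof.
apply/cvgrPdist_le => e e0; near=> n.
rewrite distrC ler_distl; apply/andP; split; near: n; [exact: fdr_lower|exact: fdr_upper].
Unshelve. all: by end_near. Qed.

End one_factor_limit.
End limits.

Theorem theorem4p3 (R : realType) (alpha : R) (halpha : 0 < alpha < 1) :
  (forall rho : R, 0 < rho < 1 ->
     let L := 1 - Phi (inf [set (PhiV (1 - t * alpha)
                                 - Num.sqrt (1 - rho) * PhiV (1 - t))
                                / Num.sqrt rho | t in `]0, 1[ ]) in
     lim_FDR_BH alpha rho L /\ 0 < L)
  /\ lim_FDR_BH alpha 0 alpha
  /\ lim_FDR_BH alpha 1 alpha.
Proof.
split=> [rho rho01 L|]; last split.
- split; last by rewrite subr_gt0 Phi_lt1.
  by move=> d T P X hX; apply: cvg_FDR; exact: cvg_fdr.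
- by move=> d T P X hX; apply: cvg_FDR; exact: cvg_fdr0.
- by move=> d T P X hX; apply: cvg_FDR; exact: cvg_fdr1.
Qed.
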